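(* Let $(\xi_k)_{k\ge1}$ and $(\rho_k)_{k\ge1}$ be two independent i.i.d. sequences with $\rho_k>0$ a.s., $\xi_1$ and $\ln\rho_1$ square-integrable with $\sigma_\xi^2=\mathrm{Var}(\xi_1)>0$, $\sigma_\rho^2=\mathrm{Var}(\ln\rho_1)>0$; let $\mu_\xi=\mathbf{E}\xi_1$, $\mu_\rho=\mathbf{E}\ln\rho_1$. Fix $y\ge0$ and let $\gamma^{(n)}_1$, $\theta^{(n)}$, $Y$, $\tau^n(y)$, $\tau(y)$ be as in the context. (i) If $\mu_\rho\le0$, then $\lim_{n\to\infty}\mathbf{P}(\tau^n(y)<\infty)=1$. (ii) If $\mu_\rho>0$ and there exist $C<1$ and $n_0\in\mathbb{N}^*$ such that $$\sup_{n\ge n_0}\left(\mathbf{E}\left(e^{-2\gamma^{(n)}_1}\right)\right)^n\le C,$$ then $$\lim_{n\to\infty}\mathbf{P}(\tau^n(y)<\infty)=\mathbf{P}(\tau(y)<\infty)=\frac{H(-y)}{H(0)},$$ where for $x\le0$, $$H(x)=\int_{-\infty}^x(\sigma_\xi^2+\sigma_\rho^2z^2)^{-(1/2+\mu_\rho/\sigma_\rho^2)}\exp\left(\frac{2\mu_\xi}{\sigma_\xi\sigma_\rho}\arctan\left(\frac{\sigma_\rho}{\sigma_\xi}z\right)\right)dz.$$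
   Context: Define $\xi^{(n)}_k=\mu_\xi/n+(\xi_k-\mu_\xi)/\sqrt n$, $\gamma^{(n)}_k=\mu_\rho/n+(\ln\rho_k-\mu_\rho)/\sqrt n$, $\rho^{(n)}_k=e^{\gamma^{(n)}_k}$, $\theta^{(n)}(0)=y$, $\theta^{(n)}(k/n)=\xi^{(n)}_k+\theta^{(n)}((k-1)/n)\rho^{(n)}_k$ for $k\ge1$, and $\theta^{(n)}_t=\theta^{(n)}([nt]/n)$ ($[\cdot]$ = floor). $Y_t=e^{R_t}(y+\int_{0+}^te^{-R_{s-}}dX_s)$ with $R_t=\mu_\rho t+\sigma_\rho W_t$, $X_t=\mu_\xi t+\sigma_\xi\tilde W_t$, $W,\tilde W$ independent standard Brownian motions. $\tau^n(y)=\inf\{t>0:\theta^{(n)}_t<0\}$, $\tau(y)=\inf\{t>0:Y_t<0\}$, $\inf\emptyset=+\infty$. *)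

(* Defs.v *)
From HB Require Import structures.
From mathcomp Require Import all_boot all_order all_algebra.
From mathcomp Require Import all_classical all_reals all_analysis.
Set Implicit Arguments. Unset Strict Implicit. Unset Printing Implicit Defensive.
Import Order.TTheory GRing.Theory Num.Def Num.Theory.
Import numFieldNormedType.Exports.
Local Open Scope classical_set_scope.
Local Open Scope ring_scope.

Section defs.
Context {R : realType} {d : measure_display} {T : measurableType d}.
Variable P : probability T R.

Definition mutually_independent {I : eqType} (X : I -> T -> R) : Prop :=
  (forall i, measurable_fun setT (X i)) /\
  forall (J : seq I) (B : I -> set R), uniq J -> (forall i, measurable (B i)) ->
    P [set w | forall i, i \in J -> B i (X i w)]
    = (\big[*%E/1%E]_(i <- J) P (X i @^-1` B i))%E.

Definition same_law (X Y : T -> R) : Prop :=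
  forall B : set R, measurable B -> P (X @^-1` B) = P (Y @^-1` B).

Definition indep_std_BM2 (W1 W2 : R -> T -> R) : Prop :=
  (forall t, measurable_fun setT (W1 t)) /\ (forall t, measurable_fun setT (W2 t)) /\
  (forall w, W1 0 w = 0 /\ W2 0 w = 0) /\
  (forall w, {within [set t : R | 0 <= t], continuous (fun t => W1 t w)}) /\
  (forall w, {within [set t : R | 0 <= t], continuous (fun t => W2 t w)}) /\
  (forall s t, 0 <= s -> s < t -> forall B : set R, measurable B ->
     P [set w | B (W1 t w - W1 s w)] = normal_prob 0 (Num.sqrt (t - s)) B /\
     P [set w | B (W2 t w - W2 s w)] = normal_prob 0 (Num.sqrt (t - s)) B) /\
  (forall ts : nat -> R, 0 <= ts 0%N -> (forall i, ts i < ts i.+1) ->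
     mutually_independent
       (fun bi : bool * nat =>
          let W := if bi.1 then W1 else W2 in
          fun w => W (ts bi.2.+1) w - W (ts bi.2) w)).

End defs.

(* the discrete recursion theta(0) = y, theta(k+1) = a_k + theta(k) * b_k
   (indices of a, b are shifted: a k stands for xi^{(n)}_{k+1}) *)
Fixpoint theta_seq {R : realType} (a b : nat -> R) (y : R) (k : nat) : R :=
  match k with
  | 0%N => y
  | k'.+1 => a k' + theta_seq a b y k' * b k'
  end.

(* first passage below 0: inf {t > 0 : Z t < 0}, with inf of the empty set = +oo *)
Definition ruin_time {R : realType} (Z : R -> R) : \bar R :=
  ereal_inf (EFin @` [set t | 0 < t /\ Z t < 0]).

Section model.
Context {R : realType} {d : measure_display} {T : measurableType d}.

(* xi^{(n)}_{k+1} and gamma^{(n)}_{k+1} (sequences indexed from 0) *)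
Definition xi_n (mu_xi : R) (xi : nat -> T -> R) (n k : nat) (w : T) : R :=
  mu_xi / n%:R + (xi k w - mu_xi) / Num.sqrt n%:R.
Definition gamma_n (mu_rho : R) (rho : nat -> T -> R) (n k : nat) (w : T) : R :=
  mu_rho / n%:R + (ln (rho k w) - mu_rho) / Num.sqrt n%:R.

(* theta^{(n)}_t = theta^{(n)}([nt]/n); truncn = floor on nonnegative reals (only t > 0 matters) *)
Definition theta_n (y mu_xi mu_rho : R) (xi rho : nat -> T -> R) (n : nat) (w : T)
  (t : R) : R :=
  theta_seq (fun k => xi_n mu_xi xi n k w) (fun k => expR (gamma_n mu_rho rho n k w)) y
    (Num.truncn (n%:R * t)).

Definition tau_n y mu_xi mu_rho xi rho n (w : T) : \bar R :=
  ruin_time (theta_n y mu_xi mu_rho xi rho n w).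

End model.

Definition riemann_sum {R : realType} {T : Type} (Rp Xp : R -> T -> R) (m : nat) (t : R)
  (w : T) : R :=
  \sum_(i < m) expR (- Rp (t * i%:R / m%:R) w)
                 * (Xp (t * i.+1%:R / m%:R) w - Xp (t * i%:R / m%:R) w).

Definition H_fun {R : realType} (mu_xi mu_rho s_xi s_rho : R) (x : R) : R :=
  (\int[lebesgue_measure]_(z in `]-oo, x]%classic)
     ((s_xi ^+ 2 + s_rho ^+ 2 * z ^+ 2) `^ (- (2^-1 + mu_rho / s_rho ^+ 2))
      * expR ((2 * mu_xi / (s_xi * s_rho)) * atan (s_rho / s_xi * z))))%R.

(* Main.v *)
Require Import Defs.
From HB Require Import structures.
From mathcomp Require Import all_boot all_order all_algebra.
From mathcomp Require Import all_classical all_reals all_analysis.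
From mathcomp Require Import measurable_realfun.
From mathcomp Require Import ring lra.
Import Order.TTheory GRing.Theory Num.Def Num.Theory.
Import numFieldNormedType.Exports.
Local Open Scope classical_set_scope.
Local Open Scope ring_scope.

Set Implicit Arguments.
Unset Strict Implicit.
Unset Printing Implicit Defensive.

(**
The generator of the limiting diffusion is
  [A f x = (s_xi ^ 2 + s_rho ^ 2 x ^ 2) / 2 * f'' x + (mu_xi + (mu_rho + s_rho ^ 2 / 2) x) * f' x]
and [x |-> \int_(- K)^(- x) h], with [h] the integrand of [H], is annihilated by it.  The
functional central limit theorem is avoided: a Taylor expansion, with a Lindeberg-type
dominated convergence for the remainder, shows that one step of the chain changes the mean of a
smooth function [f] by [A f / n + o(1 / n)], for centred noise with the given variances, whatever
its law.  Adding a small multiple of its square to the scale function, and clipping it, gives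
strict sub- and supersolutions of [A], hence bounds on the ruin probability of the chain which
are uniform in the time horizon.  Ruin from a high level is controlled by the moment condition
through an explicit quadratic supermartingale.  Letting [K] go to infinity yields (i) when [H]
diverges and the limit [H (- y) / H 0] otherwise.

The left-point Riemann sums of the stochastic integral, evaluated along a Brownian path, form a
chain of the same kind with Gaussian noise, so the same bounds hold for it; the moment condition
becomes [s_rho ^ 2 < mu_rho], which the assumed one implies.  At finitely many times the chain is
close to [Y] in probability.  For the upper bound, finitely many dyadic times are enough, by
continuity of the paths; for the lower bound, a chain that falls below [- del] is still below
[- del / 2] at the next time of a coarse grid, except with small probability.
*)

(* [lra] reifies the whole context; it is much faster on the comparisons alone. *)
Ltac lin :=
  repeat match goal with H := _ |- _ => clearbody H end;
  repeat match goal with H : ?A |- _ =>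
    lazymatch A with
    | is_true (Order.le _ _) => fail
    | is_true (Order.lt _ _) => fail
    | @eq _ _ _ => fail
    | and _ _ => fail
    | _ => lazymatch type of A with Prop => clear H end
    end
  end; lra.

(** * Taylor expansion of one step *)

Section taylor.
Context {R : realType}.
Implicit Types (F : R -> R) (lo hi x h : R).

(** Two obstacles shape the argument. Ruin concerns an infinite horizon, so errors of order
    [o (1 / n)] may not be summed over the steps. The square added to the scale function removes
    this: on compacts it gives the generator a margin of fixed sign, so that each step absorbs its
    own error. Secondly, the noise has just two moments, and it enters through an exponential that
    need have none. The test functions are therefore bounded: the cubic Taylor remainder is used
    while the noise is small and the bound of the function otherwise, which leaves a multiple of
    [w ^ 2 * min (1, w)] to integrate. Clipping supplies this boundedness; the function stays
    unchanged on a neighbourhood of the interval on which the generator is evaluated. Jumps across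
    the ruin level do no harm: the supersolution is at least 1 everywhere below 0, and the
    subsolution is normalised at a level slightly below the ruin level, the loss being recovered by
    continuity of the scale function. *)

Lemma mvt_bound (F F1 : R -> R) lo hi x h B :
  (forall t, lo < t < hi -> is_derive t (1 : R) F (F1 t)) ->
  lo < x < hi -> lo < x + h < hi ->
  (forall t, `|t - x| <= `|h| -> lo < t < hi -> `|F1 t| <= B) ->
  `|F (x + h) - F x| <= B * `|h|.
Proof.
move=> dF /andP[lx xh] /andP[lxh xhh] FB.
have key a b : a < b -> lo < a -> b < hi ->
    exists2 c, a < c < b & F b - F a = F1 c * (b - a).
  move=> ab la bh.
  have [c|c|c] := @MVT R F F1 a b ab.
  - by rewrite in_itv/= => /andP[ac cb]; apply: dF; apply/andP; split; lin.
  - apply: derivable_within_continuous => z; rewrite in_itv/= => /andP[az zb].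
    by have := dF z; case=> //; apply/andP; split; lin.
  - by rewrite in_itv/=; exists c.
have [h0|h0|->] := ltgtP h 0; last first.
- by rewrite addr0 subrr !normr0 mulr0.
- have [||| c /andP[c1 c2] ->] := key x (x + h); try lin.
  have -> : x + h - x = h by ring.
  rewrite normrM ler_wpM2r//; apply: FB; last by apply/andP; split; lin.
  by rewrite !gtr0_norm//; lin.
- have [||| c /andP[c1 c2]] := key (x + h) x; try lin.
  rewrite distrC => ->.
  have -> : x - (x + h) = - h by ring.
  rewrite normrM normrN ler_wpM2r//; apply: FB; last by apply/andP; split; lin.
  by rewrite !ltr0_norm//; lin.
Qed.

(** Three uses of [mvt_bound], each on the remainder of one order higher. Since [mvt_bound] asks for
    the derivative bound only within distance [|h|] of [x], a bound [C * |t - x| ^ k] may be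
    replaced by [C * |h| ^ k]. The factor 1/6 is given up. *)
Lemma taylor2_bound (F F1 F2 F3 : R -> R) lo hi x h C :
  (forall t, lo < t < hi -> is_derive t (1 : R) F (F1 t)) ->
  (forall t, lo < t < hi -> is_derive t (1 : R) F1 (F2 t)) ->
  (forall t, lo < t < hi -> is_derive t (1 : R) F2 (F3 t)) ->
  lo < x < hi -> lo < x + h < hi ->
  (forall t, lo < t < hi -> `|F3 t| <= C) ->
  `|F (x + h) - F x - F1 x * h - F2 x * h ^+ 2 / 2| <= C * `|h| ^+ 3.
Proof.
move=> dF dF1 dF2 xI xhI F3C.
have C0 : 0 <= C by apply: le_trans (F3C _ xI).
have b2 t : lo < t < hi -> `|F2 t - F2 x| <= C * `|t - x|.
  move=> tI; have := @mvt_bound F2 F3 lo hi x (t - x) C dF2 xI.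
  by rewrite subrKC; apply => // s _; exact: F3C.
have b1 t : lo < t < hi -> `|F1 t - F1 x - F2 x * (t - x)| <= C * `|t - x| ^+ 2.
  move=> tI.
  have := @mvt_bound (fun s => F1 s - F2 x * (s - x)) (fun s => F2 s - F2 x)
    lo hi x (t - x) (C * `|t - x|) _ xI.
  rewrite subrKC subrr mulr0 subr0.
  have -> : F1 t - F2 x * (t - x) - F1 x = F1 t - F1 x - F2 x * (t - x) by ring.
  rewrite -mulrA -expr2; apply => //.
  - move=> s sI; have := dF1 s sI => ?.
    by apply: is_derive_eq; rewrite /GRing.scale/=; ring.
  - move=> s sx sI; apply: (le_trans (b2 _ sI)).
    by rewrite ler_wpM2l.
have := @mvt_bound (fun s => F s - F1 x * (s - x) - F2 x * (s - x) ^+ 2 / 2)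
  (fun s => F1 s - F1 x - F2 x * (s - x))
    lo hi x h (C * `|h| ^+ 2) _ xI.
have -> : F (x + h) - F1 x * (x + h - x) - F2 x * (x + h - x) ^+ 2 / 2 -
   (F x - F1 x * (x - x) - F2 x * (x - x) ^+ 2 / 2) =
   F (x + h) - F x - F1 x * h - F2 x * h ^+ 2 / 2 by field.
have -> : C * `|h| ^+ 3 = C * `|h| ^+ 2 * `|h| by ring.
apply => //.
- move=> s sI; have := dF s sI => ?.
  by apply: is_derive_eq; rewrite /GRing.scale/=; field.
- move=> s sx sI; apply: (le_trans (b1 _ sI)).
  by rewrite ler_wpM2l// ler_sqr ?nnegrE.
Qed.

End taylor.

(** * Order estimates with explicit constants *)

Section order_calculus.
Context {R : realType}.
Implicit Types (K w p q : R) (k : nat).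

(** Reads [p = O (w ^ k)] with constant [K]. The sign of [K] is bundled so that products compose,
    and constants are built by the lemmas instead of being written out. *)
Definition bd K w k p := 0 <= K /\ `|p| <= K * w ^+ k.

Lemma bdD K K' w k p q : bd K w k p -> bd K' w k q -> bd (K + K') w k (p + q).
Proof.
move=> [K0 Kp] [K0' Kq]; split; first exact: addr_ge0.
by rewrite mulrDl (le_trans (ler_normD _ _))// lerD.
Qed.

Lemma bdN K w k p : bd K w k p -> bd K w k (- p).
Proof. by rewrite /bd normrN. Qed.

Lemma bdB K K' w k p q : bd K w k p -> bd K' w k q -> bd (K + K') w k (p - q).
Proof. by move=> Kp Kq; apply: bdD => //; exact: bdN. Qed.

Lemma bdM K K' w k k' p q :
  bd K w k p -> bd K' w k' q -> bd (K * K') w (k + k') (p * q).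
Proof.
move=> [K0 Kp] [K0' Kq]; split; first exact: mulr_ge0.
by rewrite exprD mulrACA normrM ler_pM.
Qed.

Lemma bdZ K K' w k p q : bd K w 0 p -> bd K' w k q -> bd (K * K') w k (p * q).
Proof. exact: bdM. Qed.

Lemma bd_cst p w : bd `|p| w 0 p.
Proof. by split=> //; rewrite mulr1. Qed.

Lemma bd_dec K w k k' p : 0 <= w -> w <= 1 ->
  bd K w k' p -> (k <= k')%N -> bd K w k p.
Proof.
move=> w0 w1 [K0 Kp] kk'; split=> //; apply: (le_trans Kp).
by rewrite ler_wpM2l// ler_wiXn2l.
Qed.

Lemma bd_inc K w k k' p : 1 <= w -> bd K w k p -> (k <= k')%N -> bd K w k' p.
Proof.
move=> w1 [K0 Kp] kk'; split=> //; apply: (le_trans Kp).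
by rewrite ler_wpM2l// ler_weXn2l.
Qed.

Lemma bd_norm_mul K C w k p q : 0 <= C -> `|p| <= C * `|q| ^+ 3 ->
  bd K w k (q * q * q) -> bd (C * K) w k p.
Proof.
move=> C0 pq [K0 Kq]; split; first exact: mulr_ge0.
apply: (le_trans pq); rewrite -mulrA ler_wpM2l//.
by have -> : `|q| ^+ 3 = `|q * q * q| by rewrite !normrM; ring.
Qed.

Lemma expR_taylor2 (G g : R) : `|g| <= G ->
  `|expR g - 1 - g - g ^+ 2 / 2| <= expR (G + 1) * `|g| ^+ 3.
Proof.
move=> gG.
have dE t : is_derive t (1 : R) expR (expR t) by exact: is_derive_expR.
have G0 : 0 <= G by rewrite (le_trans _ gG).
have := @taylor2_bound R expR expR expR expR (- (G + 1)) (G + 1) 0 g (expR (G + 1))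
  (fun t _ => dE t) (fun t _ => dE t) (fun t _ => dE t).
rewrite add0r expR0 !mul1r; apply.
- by apply/andP; split; lin.
- by move: gG; rewrite ler_norml => /andP[? ?]; apply/andP; split; lin.
- by move=> t /andP[_ tG]; rewrite gtr0_norm ?expR_gt0// ler_expR ltW.
Qed.

End order_calculus.

(** * Expansion of a test function along one step of the chain *)

Section step_taylor.
Context {R : realType} (mx mr X M C : R) (c : bool).
Hypotheses (X0 : 0 <= X) (M0 : 0 <= M) (C0 : 0 <= C).

(* With [t = 1 / sqrt n], [c = false] is the recursion of [theta^(n)]; [c = true] multiplies
   the noise too by the exponential, which is the recursion of the left-point Riemann sums
   for [Y]. *)
Definition step (t x a b : R) :=
  (mx * t ^+ 2 + a * t) * expR (mr * t ^+ 2 + b * t) ^+ c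
  + x * expR (mr * t ^+ 2 + b * t).
(** The increment [step t x a b - x] up to third order in [t]. The term [(b * t) ^ 2 / 2] is the
    source of the Ito correction in the drift. *)
Definition lin_part (t x a b : R) :=
  mx * t ^+ 2 + a * t + x * (mr * t ^+ 2 + b * t + (b * t) ^+ 2 / 2)
  + c%:R * (a * t) * (b * t).

(** The cubic remainder is required for every [h], although [f] need be smooth only near [x]: for
    large [h] it follows from boundedness, so clipped functions qualify. The numbers [u1], [u2] play
    the derivatives at [x]. *)
Definition taylor_at (f : R -> R) x u1 u2 :=
  [/\ forall y, `|f y| <= M, `|u1| <= C, `|u2| <= C
    & forall h, `|f (x + h) - f x - u1 * h - u2 * h ^+ 2 / 2| <= C * `|h| ^+ 3].

Let rem (f : R -> R) x u1 u2 t a b :=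
  f (step t x a b) - f x - u1 * lin_part t x a b
    - u2 / 2 * (a * t + x * (b * t)) ^+ 2.

(** With [w] dominating [t], [|a * t|] and [|b * t|], the remainder is cubic in [w] here and
    quadratic in [step_large]; together they bound it by a multiple of [w ^ 2 * min (1, w)]. *)
Lemma step_small : exists K : R, forall (f : R -> R) (x u1 u2 t a b w : R), taylor_at f x u1 u2 ->
  `|x| <= X -> 0 <= t -> t <= w -> `|a * t| <= w -> `|b * t| <= w -> w <= 1 ->
  `|rem f x u1 u2 t a b| <= K * w ^+ 3.
Proof.
(* The constant is an existential variable created before [f], [x] and the noise are introduced,
   hence independent of them; the composed bound on the last line instantiates it. *)
eexists => f x u1 u2 t a b w [_ u1C u2C fT] xX t0 tw aw bw w1.
have w0 : 0 <= w by exact: le_trans tw.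
have Bt : bd 1 w 1 t by split => //; rewrite mul1r ger0_norm.
have Bs : bd 1 w 2 (t ^+ 2) by rewrite -(mulr1 1) expr2; apply: (bdM Bt Bt).
have Bs1 : bd 1 w 1 (t ^+ 2) by apply: (bd_dec w0 w1 Bs).
have Ba : bd 1 w 1 (a * t) by split => //; rewrite mul1r.
have Bb : bd 1 w 1 (b * t) by split => //; rewrite mul1r.
have Bx : bd X w 0 x by split => //; rewrite mulr1.
have Bu1 : bd C w 0 u1 by split => //; rewrite mulr1.
have Bu2 : bd C w 0 u2 by split => //; rewrite mulr1.
have Bh : bd `|2^-1| w 0 (2^-1 : R) := bd_cst _ _.
have Bc : bd 1 w 0 (c%:R : R) by split => //; rewrite !mulr1; case: (c); rewrite ?normr1 ?normr0.
have Bxi := bdD (bdZ (bd_cst mx w) Bs1) Ba.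
have Bg := bdD (bdZ (bd_cst mr w) Bs1) Bb.
set xi := mx * t ^+ 2 + a * t in Bxi.
set g := mr * t ^+ 2 + b * t in Bg.
set G := (X in bd X _ _ g) in Bg.
pose r3 := expR g - 1 - g - g ^+ 2 / 2.
have Br3 : bd (expR (G + 1) * G ^+ 3) w 3 r3.
  have [G0 gG] := Bg; split; first by rewrite mulr_ge0 ?expR_ge0 ?exprn_ge0.
  apply: (le_trans (@expR_taylor2 R G g _)).
    by apply: (le_trans gG); rewrite ler_piMr// expr1.
  by rewrite -mulrA ler_wpM2l ?expR_ge0// -exprMn ler_pXn2r ?nnegrE// ?mulr_ge0//.
have Bg2 := bdZ Bh (bdM Bg Bg).
have Br2 := bdD (bd_dec (k := 2) w0 w1 Br3 isT) Bg2.
have Bk := bdD (bd_dec (k := 1) w0 w1 Br2 isT) Bg.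
(* The error of [lin_part], arranged so that each summand is visibly of order 3;
   [g ^ 2 - (b * t) ^ 2] has been factored as [mr * t ^ 2 * (g + b * t)]. *)
pose E := c%:R * (xi * (r3 + 2^-1 * (g * g)) + (mx * t ^+ 2 * g + (a * t) * (mr * t ^+ 2)))
    + x * (2^-1 * (mr * t ^+ 2 * (g + b * t)) + r3).
have BE := bdD (bdZ Bc (bdD (bdM Bxi Br2) (bdD (bdM (bdZ (bd_cst mx w) Bs) Bg) (bdM Ba (bdZ (bd_cst mr w) Bs)))))
    (bdZ Bx (bdD (bdZ Bh (bdM (bdZ (bd_cst mr w) Bs) (bdD Bg Bb))) Br3)).
rewrite -/E in BE.
pose D := step t x a b - x.
have kE : expR g = 1 + (r3 + 2^-1 * (g * g) + g) by rewrite /r3; field.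
have DE : D = lin_part t x a b + E.
  rewrite /D /step /lin_part -/xi -/g /E.
  have -> : expR g ^+ c = 1 + c%:R * (expR g - 1).
    by case: (c); rewrite /= ?expr0 ?expr1; ring.
  by rewrite {2}kE {1}kE /xi /g; field.
have Bbb := bdZ Bh (bdM Bb Bb).
have Bab := bdZ Bc (bdM Ba Bb).
pose L2 := mx * t ^+ 2 + (x * (mr * t ^+ 2 + 2^-1 * ((b * t) * (b * t))) + c%:R * ((a * t) * (b * t))).
have BL2 := bdD (bdZ (bd_cst mx w) Bs) (bdD (bdZ Bx (bdD (bdZ (bd_cst mr w) Bs) Bbb)) Bab).
rewrite -/L2 in BL2.
have LE : lin_part t x a b = L2 + (a * t + x * (b * t)) by rewrite /lin_part /L2; field.
have Bq := bdD Ba (bdZ Bx Bb).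
have BDq := bdD BL2 (bd_dec (k := 2) w0 w1 BE isT).
have BD := bdD (bd_dec (k := 1) w0 w1 BDq isT) Bq.
have DE' : D = L2 + E + (a * t + x * (b * t)) by rewrite DE LE; ring.
rewrite -DE' in BD.
(* With [q = a * t + x * (b * t)], the quadratic terms differ by
   [D ^ 2 - q ^ 2 = (D - q) * (D + q)], where [D - q = L2 + E] has order 2 and [D + q] order 1. *)
have -> : rem f x u1 u2 t a b = (f (x + D) - f x - u1 * D - u2 * D ^+ 2 / 2)
   + (u1 * E + u2 * (2^-1 * ((L2 + E) * (D + (a * t + x * (b * t)))))).
  rewrite /rem.
  have -> : x + D = step t x a b by rewrite /D; ring.
  have -> : u1 * E = u1 * (D - lin_part t x a b) by rewrite DE; ring.
  have -> : L2 + E = D - (a * t + x * (b * t)) by rewrite DE'; ring.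
  by field.
have BT := bdD (bdZ Bu1 BE) (bdZ Bu2 (bdZ Bh (bdM BDq (bdD BD Bq)))).
have BF := bd_norm_mul C0 (fT D) (bdM (bdM BD BD) BD).
exact: (bdD BF BT).2.
Qed.

(** The value of [f] after the step enters only through the bound [M], so the size of the
    exponential is irrelevant; what remains is quadratic in the noise. *)
Lemma step_large : exists K : R, forall (f : R -> R) (x u1 u2 t a b w : R), taylor_at f x u1 u2 ->
  `|x| <= X -> 0 <= t -> t <= 1 -> `|a * t| <= w -> `|b * t| <= w -> 1 <= w ->
  `|rem f x u1 u2 t a b| <= K * w ^+ 2.
Proof.
eexists => f x u1 u2 t a b w [fM u1C u2C _] xX t0 t1 aw bw w1.
have w0 : 0 <= w by exact: le_trans w1.
have Bs : bd 1 w 0 (t ^+ 2) by split=> //; rewrite mulr1 ger0_norm ?exprn_ge0// exprn_ile1.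
have Bs2 := bd_inc (k' := 2) w1 Bs isT.
have Ba : bd 1 w 1 (a * t) by split => //; rewrite mul1r.
have Bb : bd 1 w 1 (b * t) by split => //; rewrite mul1r.
have Bx : bd X w 0 x by split => //; rewrite mulr1.
have Bu1 : bd C w 0 u1 by split => //; rewrite mulr1.
have Bu2 : bd C w 0 u2 by split => //; rewrite mulr1.
have Bh : bd `|2^-1| w 0 (2^-1 : R) := bd_cst _ _.
have Bc : bd 1 w 0 (c%:R : R) by split => //; rewrite !mulr1; case: (c); rewrite ?normr1 ?normr0.
have Ba2 := bd_inc (k' := 2) w1 Ba isT.
have Bb2 := bd_inc (k' := 2) w1 Bb isT.
have Bf y : bd M w 2 (f y).
  by apply: (bd_inc (k := 0)) => //; split => //; rewrite mulr1.
have BL := bdD (bdD (bdZ (bd_cst mx w) Bs2) Ba2)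
  (bdD (bdZ Bx (bdD (bdD (bdZ (bd_cst mr w) Bs2) Bb2) (bdZ Bh (bdM Bb Bb)))) (bdZ Bc (bdM Ba Bb))).
have Bq := bdD Ba (bdZ Bx Bb).
have -> : rem f x u1 u2 t a b = (f (step t x a b) - f x) -
  (u1 * (mx * t ^+ 2 + a * t + (x * (mr * t ^+ 2 + b * t + 2^-1 * (b * t * (b * t))) + c%:R * (a * t * (b * t))))
   + u2 * (2^-1 * ((a * t + x * (b * t)) * (a * t + x * (b * t))))).
  by rewrite /rem /lin_part; field.
exact: (bdB (bdB (Bf _) (Bf _)) (bdD (bdZ Bu1 BL) (bdZ Bu2 (bdZ Bh (bdM Bq Bq))))).2.
Qed.

End step_taylor.

(** * Expectations *)

Section mean.
Context d (T : measurableType d) (R : realType) (P : probability T R).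
Implicit Types (f g : T -> R) (e r : R).

(** Integrability travels with the value, so that linear combinations, products and comparisons of
    means leave no side conditions. *)
Definition has_mean f e := P.-integrable setT (EFin \o f) /\ \int[P]_w f w = e.

Lemma mean_measurable f e : has_mean f e -> measurable_fun setT f.
Proof. by move=> [/measurable_int /measurable_EFinP]. Qed.

Lemma meanD f g e e' : has_mean f e -> has_mean g e' ->
  has_mean (fun w => f w + g w) (e + e').
Proof.
move=> [fi <-] [gi <-]; split; last exact: RintegralD.
exact: (integrableD _ fi gi).
Qed.

Lemma meanZ r f e : has_mean f e -> has_mean (fun w => r * f w) (r * e).
Proof.
move=> [fi <-]; split; last exact: RintegralZl.
exact: (integrableZl _ r fi).
Qed.

Lemma mean_cst r : has_mean (fun=> r) r.
Proof.
split; first exact: finite_measure_integrable_cst.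
by rewrite Rintegral_cst//= probability_setT mulr1.
Qed.

Lemma eq_mean f g e : (forall w, f w = g w) -> has_mean f e -> has_mean g e.
Proof. by move=> /funext ->. Qed.

Lemma mean_le f g e e' : has_mean f e -> has_mean g e' ->
  (forall w, f w <= g w) -> e <= e'.
Proof. by move=> [fi <-] [gi <-] fg; apply: le_Rintegral. Qed.

Lemma mean_dom f g e : has_mean g e -> measurable_fun setT f ->
  (forall w, `|f w| <= g w) -> has_mean f (\int[P]_w f w).
Proof.
move=> [gi _] mf fg; split=> //.
apply: le_integrable gi => //; first exact/measurable_EFinP.
move=> w _ /=; rewrite lee_fin (le_trans (fg _))//.
by rewrite ler_norm.
Qed.

Lemma mean_bounded f M : measurable_fun setT f -> (forall w, `|f w| <= M) ->
  has_mean f (\int[P]_w f w).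
Proof. by move=> mf fM; apply: (mean_dom (mean_cst M)). Qed.

Lemma meanN f e : has_mean f e -> has_mean (fun w => - f w) (- e).
Proof.
by move=> /(meanZ (-1)); rewrite mulN1r; apply: eq_mean => w; rewrite mulN1r.
Qed.

Lemma meanB f g e e' : has_mean f e -> has_mean g e' ->
  has_mean (fun w => f w - g w) (e - e').
Proof. by move=> fe ge; apply: (meanD fe (meanN ge)). Qed.

Lemma mean_ge0_EFin f e : has_mean f e -> (\int[P]_w (f w)%:E)%E = e%:E.
Proof.
move=> [fi <-]; rewrite /Rintegral fineK//.
exact: (integrable_fin_num _ fi).
Qed.

Lemma mean_of_int f e : measurable_fun setT f -> (forall w, 0 <= f w) ->
  (\int[P]_w (f w)%:E)%E = e%:E -> has_mean f e.
Proof.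
move=> mf f0 fe; split; last by rewrite /Rintegral fe.
apply/integrableP; split; first exact/measurable_EFinP.
under eq_integral do rewrite /= ger0_norm//.
by rewrite fe ltry.
Qed.

Lemma mean_norm f e : has_mean f e -> exists2 e', has_mean (fun w => `|f w|) e' & `|e| <= e'.
Proof.
move=> fe.
have ne : has_mean (fun w => `|f w|) (\int[P]_w `|f w|).
  split=> //; have [fi _] := fe.
  by have := integrable_norm fi.
exists (\int[P]_w `|f w|) => //.
rewrite ler_norml; apply/andP; split.
- by apply: (mean_le (meanN ne) fe) => w; rewrite lerNl ler_normr lexx orbT.
- by apply: (mean_le fe ne) => w; rewrite ler_norm.
Qed.

End mean.

Section mean_prod.
Context (d1 d2 : measure_display) (T1 : measurableType d1) (T2 : measurableType d2)
  (R : realType) (a : probability T1 R) (b : probability T2 R).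
Local Notation Pi := (a \x b)%E.

Lemma mean_prod f g e e' : has_mean a f e -> has_mean b g e' ->
  has_mean Pi (fun z => f z.1 * g z.2) (e * e').
Proof.
move=> fe ge.
have mf := mean_measurable fe; have mg := mean_measurable ge.
have mfg : measurable_fun setT (fun z : T1 * T2 => (f z.1 * g z.2)%:E).
  by apply/measurable_EFinP/measurable_funM; apply: measurableT_comp.
have [nf [fni fnE] _] := mean_norm fe.
have [ng [gni gnE] _] := mean_norm ge.
have gnI := mean_ge0_EFin (conj gni gnE).
have fnI := mean_ge0_EFin (conj fni fnE).
have int : Pi.-integrable setT (EFin \o (fun z => f z.1 * g z.2)).
  apply/integrable12ltyP => //=.
  rewrite (_ : (fun x => _) = (fun x => `|f x|%:E * ng%:E)%E); last first.
    apply/funext => x; under eq_integral do rewrite normrM EFinM.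
    by rewrite ge0_integralZl//= ?gnI//; apply/measurable_EFinP/measurableT_comp.
  rewrite ge0_integralZr//= ?fnI ?ltry//.
  - exact/measurable_EFinP/measurableT_comp.
  - by rewrite lee_fin -gnE Rintegral_ge0.
split=> //; rewrite /Rintegral -integral12_prod_meas1// /fubini_F/=.
rewrite (_ : (fun x => _) = (fun x => (f x * e')%:E)); last first.
  apply/funext => x; have [gi gE] := meanZ (f x) ge.
  by rewrite (mean_ge0_EFin (conj gi gE)).
have h := meanZ e' fe.
by rewrite (@mean_ge0_EFin _ _ _ _ _ (e * e'))//; move: h; rewrite mulrC; apply: eq_mean => x; rewrite mulrC.
Qed.

Lemma mean_fst f e : has_mean a f e -> has_mean Pi (fun z => f z.1) e.
Proof.
move=> fe; have := mean_prod fe (mean_cst b 1).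
by rewrite mulr1; apply: eq_mean => z; rewrite mulr1.
Qed.

Lemma mean_snd g e : has_mean b g e -> has_mean Pi (fun z => g z.2) e.
Proof.
move=> ge; have := mean_prod (mean_cst a 1) ge.
by rewrite mul1r; apply: eq_mean => z; rewrite mul1r.
Qed.

End mean_prod.

(** * The one-step operator and its generator *)

Section step_mean.
Context {R : realType} (al be : probability R R) (sx sr : R).
Hypotheses (al1 : has_mean al id 0) (al2 : has_mean al (fun a => a ^+ 2) (sx ^+ 2))
  (be1 : has_mean be id 0) (be2 : has_mean be (fun b => b ^+ 2) (sr ^+ 2)).
Local Notation Pi := (al \x be)%E.

(** Takes the value 0 at [n = 0] by the convention on inverses, so that it lies in [[0, 1]] for
    every [n]. *)
Definition mesh (n : nat) : R := (Num.sqrt n%:R)^-1.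

Lemma mesh_ge0 n : 0 <= mesh n.
Proof. by rewrite invr_ge0 sqrtr_ge0. Qed.

Lemma mesh_le1 n : mesh n <= 1.
Proof.
case: n => [|n]; first by rewrite /mesh sqrtr0 invr0.
by rewrite invf_le1 ?sqrtr_gt0 ?ltr0n// -{1}sqrtr1 ler_sqrt ?ler1n// ltr0n.
Qed.

Lemma mesh_sqr n : (0 < n)%N -> mesh n ^+ 2 = n%:R^-1.
Proof. by move=> n0; rewrite exprVn sqr_sqrtr ?ler0n. Qed.

Lemma mesh_cvg : mesh n @[n --> \oo] --> (0 : R).
Proof.
apply/cvgrPdist_le => e e0; near=> n.
have n0 : (0 < n)%N by near: n; exists 1%N.
rewrite sub0r normrN ger0_norm ?mesh_ge0//.
rewrite -ler_sqr ?nnegrE ?mesh_ge0 ?(ltW e0)// mesh_sqr//.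
have e20 : 0 < e ^+ 2 by rewrite exprn_gt0.
rewrite -[leRHS]invrK lef_pV2 ?posrE ?ltr0n ?invr_gt0//.
near: n; exact: nbhs_infty_ger.
Unshelve. all: by end_near. Qed.

Let v (z : R * R) : R := 1 + `|z.1| + `|z.2|.

Lemma measurable_sum_norm : measurable_fun setT v.
Proof.
apply: measurable_funD; last exact: measurableT_comp.
by apply: measurable_funD => //; exact: measurableT_comp.
Qed.

(** With [w = v z * t], the product [t ^ 2 * env t z] is [w ^ 2 * min (1, w)], the common bound of
    [step_small] and [step_large]. It is dominated by [v ^ 2], integrable by the second moments, and
    vanishes pointwise as [t] tends to 0; [env_cvg0] follows by dominated convergence. *)
Let env (t : R) (z : R * R) := v z ^+ 2 * minr 1 (v z * t).

Let v_ge1 z : 1 <= v z.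
Proof. by rewrite /v -addrA lerDl addr_ge0. Qed.

Lemma env_bound t z : 0 <= t -> 0 <= env t z <= v z ^+ 2.
Proof.
move=> t0; have v0 : 0 <= v z by rewrite (le_trans _ (v_ge1 z)).
rewrite mulr_ge0 ?exprn_ge0//= ?ler_piMr ?exprn_ge0// ?ge_min ?lexx//.
by rewrite le_min ler01 mulr_ge0.
Qed.

Let measurable_env t : measurable_fun setT (env t).
Proof.
have mv := measurable_sum_norm.
apply: measurable_funM; first exact: measurable_funX.
apply: measurable_minr => //.
exact: measurable_funM.
Qed.

Let mean_v2 : has_mean Pi (fun z => 3 * (1 + (z.1 ^+ 2 + z.2 ^+ 2))) (3 * (1 + (sx ^+ 2 + sr ^+ 2))).
Proof.
apply/meanZ/meanD; first exact: mean_cst.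
apply: meanD.
- exact: (mean_fst be al2).
- exact: (mean_snd al be2).
Qed.

Let v2_le z : v z ^+ 2 <= 3 * (1 + (z.1 ^+ 2 + z.2 ^+ 2)).
Proof.
rewrite -(real_normK (num_real z.1)) -(real_normK (num_real z.2)) /v.
by move: (`|z.1|) (`|z.2|) => x y; have := sqr_ge0 (x - y); have := sqr_ge0 (x - 1);
  have := sqr_ge0 (y - 1); nra.
Qed.

Lemma mean_env t : 0 <= t -> has_mean Pi (env t) (\int[Pi]_z env t z).
Proof.
move=> t0; apply: (mean_dom mean_v2) => // z.
have /andP[e0 e1] := env_bound z t0.
by rewrite ger0_norm// (le_trans e1).
Qed.

Lemma env_cvg0 eps : 0 < eps ->
  \forall n \near \oo, \int[Pi]_z env (mesh n) z <= eps.
Proof.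
move=> e0.
have [|||||] := @dominated_convergence _ _ _ Pi setT measurableT
  (fun n z => (env (mesh n) z)%:E) (fun=> 0%:E) (fun z => (3 * (1 + (z.1 ^+ 2 + z.2 ^+ 2)))%:E).
- by move=> n; exact/measurable_EFinP.
- exact: measurable_cst.
- apply/aeW => z _; apply: cvg_EFin; first exact: nearW.
  apply/cvgrPdist_le => e e1.
  have v0 : 0 < v z by rewrite (lt_le_trans _ (v_ge1 z)).
  have : mesh n @[n --> \oo] --> (0 : R) by exact: mesh_cvg.
  have d0 : 0 < e / v z ^+ 3 by rewrite divr_gt0 ?exprn_gt0.
  move/cvgrPdist_le => /(_ _ d0); apply: filterS => n /=.
  rewrite !sub0r !normrN ger0_norm ?mesh_ge0// => nd.
  have /andP[env0 _] := env_bound z (mesh_ge0 n).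
  rewrite ger0_norm// /env (@le_trans _ _ (v z ^+ 2 * (v z * mesh n)))//.
    by rewrite ler_wpM2l ?exprn_ge0 ?(ltW v0)// ge_min lexx orbT.
  rewrite mulrA -exprSr mulrC -ler_pdivlMr ?exprn_gt0//.
- exact: mean_v2.1.
- apply/aeW => z n _; rewrite /= lee_fin.
  have /andP[env0 env1] := env_bound z (mesh_ge0 n).
  by rewrite ger0_norm// (le_trans env1).
move=> _ _; rewrite integral0 => /fine_cvgP[_ /cvgrPdist_le/(_ _ e0)].
apply: filterS => n; rewrite /= sub0r normrN.
by apply: le_trans; rewrite ler_norm.
Qed.

Definition drift (mx mr x : R) := mx + x * (mr + sr ^+ 2 / 2).
Definition generator (mx mr x u1 u2 : R) :=
  u1 * drift mx mr x + u2 / 2 * (sx ^+ 2 + x ^+ 2 * sr ^+ 2).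

Definition Q (mx mr : R) (c : bool) (n : nat) (f : R -> R) (x : R) :=
  \int[Pi]_z f (step mx mr c (mesh n) x z.1 z.2).

Lemma measurable_step (mx mr : R) (c : bool) (t : R) :
  measurable_fun setT (fun p : R * (R * R) => step mx mr c t p.1 p.2.1 p.2.2).
Proof.
have m1 : measurable_fun setT (fun p : R * (R * R) => p.2.1) by exact: measurableT_comp.
have m2 : measurable_fun setT (fun p : R * (R * R) => p.2.2) by exact: measurableT_comp.
have me : measurable_fun setT (fun p : R * (R * R) => expR (mr * t ^+ 2 + p.2.2 * t)).
  apply: measurableT_comp => //; apply: measurable_funD => //.
  exact: measurable_funM.
apply: measurable_funD; last exact: measurable_funM.
apply: measurable_funM; last exact: measurable_funX.
by apply: measurable_funD => //; exact: measurable_funM.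
Qed.

Lemma measurable_step2 (mx mr : R) (c : bool) (t x : R) :
  measurable_fun setT (fun z : R * R => step mx mr c t x z.1 z.2).
Proof.
have mp : measurable_fun setT (fun z : R * R => (x, z)) by exact: measurable_fun_pair.
exact: (measurableT_comp (measurable_step mx mr c t) mp).
Qed.

(** The term carrying [c] has mean 0, being a product of independent centred variables. Hence both
    recursions have the same generator. *)
Lemma mean_lin_part (mx mr : R) (c : bool) (t x : R) :
  has_mean Pi (fun z => lin_part mx mr c t x z.1 z.2) (t ^+ 2 * drift mx mr x).
Proof.
have A := mean_fst be al1; have B := mean_snd al be1.
have B2 := mean_snd al be2; have AB := mean_prod al1 be1.
have := meanD (mean_cst Pi (mx * t ^+ 2 + x * mr * t ^+ 2)) (meanD (meanZ t A)
  (meanD (meanZ (x * t) B) (meanD (meanZ (x * t ^+ 2 / 2) B2) (meanZ (c%:R * t ^+ 2) AB)))).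
have -> : mx * t ^+ 2 + x * mr * t ^+ 2 + (t * 0 + (x * t * 0 + (x * t ^+ 2 / 2 * sr ^+ 2 + c%:R * t ^+ 2 * (0 * 0)))) = t ^+ 2 * drift mx mr x.
  by rewrite /drift; field.
by apply: eq_mean => z; rewrite /lin_part /=; field.
Qed.

Lemma mean_quad_part (t x : R) :
  has_mean Pi (fun z => (z.1 * t + x * (z.2 * t)) ^+ 2) (t ^+ 2 * (sx ^+ 2 + x ^+ 2 * sr ^+ 2)).
Proof.
have A2 := mean_fst be al2; have B2 := mean_snd al be2; have AB := mean_prod al1 be1.
have := meanD (meanZ (t ^+ 2) A2) (meanD (meanZ (x ^+ 2 * t ^+ 2) B2) (meanZ (2 * x * t ^+ 2) AB)).
have -> : t ^+ 2 * sx ^+ 2 + (x ^+ 2 * t ^+ 2 * sr ^+ 2 + 2 * x * t ^+ 2 * (0 * 0)) =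
   t ^+ 2 * (sx ^+ 2 + x ^+ 2 * sr ^+ 2) by ring.
by apply: eq_mean => z; ring.
Qed.

(** The threshold on [n] is chosen before [f] and [x]: it depends on the bounds alone, so it serves
    all test functions with these bounds and all points of the compact. *)
Lemma Q_taylor (mx mr : R) (c : bool) (X M C eps : R) : 0 <= X -> 0 <= M -> 0 <= C -> 0 < eps ->
  \forall n \near \oo, forall (f : R -> R) (x u1 u2 : R), measurable_fun setT f ->
    taylor_at M C f x u1 u2 -> `|x| <= X ->
    `|Q mx mr c n f x - f x - n%:R^-1 * generator mx mr x u1 u2| <= eps * n%:R^-1.
Proof.
move=> X0 M0 C0 eps0.
have [K1 K1P] := step_small mx mr M c X0 C0.
have [K2 K2P] := step_large mx mr c X0 M0 C0.
pose K := `|K1| + `|K2| + 1.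
have K0 : 0 < K by rewrite /K ltr_wpDl// addr_ge0.
have eK : 0 < eps / K by rewrite divr_gt0.
near=> n => f x u1 u2 mf fT xX.
have n0 : (0 < n)%N by near: n; exists 1%N.
have nE : \int[Pi]_z env (mesh n) z <= eps / K by near: n; exact: env_cvg0.
set t := mesh n in nE *.
have t0 : 0 <= t := mesh_ge0 n.
have t2 : t ^+ 2 = n%:R^-1 by rewrite mesh_sqr.
pose rem z := f (step mx mr c t x z.1 z.2) - f x - u1 * lin_part mx mr c t x z.1 z.2
    - u2 / 2 * (z.1 * t + x * (z.2 * t)) ^+ 2.
have remP z : `|rem z| <= K * t ^+ 2 * env t z.
  have v0 : 0 <= v z by rewrite (le_trans _ (v_ge1 z)).
  pose w := v z * t.
  have tw : t <= w by rewrite /w ler_peMl.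
  have aw : `|z.1 * t| <= w.
    by rewrite normrM (ger0_norm t0) ler_wpM2r// /v; have := normr_ge0 z.2; lin.
  have bw : `|z.2 * t| <= w.
    by rewrite normrM (ger0_norm t0) ler_wpM2r// /v; have := normr_ge0 z.1; lin.
  have wE : K * t ^+ 2 * env t z = K * (w ^+ 2 * minr 1 w) by rewrite /env /w; ring.
  rewrite wE.
  have w0 : 0 <= w by exact: le_trans tw.
  have [w1|w1] := leP w 1.
    apply: (le_trans (K1P f x u1 u2 t z.1 z.2 w fT xX t0 tw aw bw w1)).
    rewrite -exprSr ler_wpM2r ?exprn_ge0//.
    by rewrite /K; have := ler_norm K1; have := normr_ge0 K2; lin.
  apply: (le_trans (K2P f x u1 u2 t z.1 z.2 w fT xX t0 (mesh_le1 n) aw bw (ltW w1))).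
  rewrite mulr1 ler_wpM2r ?exprn_ge0//.
  by rewrite /K; have := ler_norm K2; have := normr_ge0 K1; lin.
have [fM _ _ _] := fT.
have mQ : has_mean Pi (fun z => f (step mx mr c t x z.1 z.2)) (Q mx mr c n f x).
  apply: (@mean_bounded _ _ _ _ _ M) => //.
  apply: measurableT_comp => //; exact: measurable_step2.
have mrem := meanB (meanB (meanB mQ (mean_cst Pi (f x))) (meanZ u1 (mean_lin_part mx mr c t x)))
  (meanZ (u2 / 2) (mean_quad_part t x)).
have [e' nrem le_e'] := mean_norm mrem.
have E : Q mx mr c n f x - f x - u1 * (t ^+ 2 * drift mx mr x) - u2 / 2 * (t ^+ 2 * (sx ^+ 2 + x ^+ 2 * sr ^+ 2))
   = Q mx mr c n f x - f x - n%:R^-1 * generator mx mr x u1 u2.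
  by rewrite t2 /generator; ring.
rewrite -E; apply: (le_trans le_e').
have := mean_le nrem (meanZ (K * t ^+ 2) (mean_env t0)) remP.
move=> /le_trans; apply.
have -> : eps * n%:R^-1 = K * t ^+ 2 * (eps / K) by rewrite t2; field; rewrite ?gt_eqF ?ltr0n.
by rewrite ler_wpM2l ?mulr_ge0 ?(ltW K0) ?exprn_ge0.
Unshelve. all: by end_near. Qed.

End step_mean.

(** * Survival probabilities of the chain *)

Section survival.
Context {R : realType} (al be : probability R R) (sx sr : R).
Hypotheses (al1 : has_mean al id 0) (al2 : has_mean al (fun a => a ^+ 2) (sx ^+ 2))
  (be1 : has_mean be id 0) (be2 : has_mean be (fun b => b ^+ 2) (sr ^+ 2)).
Local Notation Pi := (al \x be)%E.
Variables (mx mr : R) (c : bool).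
Local Notation Q := (Q al be mx mr c).

Lemma mean_Q n (f : R -> R) M x : measurable_fun setT f -> (forall y, `|f y| <= M) ->
  has_mean Pi (fun z => f (step mx mr c (mesh n) x z.1 z.2)) (Q n f x).
Proof.
move=> mf fM; apply: (@mean_bounded _ _ _ _ _ M) => //.
by apply: measurableT_comp => //; exact: measurable_step2.
Qed.

Lemma measurable_Q n (f : R -> R) : measurable_fun setT f -> (forall y, 0 <= f y) ->
  measurable_fun setT (Q n f).
Proof.
move=> mf f0.
pose g (p : R * (R * R)) := (f (step mx mr c (mesh n) p.1 p.2.1 p.2.2))%:E.
have g0 p : (0 <= g p)%E by rewrite lee_fin.
have mg : measurable_fun setT g.
  apply/measurable_EFinP.
  exact: (measurableT_comp mf (measurable_step mx mr c (mesh n))).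
pose PiP : probability (R * R)%type R := Pi.
have mG := measurable_fun_fubini_tonelli_F (m2 := PiP) g mg g0.
exact: (measurableT_comp (fine_measurable measurableT) mG).
Qed.

(* [surv n G N i x] is the probability that the chain started at [x] at time [i]
   stays in [G i], ..., [G (i + N)] at times [i], ..., [i + N]. *)
Fixpoint surv n (G : nat -> set R) (N i : nat) (x : R) : R :=
  match N with
  | 0%N => \1_(G i) x
  | N'.+1 => \1_(G i) x * Q n (surv n G N' i.+1) x
  end.

Lemma indic01 (A : set R) x : 0 <= (\1_A x : R) <= 1.
Proof. by rewrite indicE; case: (_ \in _); rewrite ?lexx ?ler01. Qed.

Lemma surv_prop n G N : (forall i, measurable (G i)) ->
  forall i, measurable_fun setT (surv n G N i) /\ forall x, 0 <= surv n G N i x <= 1.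
Proof.
move=> mG; elim: N => [|N IH] i /=.
  by split; [exact: measurable_indic|move=> x; exact: indic01].
have [mS S01] := IH i.+1; split.
  apply: measurable_funM; first exact: measurable_indic.
  by apply: measurable_Q => // y; have /andP[] := S01 y.
move=> x; have /andP[I0 I1] := indic01 (G i) x.
have nS y : `|surv n G N i.+1 y| <= 1.
  by have /andP[? ?] := S01 y; rewrite ger0_norm.
have mQ := mean_Q n x mS nS.
have Q0 : 0 <= Q n (surv n G N i.+1) x.
  by apply: (mean_le (mean_cst Pi 0) mQ) => z; have /andP[] := S01 (step mx mr c (mesh n) x z.1 z.2).
have Q1 : Q n (surv n G N i.+1) x <= 1.
  by apply: (mean_le mQ (mean_cst Pi 1)) => z; have /andP[] := S01 (step mx mr c (mesh n) x z.1 z.2).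
by rewrite mulr_ge0//= mulr_ile1.
Qed.

Lemma mean_surv n G N i x : (forall i, measurable (G i)) ->
  has_mean Pi (fun z => surv n G N i (step mx mr c (mesh n) x z.1 z.2))
    (Q n (surv n G N i) x).
Proof.
move=> mG; have [mS S01] := surv_prop n N mG i.
by apply: (@mean_Q n _ 1 x mS) => y; have /andP[? ?] := S01 y; rewrite ger0_norm.
Qed.

(** Constant in time; the index is there because [surv] takes a family of sets, which [coarse] makes
    genuinely time dependent. *)
Definition above (r : R) (_ : nat) : set R := [set x | r <= x].

Lemma measurable_above r i : measurable (above r i).
Proof.
rewrite (_ : above r i = `[r, +oo[%classic); first exact: measurable_itv.
by apply/seteqP; split => x; rewrite /= in_itv/= andbT.
Qed.

Lemma above_indic (r : R) i (x : R) : (\1_(above r i) x : R) = (r <= x)%R%:R.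
Proof. by rewrite indicE mem_setE. Qed.

(** The margin [kap] beats the error of [Q_taylor], so on [[r, K]] the mean of [psi] grows by at
    least [e = kap / 2 / n] per step. The bound [psi <= 1] covers ruin with any overshoot and
    [psi <= 0] covers escape above [K]. The term [max 0 (1 - N * e)] pays for paths still undecided:
    it decreases by at most [e] per step, which the growth of [psi] compensates. *)
Lemma sub_solution (psi u1 u2 : R -> R) r K M C kap : 0 <= M -> 0 <= C ->
  measurable_fun setT psi -> (forall x, r <= x <= K -> taylor_at M C psi x (u1 x) (u2 x)) ->
  (forall x, psi x <= 1) -> (forall x, K < x -> psi x <= 0) ->
  0 < kap -> (forall x, r <= x <= K -> kap <= generator sx sr mx mr x (u1 x) (u2 x)) ->
  \forall n \near \oo, forall N i x,
    psi x - Num.max 0 (1 - N%:R * (kap / 2 / n%:R)) <= 1 - surv n (above r) N i x.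
Proof.
move=> M0 C0 mpsi tpsi psi1 psi0 kap0 kapP.
have kap2 : 0 < kap / 2 by rewrite divr_gt0.
near=> n.
have n0 : (0 < n)%N by near: n; exists 1%N.
have T : forall (f : R -> R) (x u1 u2 : R), measurable_fun setT f ->
    taylor_at M C f x u1 u2 -> `|x| <= `|r| + `|K| ->
    `|Q n f x - f x - n%:R^-1 * generator sx sr mx mr x u1 u2| <= kap / 2 * n%:R^-1.
  by near: n; apply: (Q_taylor al1 al2 be1 be2) => //; rewrite addr_ge0.
set e := kap / 2 / n%:R.
have e0 : 0 < e by rewrite /e divr_gt0 ?ltr0n.
elim => [|N IH] i x /=.
  rewrite mul0r subr0 (max_idPr _)// above_indic.
  by have := psi1 x; case: (r <= x); rewrite /=; lin.
rewrite above_indic.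
have [rx|xr] := leP r x; last first.
  have mN : 0 <= Num.max 0 (1 - N.+1%:R * e) by rewrite le_max lexx.
  by rewrite /= mul0r; have := psi1 x; lin.
rewrite /= mul1r.
have mA := measurable_above r.
have mS := mean_surv n N i.+1 x mA.
have [Kx|xK] := ltP K x.
  have Q1 : Q n (surv n (above r) N i.+1) x <= 1.
    apply: (mean_le mS (mean_cst Pi 1)) => z.
    by have [_ /(_ (step mx mr c (mesh n) x z.1 z.2)) /andP[]] := surv_prop n N mA i.+1.
  have := psi0 _ Kx; have : 0 <= Num.max 0 (1 - N.+1%:R * e) by rewrite le_max lexx.
  lin.
have rxK : r <= x <= K by rewrite rx.
have tx := tpsi _ rxK; have [psiM _ _ _] := tx.
have mP := @mean_Q n psi M x mpsi psiM.
have Tx : `|Q n psi x - psi x - n%:R^-1 * generator sx sr mx mr x (u1 x) (u2 x)| <= e.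
  apply: T => //.
  rewrite ler_norml; apply/andP; split.
    by have := normr_ge0 K; have := ler_norm (- r); rewrite normrN; lin.
  by have := normr_ge0 r; have := ler_norm K; lin.
have gx : 2 * e <= n%:R^-1 * generator sx sr mx mr x (u1 x) (u2 x).
  have -> : 2 * e = n%:R^-1 * kap by rewrite /e; field; rewrite pnatr_eq0 -lt0n.
  by rewrite ler_wpM2l ?invr_ge0 ?ler0n// kapP.
have psiQ : psi x + e <= Q n psi x by move: Tx; rewrite ler_norml => /andP[]; lin.
set m := Num.max 0 (1 - N%:R * e) in IH.
have Sle : Q n (surv n (above r) N i.+1) x <= 1 - Q n psi x + m.
  apply: (mean_le mS (meanD (meanB (mean_cst Pi 1) mP) (mean_cst Pi m))) => z.
  by have := IH i.+1 (step mx mr c (mesh n) x z.1 z.2); lin.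
have : m - e <= Num.max 0 (1 - N.+1%:R * e).
  rewrite le_max /m; have [h|h] := leP 0 (1 - N%:R * e); last by rewrite sub0r oppr_le0 (ltW e0).
  by apply/orP; right; rewrite -natr1 mulrDl mul1r; lin.
lin.
Unshelve. all: by end_near. Qed.

(** On [[0, K]] the margin makes [f] decrease in mean, so the induction on [N] closes without any
    correction in time. Above [K] nothing is known of the generator, and a direct bound on ruin from
    there is taken as input. *)
Lemma super_solution (f u1 u2 : R -> R) K M C kap : 0 <= M -> 0 <= C ->
  measurable_fun setT f -> (forall x, 0 <= x <= K -> taylor_at M C f x (u1 x) (u2 x)) ->
  (forall x, 0 <= f x) -> (forall x, x < 0 -> 1 <= f x) ->
  0 < kap -> (forall x, 0 <= x <= K -> generator sx sr mx mr x (u1 x) (u2 x) <= - kap) ->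
  (\forall n \near \oo, forall N i x, K < x -> 1 - surv n (above 0) N i x <= f x) ->
  \forall n \near \oo, forall N i x, 1 - surv n (above 0) N i x <= f x.
Proof.
move=> M0 C0 mf tf f0 f1 kap0 kapP far.
near=> n.
have n0 : (0 < n)%N by near: n; exists 1%N.
have T : forall (f : R -> R) (x u1 u2 : R), measurable_fun setT f ->
    taylor_at M C f x u1 u2 -> `|x| <= `|K| ->
    `|Q n f x - f x - n%:R^-1 * generator sx sr mx mr x u1 u2| <= kap * n%:R^-1.
  by near: n; apply: (Q_taylor al1 al2 be1 be2).
have F : forall N i x, K < x -> 1 - surv n (above 0) N i x <= f x by near: n.
elim => [|N IH] i x.
  rewrite /= above_indic; have [x0|x0] := leP 0 x; first by have := f0 x; rewrite /=; lin.
  by have := f1 _ x0; rewrite /=; lin.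
have [Kx|xK] := ltP K x; first exact: F.
rewrite /= above_indic; have [x0|x0] := leP 0 x; last by have := f1 _ x0; rewrite /= mul0r; lin.
rewrite mul1r.
have xK0 : 0 <= x <= K by rewrite x0.
have tx := tf _ xK0; have [fM _ _ _] := tx.
have mF := @mean_Q n f M x mf fM.
have mS := mean_surv n N i.+1 x (measurable_above 0).
have Tx : `|Q n f x - f x - n%:R^-1 * generator sx sr mx mr x (u1 x) (u2 x)| <= kap * n%:R^-1.
  by apply: T => //; rewrite !ger0_norm// (le_trans x0).
have gx : n%:R^-1 * generator sx sr mx mr x (u1 x) (u2 x) <= n%:R^-1 * (- kap).
  by rewrite ler_wpM2l ?invr_ge0 ?ler0n// kapP.
have fQ : Q n f x <= f x by move: Tx gx; rewrite ler_norml => /andP[]; rewrite (mulrC kap); lin.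
have Sle : 1 - Q n f x <= Q n (surv n (above 0) N i.+1) x.
  apply: (mean_le (meanB (mean_cst Pi 1) mF) mS) => z.
  by have := IH i.+1 (step mx mr c (mesh n) x z.1 z.2); lin.
lin.
Unshelve. all: by end_near. Qed.

(** Bernoulli's inequality [1 - n * e <= (1 - e) ^ n] at [e = (1 - C) / n]. It turns the moment
    condition into a contraction at each step. *)
Lemma bernoulli_root (p C : R) n : 0 <= p -> p ^+ n <= C -> C < 1 -> (0 < n)%N ->
  p <= 1 - (1 - C) / n%:R.
Proof.
move=> p0 pC C1 n0.
have C0 : 0 <= C by apply: le_trans pC; rewrite exprn_ge0.
pose e := (1 - C) / n%:R.
have n0' : 0 < n%:R :> R by rewrite ltr0n.
have e0 : 0 <= e by rewrite divr_ge0 ?ler0n// subr_ge0 ltW.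
have e1 : e <= 1.
  rewrite /e ler_pdivrMr// mul1r (@le_trans _ _ 1)//; first by lin.
  by rewrite ler1n.
have B k : 1 - k%:R * e <= (1 - e) ^+ k.
  elim: k => [|k IH]; first by rewrite mul0r subr0.
  rewrite exprS -natr1 (@le_trans _ _ ((1 - e) * (1 - k%:R * e)))//; last first.
    by rewrite ler_wpM2l// subr_ge0.
  have : 0 <= k%:R * e ^+ 2 by rewrite mulr_ge0 ?ler0n ?sqr_ge0.
  by nra.
rewrite leNgt; apply/negP => h.
have : (1 - e) ^+ n < p ^+ n.
  by rewrite ltr_pXn2r ?nnegrE ?subr_ge0.
have := B n; have -> : n%:R * e = 1 - C by rewrite /e mulrCA divff ?mulr1// gt_eqF.
lin.
Qed.

(* Written as [(K + m) / s], the chain multiplies [s] by [e ^ (- gamma)] and adds to [m] a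
   multiple of [s]; for [A] large the quadratic [m ^ 2 + b m s + A s ^ 2] is a nonnegative
   supermartingale, at least [K ^ 2 / 2] at ruin. *)
Lemma ruin_far (C : R) : C < 1 -> exists2 A, 0 <= A & forall n p, (0 < n)%N ->
  has_mean be (fun b => expR (-2 * (mr * mesh n ^+ 2 + b * mesh n))) p ->
  p ^+ n <= C ->
  forall N i x, 0 < x -> 1 - surv n (above 0) N i x <= A / x ^+ 2.
Proof.
move=> C1.
have C1' : 0 < 1 - C by lra.
(* [B] will bound the coefficient [b]. In [A], the first summand gives [Ah] and the summand [B ^ 2]
   gives [hm]. *)
pose B := 4 * `|mx| / (1 - C).
have B0 : 0 <= B by rewrite divr_ge0 ?mulr_ge0// ltW.
pose A := (mx ^+ 2 + sx ^+ 2 + B * `|mx|) / (1 - C) + B ^+ 2.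
have A1 : 0 <= (mx ^+ 2 + sx ^+ 2 + B * `|mx|) / (1 - C).
  apply: divr_ge0; last exact: ltW.
  apply: addr_ge0; last exact: mulr_ge0.
  by apply: addr_ge0; exact: sqr_ge0.
have A0 : 0 <= A by rewrite addr_ge0// sqr_ge0.
exists (2 * A) => [|n p n0 mp pC N i0 K K0]; first by rewrite mulr_ge0.
set t := mesh n in mp.
have t2 : t ^+ 2 = n%:R^-1 by rewrite mesh_sqr.
have t20 : 0 < t ^+ 2 by rewrite t2 invr_gt0 ltr0n.
have t21 : t ^+ 2 <= 1 by rewrite exprn_ile1 ?mesh_ge0 ?mesh_le1.
pose e (b : R) := expR (- (mr * t ^+ 2 + b * t)).
have e0 b : 0 < e b by exact: expR_gt0.
have e2 b : e b ^+ 2 = expR (-2 * (mr * t ^+ 2 + b * t)).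
  by rewrite /e expr2 -expRD; congr expR; ring.
have m2 : has_mean be (fun b => e b ^+ 2) p by apply: eq_mean mp => b; rewrite e2.
have m1 : has_mean be e (\int[be]_b e b).
  apply: (mean_dom (meanD (mean_cst be 1) m2)).
    by apply: measurableT_comp => //; apply: measurableT_comp => //; apply: measurable_funD => //; exact: measurable_funM.
  by move=> b; rewrite ger0_norm ?(ltW (e0 b))//; have := sqr_ge0 (e b - 1); have := e0 b; nra.
set q := \int[be]_b e b in m1.
have p0 : 0 <= p by apply: (mean_le (mean_cst be 0) m2) => b; exact: sqr_ge0.
have q0 : 0 <= q by apply: (mean_le (mean_cst be 0) m1) => b; exact: ltW.
have qp : q <= 2^-1 * (1 + p).
  apply: (mean_le m1 (meanZ _ (meanD (mean_cst be 1) m2))) => b.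
  by have := sqr_ge0 (e b - 1); nra.
have pt : p <= 1 - (1 - C) * t ^+ 2 by rewrite t2; exact: bernoulli_root.
have Ct0 : 0 < (1 - C) * t ^+ 2 by rewrite mulr_gt0.
have q1 : (1 - C) * t ^+ 2 / 2 <= 1 - q by lin.
(* Relative to the new scale [s * e], the noise is multiplied by [e ^ (~~ c)]: for [c = true] its
   own exponential cancels. The three constants are the means of this factor, of its square and of
   its product with [e]. *)
pose k1 := if c then 1 else q.
pose k2 := if c then 1 else p.
pose k3 := if c then q else p.
have K1 : has_mean be (fun b => e b ^+ (~~ c)) k1.
  by rewrite /k1; case: (c) => /=; [exact: mean_cst|apply: eq_mean m1 => b; rewrite expr1].
have K2 : has_mean be (fun b => (e b ^+ (~~ c)) ^+ 2) k2.
  rewrite /k2; case: (c) => /=; last by apply: eq_mean m2 => b; rewrite expr1.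
  by apply: eq_mean (mean_cst be 1) => b; rewrite expr0 expr1n.
have K3 : has_mean be (fun b => e b ^+ (~~ c) * e b) k3.
  rewrite /k3; case: (c) => /=; first by apply: eq_mean m1 => b; rewrite expr0 mul1r.
  by apply: eq_mean m2 => b; rewrite expr1 expr2.
have k1_01 : 0 <= k1 <= 1 by rewrite /k1; case: (c); rewrite ?lexx ?ler01//; apply/andP; split; lin.
have k2_01 : 0 <= k2 <= 1 by rewrite /k2; case: (c); rewrite ?lexx ?ler01//; apply/andP; split; lin.
have k3_01 : 0 <= k3 <= 1 by rewrite /k3; case: (c); apply/andP; split; lin.
have X1 : has_mean al (fun a => mx * t ^+ 2 + a * t) (mx * t ^+ 2).
  have := meanD (mean_cst al (mx * t ^+ 2)) (meanZ t al1).
  by rewrite mulr0 addr0; apply: eq_mean => a; ring.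
pose v := mx ^+ 2 * t ^+ 4 + sx ^+ 2 * t ^+ 2.
have X2 : has_mean al (fun a => (mx * t ^+ 2 + a * t) ^+ 2) v.
  have := meanD (mean_cst al (mx ^+ 2 * t ^+ 4)) (meanD (meanZ (2 * mx * t ^+ 3) al1) (meanZ (t ^+ 2) al2)).
  have -> : mx ^+ 2 * t ^+ 4 + (2 * mx * t ^+ 3 * 0 + t ^+ 2 * sx ^+ 2) = v by rewrite /v; ring.
  by apply: eq_mean => a; ring.
(* Chosen so that one step preserves in mean the coefficient [b] of [m * s]. It stays bounded as [n]
   grows, since [1 - q] is at least of order [t ^ 2]. *)
pose b := 2 * mx * t ^+ 2 * k1 / (1 - q).
have q1' : 0 < 1 - q by apply: lt_le_trans q1; rewrite divr_gt0.
have bE : b * (1 - q) = 2 * mx * t ^+ 2 * k1 by rewrite /b; field; rewrite gt_eqF.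
have bB : `|b| <= B.
  have /andP[k10 k11] := k1_01.
  rewrite /b normrM normfV (gtr0_norm q1') ler_pdivrMr//.
  rewrite normrM (ger0_norm k10) normrM (gtr0_norm t20) normrM (@ger0_norm _ 2)//.
  rewrite (@le_trans _ _ (2 * `|mx| * t ^+ 2))//.
    by rewrite ler_piMr// mulr_ge0 ?(ltW t20)// mulr_ge0.
  rewrite (@le_trans _ _ (B * ((1 - C) * t ^+ 2 / 2)))//; last by rewrite ler_wpM2l.
  by rewrite le_eqVlt /B; apply/orP; left; apply/eqP; field; rewrite gt_eqF.
pose h m s := m ^+ 2 + b * m * s + A * s ^+ 2.
have Ab : b ^+ 2 <= A.
  rewrite -(real_normK (num_real b)) (@le_trans _ _ (B ^+ 2))//.
    by rewrite ler_sqr ?nnegrE.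
  by rewrite /A lerDr.
have hm m s : m ^+ 2 / 2 <= h m s.
  rewrite /h; have := sqr_ge0 (m / 2 + b * s).
  have : b ^+ 2 * s ^+ 2 <= A * s ^+ 2 by rewrite ler_wpM2r ?sqr_ge0.
  have := sqr_ge0 m; nra.
have h0 m s : 0 <= h m s by rewrite (le_trans _ (hm m s))// divr_ge0 ?sqr_ge0.
(* Says that the coefficient of [s ^ 2] does not increase in mean. *)
have Ah : v * k2 + b * (mx * t ^+ 2) * k3 <= A * (1 - p).
  have /andP[k20 k21] := k2_01; have /andP[k30 k31] := k3_01.
  have v0 : 0 <= v by apply: addr_ge0; apply: mulr_ge0; rewrite ?sqr_ge0 ?exprn_ge0 ?mesh_ge0.
  have vt : v <= (mx ^+ 2 + sx ^+ 2) * t ^+ 2.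
    rewrite /v mulrDl lerD2r ler_wpM2l ?sqr_ge0//.
    have -> : t ^+ 4 = t ^+ 2 * t ^+ 2 by ring.
    by rewrite ler_piMr// ltW.
  have bt : b * (mx * t ^+ 2) * k3 <= B * `|mx| * t ^+ 2.
    rewrite (le_trans (ler_norm _))// normrM (ger0_norm k30) normrM.
    rewrite [`|mx * t ^+ 2|]normrM (gtr0_norm t20).
    rewrite (@le_trans _ _ (`|b| * (`|mx| * t ^+ 2)))//.
      by rewrite ler_piMr// mulr_ge0// mulr_ge0// ltW.
    by rewrite -mulrA ler_wpM2r// mulr_ge0// ltW.
  have vk : v * k2 <= v by rewrite ler_piMr.
  have : A * ((1 - C) * t ^+ 2) <= A * (1 - p) by rewrite ler_wpM2l//; lin.
  have : (mx ^+ 2 + sx ^+ 2 + B * `|mx|) * t ^+ 2 <= A * ((1 - C) * t ^+ 2).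
    have -> : (mx ^+ 2 + sx ^+ 2 + B * `|mx|) * t ^+ 2 =
      (mx ^+ 2 + sx ^+ 2 + B * `|mx|) / (1 - C) * ((1 - C) * t ^+ 2).
      by field; rewrite gt_eqF.
    by rewrite ler_wpM2r ?(ltW Ct0)// /A lerDl sqr_ge0.
  lin.
have mh m s : has_mean Pi
    (fun z => h (m + (mx * t ^+ 2 + z.1 * t) * s * e z.2 ^+ (~~ c)) (s * e z.2))
    (m ^+ 2 + 2 * m * s * (mx * t ^+ 2 * k1) + s ^+ 2 * (v * k2)
      + b * (m * s * q + s ^+ 2 * (mx * t ^+ 2 * k3)) + A * s ^+ 2 * p).
  have := meanD (meanD (meanD (meanD (mean_cst Pi (m ^+ 2)) (meanZ (2 * m * s) (mean_prod X1 K1)))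
    (meanZ (s ^+ 2) (mean_prod X2 K2)))
    (meanZ b (meanD (meanZ (m * s) (mean_snd al m1)) (meanZ (s ^+ 2) (mean_prod X1 K3)))))
    (meanZ (A * s ^+ 2) (mean_snd al m2)).
  by apply: eq_mean => z; rewrite /h; ring.
have K20 : 0 < K ^+ 2 by rewrite exprn_gt0.
(* Ruin means [m < - K], whence [h m s >= m ^ 2 / 2 >= K ^ 2 / 2]. The chain starts at [m = 0],
   [s = 1], where [h] equals [A]. *)
suff main : forall N i m s, 0 < s -> 1 - surv n (above 0) N i ((K + m) / s) <= 2 / K ^+ 2 * h m s.
  have := main N i0 0 1 ltr01; rewrite addr0 divr1 /h => /le_trans; apply.
  by rewrite le_eqVlt; apply/orP; left; apply/eqP; field; rewrite gt_eqF.
elim => {N i0} [|N IH] i m s s0 /=; rewrite above_indic.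
all: have [Km|Km] := leP 0 ((K + m) / s); last first.
- rewrite /= subr0 -ler_pdivrMl ?divr_gt0// (le_trans _ (hm m s))// invf_div mulr1.
  rewrite ler_wpM2r// -(real_normK (num_real m)) ler_sqr ?nnegrE ?(ltW K0)//.
  move: Km; rewrite pmulr_llt0 ?invr_gt0// => Km.
  by rewrite ltr0_norm; lin.
- by rewrite /= subrr mulr_ge0// divr_ge0// ltW.
- rewrite /= mul0r subr0 -ler_pdivrMl ?divr_gt0// (le_trans _ (hm m s))// invf_div mulr1.
  rewrite ler_wpM2r// -(real_normK (num_real m)) ler_sqr ?nnegrE ?(ltW K0)//.
  move: Km; rewrite pmulr_llt0 ?invr_gt0// => Km.
  by rewrite ltr0_norm; lin.
rewrite /= mul1r.
have mS := mean_surv n N i.+1 ((K + m) / s) (measurable_above 0).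
have := mean_le (meanB (mean_cst Pi 1) mS) (meanZ (2 / K ^+ 2) (mh m s)).
move=> /(_ _)/le_trans; apply.
- move=> z /=.
  have -> : step mx mr c (mesh n) ((K + m) / s) z.1 z.2 =
     (K + (m + (mx * t ^+ 2 + z.1 * t) * s * e z.2 ^+ (~~ c))) / (s * e z.2).
    rewrite /step -/t -[expR (mr * t ^+ 2 + z.2 * t)]invrK -expRN -/(e z.2).
    have := e0 z.2; case: (c) => /= e00; rewrite ?expr0 ?expr1; field;
      by rewrite ?gt_eqF.
  by apply: IH; rewrite mulr_gt0.
- rewrite ler_wpM2l ?divr_ge0 ?(ltW K20)// /h.
  have : s ^+ 2 * (v * k2 + b * (mx * t ^+ 2) * k3) <= s ^+ 2 * (A * (1 - p)).
    by rewrite ler_wpM2l ?sqr_ge0.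
  have : m * s * (b * (1 - q)) = m * s * (2 * mx * t ^+ 2 * k1) by rewrite bE.
  lin.
Qed.

End survival.

Lemma is_derive_continuous {R : realType} (f : R -> R) (x a : R) :
  is_derive x (1 : R) f a -> {for x, continuous f}.
Proof. by move=> [df _]; apply/differentiable_continuous/derivable1_diffP. Qed.

Lemma segment_bounded {R : realType} (f : R -> R) (lo hi : R) :
  (forall x : R, lo <= x <= hi -> {for x, continuous f}) ->
  exists2 B : R, 0 <= B & forall x : R, lo <= x <= hi -> `|f x| <= B.
Proof.
move=> cf; have [lh|hl] := leP lo hi; last first.
  by exists 0 => // x /andP[h1 h2]; have := le_trans h1 h2; rewrite leNgt hl.
have [|c _ cP] := @EVT_max R (fun x => `|f x|) lo hi lh.
  apply: continuous_in_subspaceT => x; rewrite inE/= in_itv/= => xI.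
  by apply: continuous_comp; [exact: cf|exact: norm_continuous].
by exists `|f c| => // x xI; apply: cP; rewrite in_itv.
Qed.

(** * The scale function *)

Section clip.
Context {R : realType} (F F1 F2 F3 : R -> R) (lo hi a b r K B : R).
Hypotheses (loa : lo < a) (ar : a < r) (Kb : K < b) (bhi : b < hi).
Hypotheses (dF : forall t, lo < t < hi -> is_derive t (1 : R) F (F1 t))
  (dF1 : forall t, lo < t < hi -> is_derive t (1 : R) F1 (F2 t))
  (dF2 : forall t, lo < t < hi -> is_derive t (1 : R) F2 (F3 t)).
Hypotheses (B0 : 0 <= B) (F0B : forall t, lo < t < hi -> `|F t| <= B)
  (F1B : forall t, lo < t < hi -> `|F1 t| <= B)
  (F2B : forall t, lo < t < hi -> `|F2 t| <= B)
  (F3B : forall t, lo < t < hi -> `|F3 t| <= B).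

Definition clip (a b x : R) := minr b (maxr a x).

Lemma clip_id (x : R) : a <= x <= b -> clip a b x = x.
Proof. by move=> /andP[ax xb]; rewrite /clip (max_idPr ax) (min_idPr xb). Qed.

Lemma clip_in (x : R) : a <= b -> a <= clip a b x <= b.
Proof. by move=> ab; rewrite /clip le_min ab/= le_max lexx ge_min lexx. Qed.

(** Inside [[a, b]] clipping is the identity and Taylor applies. If [x + h] lies outside, then
    [|h| >= d], the distance from [[r, K]] to the ends of [[a, b]], and each lower power of [|h|] is
    at most [|h| ^ 3] times an inverse power of [d]. *)
Lemma clip_taylor : exists2 C : R, 0 <= C & forall x : R, r <= x <= K ->
  taylor_at B C (F \o clip a b) x (F1 x) (F2 x).
Proof.
have [la ar' Kb' bh] := And4 loa ar Kb bhi.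
pose d := minr (r - a) (b - K).
have d0 : 0 < d by rewrite lt_min !subr_gt0 ar.
pose C := B + (2 * B / d ^+ 3 + B / d ^+ 2 + B / d).
have Cd : 0 <= 2 * B / d ^+ 3 + B / d ^+ 2 + B / d.
  by rewrite !addr_ge0// divr_ge0 ?exprn_ge0 ?mulr_ge0 ?(ltW d0).
exists C => [|x /andP[rx xK]]; first by rewrite addr_ge0.
have ab : a <= b by lin.
have xI : lo < x < hi by apply/andP; split; lin.
have FcB y : `|(F \o clip a b) y| <= B.
  by apply: F0B; have /andP[] := @clip_in y ab; rewrite /= => ? ?; apply/andP; split; lin.
split=> //.
- by apply: (le_trans (F1B xI)); rewrite /C lerDl.
- by apply: (le_trans (F2B xI)); rewrite /C lerDl.
move=> h; have [/andP[ax xb]|out] := boolP (a <= x + h <= b).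
  rewrite /= !clip_id ?ax//; last by apply/andP; split; lin.
  apply: (le_trans (taylor2_bound dF dF1 dF2 xI _ F3B)); first by apply/andP; split; lin.
  by rewrite ler_wpM2r ?exprn_ge0// /C lerDl.
have dh : d <= `|h|.
  rewrite leNgt; apply/negP; rewrite lt_min !ltr_norml => /andP[/andP[? ?] /andP[? ?]].
  by move/negP: out; apply; apply/andP; split; lin.
have h0 : 0 <= `|h| by [].
have hd : 1 <= `|h| / d by rewrite ler_pdivlMr ?mul1r.
have E3 : 2 * B <= 2 * B / d ^+ 3 * `|h| ^+ 3.
  have -> : 2 * B / d ^+ 3 * `|h| ^+ 3 = 2 * B * (`|h| / d) ^+ 3 by field; rewrite gt_eqF.
  by rewrite ler_peMr ?mulr_ge0// exprn_ege1.
have E2 : B * `|h| <= B / d ^+ 2 * `|h| ^+ 3.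
  have -> : B / d ^+ 2 * `|h| ^+ 3 = B * `|h| * (`|h| / d) ^+ 2 by field; rewrite gt_eqF.
  by rewrite ler_peMr ?mulr_ge0// exprn_ege1.
have E1 : B * `|h| ^+ 2 <= B / d * `|h| ^+ 3.
  have -> : B / d * `|h| ^+ 3 = B * `|h| ^+ 2 * (`|h| / d) by field; rewrite gt_eqF.
  by rewrite ler_peMr ?mulr_ge0 ?exprn_ge0.
have n1 : `|F1 x * h| <= B * `|h| by rewrite normrM ler_wpM2r// F1B.
have n2 : `|F2 x * h ^+ 2 / 2| <= B * `|h| ^+ 2.
  rewrite normrM normrM normrX (@ger0_norm _ 2^-1)// -mulrA.
  apply: ler_pM => //; rewrite ?mulr_ge0 ?exprn_ge0 ?F2B//.
  by rewrite ler_piMr ?exprn_ge0// invf_le1 ?ler1n.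
apply: (le_trans (ler_normB _ _)); apply: (le_trans (lerD (ler_normB _ _) n2)).
apply: (le_trans (lerD (lerD (ler_normB _ _) n1) (lexx _))).
have := FcB (x + h); have := FcB x.
have : 0 <= B * `|h| ^+ 3 by rewrite mulr_ge0 ?exprn_ge0.
rewrite /C; nra.
Qed.

End clip.

Section scale.
Context {R : realType} (mx mr sx sr : R).
Hypotheses (sx0 : 0 < sx) (sr0 : 0 < sr).

Let D (z : R) := sx ^+ 2 + sr ^+ 2 * z ^+ 2.
Let N (z : R) := 2 * mx - (sr ^+ 2 + 2 * mr) * z.

Definition hdens (z : R) : R :=
  (sx ^+ 2 + sr ^+ 2 * z ^+ 2) `^ (- (2^-1 + mr / sr ^+ 2))
      * expR ((2 * mx / (sx * sr)) * atan (sr / sx * z)).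

Let D_gt0 z : 0 < D z.
Proof. by rewrite ltr_pwDl ?exprn_gt0// mulr_ge0 ?sqr_ge0. Qed.

Lemma hdens_gt0 z : 0 < hdens z.
Proof. by rewrite mulr_gt0 ?expR_gt0// powR_gt0// D_gt0. Qed.

Let dD (z : R) : is_derive z (1 : R) D (2 * sr ^+ 2 * z).
Proof. by rewrite /D; apply: is_derive_eq; rewrite /GRing.scale/=; ring. Qed.

Let dN (z : R) : is_derive z (1 : R) N (- (sr ^+ 2 + 2 * mr)).
Proof. by rewrite /N; apply: is_derive_eq; rewrite /GRing.scale/=; ring. Qed.

(** That the logarithmic derivative is [N / D] is exactly harmonicity: for [u1 = - hdens (- x)] and
    [u2] its derivative, the generator vanishes. *)
Lemma is_derive_hdens (z : R) : is_derive z (1 : R) hdens (hdens z * (N z / D z)).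
Proof.
have -> : hdens = expR \o (fun z => - (2^-1 + mr / sr ^+ 2) * (@ln R \o D) z
    + 2 * mx / (sx * sr) * (@atan R \o (fun z : R => sr / sx * z)) z).
  apply/funext => y; rewrite /hdens /powR gt_eqF ?D_gt0// -expRD//.
have dl := is_derive1_ln (D_gt0 z).
have dlD := is_derive1_comp dl (dD z).
have da : is_derive z (1 : R) (fun z => sr / sx * z) (sr / sx).
  by apply: is_derive_eq; rewrite /GRing.scale/=; ring.
have daD := is_derive1_comp (is_derive1_atan (sr / sx * z)) da.
have de : is_derive z (1 : R) (fun z => - (2^-1 + mr / sr ^+ 2) * (@ln R \o D) z
    + 2 * mx / (sx * sr) * (@atan R \o (fun z : R => sr / sx * z)) z) (N z / D z).
  apply: is_derive_eq; rewrite /GRing.scale/=.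
  have := D_gt0 z; rewrite /D /N => Dz; field.
  rewrite !gt_eqF//=.
  have -> : sx ^+ 2 + (sr * z) ^+ 2 = D z by rewrite /D exprMn.
  exact: D_gt0.
have := is_derive1_comp (is_derive_expR _) de.
by [].
Qed.

Let rr (z : R) := N z / D z.
Let rr1 (z : R) := (- (sr ^+ 2 + 2 * mr) * D z - N z * (2 * sr ^+ 2 * z)) / D z ^+ 2.

Let drr (z : R) : is_derive z (1 : R) rr (rr1 z).
Proof.
have Dz : D z != 0 by rewrite gt_eqF.
have dV := is_deriveV Dz (dD z).
have := is_deriveM (dN z) dV => h.
apply: is_derive_eq h _; rewrite /rr1 /GRing.scale/=; field.
by rewrite Dz.
Qed.

Let h1 z := hdens z * rr z.
Let h2 z := hdens z * (rr z ^+ 2 + rr1 z).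

Let dh1 (z : R) : is_derive z (1 : R) h1 (h2 z).
Proof.
have := is_deriveM (is_derive_hdens z) (drr z) => h.
by apply: is_derive_eq h _; rewrite /h2 /h1 /rr /GRing.scale/=; ring.
Qed.

Let rr1_continuous z : {for z, continuous rr1}.
Proof.
have cD : {for z, continuous D} by exact: is_derive_continuous (dD z).
have cN : {for z, continuous N} by exact: is_derive_continuous (dN z).
apply: cvgM.
  apply: cvgB; first by apply: cvgM => //; exact: cvg_cst.
  by apply: cvgM => //; apply: cvgM => //; exact: cvg_cst.
apply: cvgV; first by rewrite expf_neq0// gt_eqF.
exact: cvgM.
Qed.

Let h2_continuous z : {for z, continuous h2}.
Proof.
apply: cvgM; first exact: is_derive_continuous (is_derive_hdens z).
apply: cvgD; last exact: rr1_continuous.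
by apply: cvgM; exact: is_derive_continuous (drr z).
Qed.

Lemma hdens_continuous : continuous hdens.
Proof. by move=> z; exact: is_derive_continuous (is_derive_hdens z). Qed.

Lemma measurable_hdens : measurable_fun setT hdens.
Proof. by apply: continuous_measurable_fun; exact: hdens_continuous. Qed.

(** The scale function up to sign and an additive constant, reflected because [H] is evaluated at
    [- y]. The base point [L] lies beyond all points of interest, so that the fundamental theorem of
    calculus applies around each of them. *)
Definition qscale (L x : R) : R := \int[lebesgue_measure]_(z in `[- L, - x]) hdens z.

Lemma hdens_integrable (u v : R) :
  lebesgue_measure.-integrable `[u, v] (EFin \o hdens).
Proof.
apply: continuous_compact_integrable; first exact: segment_compact.
by apply: continuous_subspaceT; exact: hdens_continuous.
Qed.

Lemma is_derive_opp (f : R -> R) (x a : R) : is_derive (- x) (1 : R) f a ->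
  is_derive x (1 : R) (fun y => f (- y)) (- a).
Proof.
move=> df; have dn : is_derive x (1 : R) (fun y : R => - y) (-1).
  by apply: is_derive_eq.
by have := is_derive1_comp df dn; rewrite mulrN1.
Qed.

Lemma is_derive_qscale (L x : R) : x < L -> is_derive x (1 : R) (qscale L) (- hdens (- x)).
Proof.
move=> xL; rewrite /qscale.
apply: (@is_derive_opp (fun y => \int[lebesgue_measure]_(z in `[- L, y]) hdens z)).
have [||dF FE] := @continuous_FTC1_closed R hdens (- L) (- x) (- x + 1) _
  (hdens_integrable _ _) _ (@hdens_continuous (- x)).
- by rewrite ltrDl.
- by rewrite ltrN2.
exact: (DeriveDef dF (etrans (esym (derive1E _ _)) FE)).
Qed.

Lemma qscale_mono (L x y : R) : x <= y -> qscale L y <= qscale L x.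
Proof.
move=> xy; rewrite /qscale -lee_fin !fineK ?(integrable_fin_num _ (hdens_integrable _ _))//.
apply: ge0_subset_integral => //=.
- by apply/measurable_funTS/measurable_EFinP; exact: measurable_hdens.
- by move=> z _; rewrite lee_fin ltW// hdens_gt0.
- by apply: subset_itvl; rewrite bnd_simp lerN2.
Qed.

(* [qscale L] is annihilated by the generator, so that the generator of
   [q + lam * q ^ 2] keeps only the second-order term of the square. *)
Lemma perturbed_scale (lam k L lo hi : R) : hi < L ->
  let q x := qscale L x - k in
  let F x := q x + lam * q x ^+ 2 in
  let F1 x := - hdens (- x) * (1 + 2 * lam * q x) in
  exists F2 : R -> R, (forall x : R, generator sx sr mx mr x (F1 x) (F2 x) =
     lam * hdens (- x) ^+ 2 * (sx ^+ 2 + x ^+ 2 * sr ^+ 2)) /\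
  exists F3 : R -> R, exists2 B : R, 0 <= B & forall x : R, lo < x < hi ->
   [/\ is_derive x (1 : R) F (F1 x), is_derive x (1 : R) F1 (F2 x),
      is_derive x (1 : R) F2 (F3 x) & [/\ `|F x| <= B, `|F1 x| <= B, `|F2 x| <= B & `|F3 x| <= B]].
Proof.
move=> hiL q F F1.
pose F2 x := h1 (- x) * (1 + 2 * lam * q x) + 2 * lam * hdens (- x) ^+ 2.
pose F3 x := - h2 (- x) * (1 + 2 * lam * q x) - 6 * lam * hdens (- x) * h1 (- x).
exists F2; split.
  move=> x; rewrite /generator /drift /F1 /F2 /h1 /rr /N /D.
  have := D_gt0 (- x); rewrite /D => Dx.
  field; rewrite gt_eqF//.
  by move: Dx; congr (_ < _); ring.
exists F3.
have dq x : x < L -> is_derive x (1 : R) q (- hdens (- x)).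
  move=> xL; have := is_derive_qscale xL => ?.
  by rewrite /q; apply: is_derive_eq; rewrite subr0.
have ds x := is_derive_opp (is_derive_hdens (- x)).
have ds1 x := is_derive_opp (dh1 (- x)).
have dF x : x < L -> is_derive x (1 : R) F (F1 x).
  move=> xL; have := dq x xL => ?.
  by rewrite /F; apply: is_derive_eq; rewrite /F1 /GRing.scale/=; ring.
have dF1 x : x < L -> is_derive x (1 : R) F1 (F2 x).
  move=> xL; have := dq x xL => ?; have := ds x => ?.
  by rewrite /F1; apply: is_derive_eq; rewrite /F2 /h1 /rr /GRing.scale/=; ring.
have dF2 x : x < L -> is_derive x (1 : R) F2 (F3 x).
  move=> xL; have := dq x xL => ?; have := ds x => ?; have := ds1 x => ?.
  by rewrite /F2; apply: is_derive_eq; rewrite /F3 /h1 /rr /GRing.scale/=; ring.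
have [B1 B10 B1P] := @segment_bounded R F lo hi (fun x h => is_derive_continuous (dF x (le_lt_trans (andP h).2 hiL))).
have [B2 B20 B2P] := @segment_bounded R F1 lo hi (fun x h => is_derive_continuous (dF1 x (le_lt_trans (andP h).2 hiL))).
have [B3 B30 B3P] := @segment_bounded R F2 lo hi (fun x h => is_derive_continuous (dF2 x (le_lt_trans (andP h).2 hiL))).
have [|B4 B40 B4P] := @segment_bounded R F3 lo hi.
  move=> x /andP[_ xhi]; have xL := le_lt_trans xhi hiL.
  have cN (f : R -> R) : continuous f -> {for x, continuous (fun y => f (- y))}.
    move=> cf; apply: continuous_comp; last exact: cf.
    exact: opp_continuous.
  apply: cvgB; apply: cvgM.
  - by apply: cvgN; apply: (cN h2).
  - apply: cvgD; first exact: cvg_cst.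
    by apply: cvgM; [exact: cvg_cst|exact: is_derive_continuous (dq x xL)].
  - by apply: cvgM; [exact: cvg_cst|exact: (cN _ hdens_continuous)].
  - apply: (cN h1) => z; exact: is_derive_continuous (dh1 z).
exists (B1 + B2 + B3 + B4); first by rewrite !addr_ge0.
move=> x /andP[lx xh]; have xL := lt_trans xh hiL.
have xI : lo <= x <= hi by rewrite !ltW.
have := B1P _ xI; have := B2P _ xI; have := B3P _ xI; have := B4P _ xI.
by move=> ? ? ? ?; split; [exact: dF|exact: dF1|exact: dF2|split; lin].
Qed.

End scale.

Lemma taylor_affine {R : realType} (M C : R) (f : R -> R) (x u1 u2 k e : R) :
  0 <= k -> taylor_at M C f x u1 u2 ->
  taylor_at (k * M + `|e|) (k * C) (fun y => k * f y + e) x (k * u1) (k * u2).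
Proof.
move=> k0 [fM u1C u2C fT]; split.
- by move=> y; rewrite (le_trans (ler_normD _ _))// lerD2r normrM (ger0_norm k0) ler_wpM2l.
- by rewrite normrM (ger0_norm k0) ler_wpM2l.
- by rewrite normrM (ger0_norm k0) ler_wpM2l.
move=> h; have -> : k * f (x + h) + e - (k * f x + e) - k * u1 * h - k * u2 * h ^+ 2 / 2
   = k * (f (x + h) - f x - u1 * h - u2 * h ^+ 2 / 2) by ring.
rewrite normrM (ger0_norm k0); apply: (le_trans (ler_wpM2l k0 (fT h))); by rewrite mulrA.
Qed.

(** * Ruin bounds from the clipped, perturbed scale function *)

Section ruin_bounds.
Context {R : realType} (al be : probability R R) (sx sr : R).
Hypotheses (al1 : has_mean al id 0) (al2 : has_mean al (fun a => a ^+ 2) (sx ^+ 2))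
  (be1 : has_mean be id 0) (be2 : has_mean be (fun b => b ^+ 2) (sr ^+ 2)).
Variables (mx mr : R) (c : bool).
Hypotheses (sx0 : 0 < sx) (sr0 : 0 < sr).
Local Notation surv := (surv al be mx mr c).
Local Notation hd := (hdens mx mr sx sr).
Local Notation qs := (qscale mx mr sx sr).

(** The integral over [[- K, - x]] when [x <= K], continued smoothly a little beyond [K], where it
    is negative. A Taylor expansion at [K] needs this room. *)
Definition scale_gap (K x : R) : R := qs (K + 2) x - qs (K + 2) K.
Local Notation sc := scale_gap.

Lemma sc_mono (K x y : R) : x <= y -> sc K y <= sc K x.
Proof. by move=> xy; rewrite lerD2r; exact: qscale_mono. Qed.

Lemma measurable_sc (K : R) : measurable_fun setT (sc K).
Proof.
rewrite (_ : sc K = fun x => - (- sc K x)); last by apply/funext => x; rewrite opprK.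
apply: measurableT_comp => //; apply: nondecreasing_measurable => //.
by move=> x y xy; rewrite lerN2; exact: sc_mono.
Qed.

Lemma measurable_clip (a b : R) : measurable_fun setT (clip a b).
Proof. by apply: measurable_minr => //; exact: measurable_maxr. Qed.

Lemma sc_diag (K : R) : sc K K = 0.
Proof. by rewrite /scale_gap subrr. Qed.

Lemma sc_ge0 (K x : R) : x <= K -> 0 <= sc K x.
Proof. by move=> /(sc_mono K); rewrite sc_diag. Qed.

Lemma sc_integral (K x : R) : x <= K ->
  sc K x = \int[lebesgue_measure]_(z in `[- K, - x]) hd z.
Proof.
move=> xK; rewrite /scale_gap /qscale.
rewrite Rintegral_itvB; [|exact: hdens_integrable|by rewrite bnd_simp; lin|by rewrite bnd_simp; lin].
rewrite Rintegral_itv_obnd_cbnd//.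
apply: integrableS (hdens_integrable mx mr sx0 sr0 (- K) (- x)) => //.
exact: subset_itv_oc_cc.
Qed.

Lemma sc_gt0 (K x : R) : x < K -> 0 < sc K x.
Proof.
move=> xK.
have dq t : t < K + 2 -> is_derive t (1 : R) (qs (K + 2)) (- hd (- t)).
  exact: is_derive_qscale.
have [t||t _ E] := @MVT R (qs (K + 2)) (fun t => - hd (- t)) x K xK.
- by rewrite in_itv/= => /andP[_ tK]; apply: dq; lin.
- apply: derivable_within_continuous => t; rewrite in_itv/= => /andP[_ tK].
  by have [|] := dq t; first lin.
have : 0 < hd (- t) * (K - x) by rewrite mulr_gt0 ?hdens_gt0// subr_gt0.
by rewrite /scale_gap; lin.
Qed.

(** Up to the factor [lam], this is the generator of the perturbed scale function; its positive
    minimum on a compact provides the margin [kap]. *)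
Let h_bnd (lo hi : R) : exists2 m : R, 0 < m & forall x : R, lo <= x <= hi ->
  m <= hd (- x) ^+ 2 * (sx ^+ 2 + x ^+ 2 * sr ^+ 2).
Proof.
have [x _|B B0 BP] := @segment_bounded R (fun x => (hd (- x))^-1) lo hi.
  apply: cvgV; first by rewrite gt_eqF// hdens_gt0.
  by apply: continuous_comp; [exact: opp_continuous|exact: hdens_continuous].
have sx20 : 0 < sx ^+ 2 by rewrite exprn_gt0.
have B1 : 0 < B + 1 by rewrite ltr_wpDl.
exists ((B + 1) ^- 2 * sx ^+ 2) => [|x xI]; first by rewrite mulr_gt0// invr_gt0 exprn_gt0.
have h0 : 0 < hd (- x) by exact: hdens_gt0.
have Bx : (B + 1)^-1 <= hd (- x).
  rewrite -[leRHS]invrK lef_pV2 ?posrE ?invr_gt0//.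
  have := BP x xI; rewrite ger0_norm ?invr_ge0 ?(ltW h0)//; lin.
apply: ler_pM.
- by rewrite invr_ge0 exprn_ge0// ltW.
- exact: ltW.
- by rewrite -exprVn ler_sqr ?nnegrE ?invr_ge0 ?(ltW B1) ?(ltW h0).
- by rewrite lerDl mulr_ge0 ?sqr_ge0.
Qed.

(** The subsolution is [sc + lam * sc ^ 2], clipped to [[a, b]] and divided by its value at [a], its
    maximum. The gap between [a] and [r] is the room that clipping needs; its price is [sc K a] in
    the denominator. *)
Lemma ruin_lower (a r K eps : R) : a < r -> 0 < eps -> exists2 T : R, 0 < T &
  \forall n \near \oo, forall N i (x : R), r <= x <= K -> T * n%:R <= N%:R ->
    sc K x / sc K a - eps <= 1 - surv n (above r) N i x.
Proof.
move=> ar eps0.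
have [rK|Kr] := leP r K; last first.
  exists 1 => //; apply: nearW => n N i x /andP[rx xK].
  by have := le_trans rx xK; rewrite leNgt Kr.
have aK : a < K by exact: lt_le_trans rK.
pose b := K + 2^-1; pose hi := K + 1; pose lo := a - 1.
have qa0 : 0 < sc K a := sc_gt0 aK.
pose B := sc K a - sc K b + 1.
have qb0 : sc K b <= 0 by rewrite -(sc_diag K); apply: sc_mono; rewrite /b; lin.
have B1 : 1 <= B by rewrite /B; lin.
have B0 : 0 < B by lin.
(* The first bound keeps [q + lam * q ^ 2] nondecreasing in [q] over the values taken, which range
   from [sc K b <= 0] to [sc K a]; the second limits the cost of the perturbation to [eps]. *)
pose lam := minr (2 * B)^-1 (eps / B).
have lam0 : 0 < lam by rewrite lt_min invr_gt0 mulr_gt0// divr_gt0.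
have lamB : 2 * lam * B <= 1.
  have : lam <= (2 * B)^-1 by rewrite ge_min lexx.
  by rewrite -[leRHS]mul1r ler_pdivlMr ?mulr_gt0//; lin.
have lame : lam * B <= eps.
  have : lam <= eps / B by rewrite ge_min lexx orbT.
  by rewrite ler_pdivlMr.
have [F2 [gF [F3 [BF BF0 dF]]]] := @perturbed_scale R mx mr sx sr sx0 sr0 lam (qs (K + 2) K) (K + 2) lo hi
  (ltac:(rewrite /hi; lin)).
pose F x := sc K x + lam * sc K x ^+ 2.
pose F1 x := - hd (- x) * (1 + 2 * lam * sc K x).
have {}gF x : generator sx sr mx mr x (F1 x) (F2 x) =
    lam * (hd (- x) ^+ 2 * (sx ^+ 2 + x ^+ 2 * sr ^+ 2)) by rewrite mulrA; exact: gF.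
have {}dF t : lo < t < hi -> [/\ is_derive t (1 : R) F (F1 t), is_derive t (1 : R) F1 (F2 t),
    is_derive t (1 : R) F2 (F3 t) & [/\ `|F t| <= BF, `|F1 t| <= BF, `|F2 t| <= BF & `|F3 t| <= BF]].
  exact: dF.
have [C C0 CP] := @clip_taylor R F F1 F2 F3 lo hi a b r K BF
  (ltac:(rewrite /lo; lin)) ar (ltac:(rewrite /b; lin)) (ltac:(rewrite /b /hi; lin))
  (fun t tI => let: And4 h _ _ _ := dF t tI in h)
  (fun t tI => let: And4 _ h _ _ := dF t tI in h)
  (fun t tI => let: And4 _ _ h _ := dF t tI in h) BF0
  (fun t tI => let: And4 _ _ _ (And4 h _ _ _) := dF t tI in h)
  (fun t tI => let: And4 _ _ _ (And4 _ h _ _) := dF t tI in h)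
  (fun t tI => let: And4 _ _ _ (And4 _ _ h _) := dF t tI in h)
  (fun t tI => let: And4 _ _ _ (And4 _ _ _ h) := dF t tI in h).
have Fa0 : 0 < F a by rewrite /F ltr_pwDl// mulr_ge0 ?sqr_ge0// ltW.
pose k := (F a)^-1.
have k0 : 0 < k by rewrite invr_gt0.
pose psi y := k * (F \o clip a b) y + 0.
have [m m0 mP] := h_bnd r K.
have ab : a <= b by rewrite /b; lin.
have qclip y : sc K b <= sc K (clip a b y) <= sc K a.
  by have /andP[? ?] := clip_in y ab; rewrite !sc_mono.
have mpsi : measurable_fun setT psi.
  have mq := measurableT_comp (measurable_sc K) (measurable_clip a b).
  apply: measurable_funD => //; apply: measurable_funM => //.
  by apply: measurable_funD => //; apply: measurable_funM => //; exact: measurable_funX.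
have psi1 y : psi y <= 1.
  rewrite /psi addr0 mulrC ler_pdivrMr// mul1r /F/=.
  have /andP[] := qclip y; move: (sc K (clip a b y)) => q q1 q2.
  have l1 : 0 <= lam * (B + (sc K a + q)) by rewrite mulr_ge0 ?(ltW lam0)// /B; lin.
  have : 0 <= (sc K a - q) * (1 + lam * (sc K a + q)).
    by rewrite mulr_ge0 ?subr_ge0//; lin.
  lin.
have psi0 y : K < y -> psi y <= 0.
  move=> Ky; rewrite /psi addr0 pmulr_rle0//= /F.
  have q0 : sc K (clip a b y) <= 0.
    rewrite -(sc_diag K); apply: sc_mono.
    by rewrite /clip le_min le_max (ltW Ky) orbT andbT /b; lin.
  have /andP[qb _] := qclip y; move: (sc K (clip a b y)) q0 qb => q q0 qb.
  have l1 : 0 <= lam * (B + q) by rewrite mulr_ge0 ?(ltW lam0)// /B; lin.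
  have : 0 <= (- q) * (1 + lam * q) by rewrite mulr_ge0 ?oppr_ge0//; lin.
  lin.
pose kap := k * (lam * m).
have kap0 : 0 < kap by rewrite !mulr_gt0.
have hM : 0 <= k * BF + `|0 : R| by rewrite addr_ge0// mulr_ge0// ltW.
have hC : 0 <= k * C by rewrite mulr_ge0// ltW.
have tP (x : R) : r <= x <= K -> taylor_at (k * BF + `|0 : R|) (k * C) psi x (k * F1 x) (k * F2 x).
  by move=> xI; apply: taylor_affine; [exact: ltW|exact: CP].
have gP (x : R) : r <= x <= K -> kap <= generator sx sr mx mr x (k * F1 x) (k * F2 x).
  move=> xI; have -> : generator sx sr mx mr x (k * F1 x) (k * F2 x) = k * generator sx sr mx mr x (F1 x) (F2 x).
    by rewrite /generator; ring.
  by rewrite gF ler_pM2l// ler_pM2l// mP.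
(* After [2 * n / kap] steps the time correction of [sub_solution] is zero. *)
exists (2 / kap); first by rewrite divr_gt0.
have [n0 _ nP] := @sub_solution R al be sx sr al1 al2 be1 be2 mx mr c psi
  (fun x => k * F1 x) (fun x => k * F2 x) r K (k * BF + `|0 : R|) (k * C) kap
  hM hC mpsi tP psi1 psi0 kap0 gP.
exists (maxn 1 n0) => // n /= nn N i x xI TN.
have {}nP := nP n (leq_trans (leq_maxr _ _) nn) N i x.
have n1 : 0 < n%:R :> R by rewrite ltr0n (leq_trans (leq_maxl _ _) nn).
move: nP; rewrite (_ : Num.max 0 _ = 0) ?subr0; last first.
  apply/max_idPl; rewrite subr_le0.
  have : 2 / kap * n%:R * (kap / 2 / n%:R) <= N%:R * (kap / 2 / n%:R).
    by rewrite ler_wpM2r// !divr_ge0// ltW.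
  by apply: le_trans; rewrite le_eqVlt; apply/orP; left; apply/eqP; field; rewrite !gt_eqF.
apply: le_trans.
have /andP[rx xK] := xI.
have xc : clip a b x = x by rewrite clip_id// /b; apply/andP; split; lin.
rewrite /psi addr0 /= xc.
have qx0 : 0 <= sc K x by exact: sc_ge0.
have qxa : sc K x <= sc K a by apply: sc_mono; lin.
rewrite /k [_^-1 * _]mulrC ler_pdivlMr// /F.
have qaB : lam * sc K a <= eps.
  by apply: le_trans lame; rewrite ler_wpM2l ?(ltW lam0)// /B; lin.
pose t := sc K x / sc K a.
have t0 : 0 <= t by rewrite divr_ge0// ltW.
have t1 : t <= 1 by rewrite ler_pdivrMr// mul1r.
have -> : sc K x = t * sc K a by rewrite /t mulfVK// gt_eqF.
rewrite mulfK ?gt_eqF//.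
have h1 : 0 <= (1 - t) * (lam * sc K a * sc K a).
  by rewrite mulr_ge0 ?subr_ge0// !mulr_ge0// ltW.
have h2 : 0 <= (eps - lam * sc K a) * sc K a.
  by apply: mulr_ge0; [rewrite subr_ge0|exact: ltW].
have h3 : 0 <= eps * (lam * sc K a ^+ 2)
  by apply: mulr_ge0; [exact: ltW|apply: mulr_ge0; [exact: ltW|exact: sqr_ge0]].
have h4 : 0 <= lam * (t * sc K a) ^+ 2 by apply: mulr_ge0; [exact: ltW|exact: sqr_ge0].
lin.
Qed.

(** The supersolution is [sc - lam * sc ^ 2] clipped to [[-1, K]], divided by [sc K 0] and raised by
    a constant. It is used on [[0, K - 1]], so that clipping at [K] leaves room; ruin from above
    [K - 1] costs at most [eta]. *)
Lemma ruin_upper (A K eps : R) : 0 <= A -> 1 < K -> 0 < eps ->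
  (\forall n \near \oo, forall N i (x : R), 0 < x -> 1 - surv n (above 0) N i x <= A / x ^+ 2) ->
  \forall n \near \oo, forall N i (x : R), 0 <= x <= K ->
    1 - surv n (above 0) N i x <= sc K x / sc K 0 + A / (K - 1) ^+ 2 + eps.
Proof.
move=> A0 K1 eps0 far.
pose a : R := -1; pose hi := K + 1; pose lo : R := -2.
have q00 : 0 < sc K 0 by apply: sc_gt0; lin.
pose B := sc K a.
have B0 : 0 < B by apply: sc_gt0; rewrite /a; lin.
pose lam := minr (2 * B)^-1 (eps * sc K 0 / B ^+ 2).
have lam0 : 0 < lam by rewrite lt_min invr_gt0 mulr_gt0// !divr_gt0 ?mulr_gt0 ?exprn_gt0.
have lamB : 2 * lam * B <= 1.
  have : lam <= (2 * B)^-1 by rewrite ge_min lexx.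
  by rewrite -[leRHS]mul1r ler_pdivlMr ?mulr_gt0//; lin.
have lame : lam * B ^+ 2 <= eps * sc K 0.
  have : lam <= eps * sc K 0 / B ^+ 2 by rewrite ge_min lexx orbT.
  by rewrite ler_pdivlMr ?exprn_gt0.
have [F2 [gF [F3 [BF BF0 dF]]]] := @perturbed_scale R mx mr sx sr sx0 sr0 (- lam) (qs (K + 2) K) (K + 2) lo hi
  (ltac:(rewrite /hi; lin)).
pose F x := sc K x + - lam * sc K x ^+ 2.
pose F1 x := - hd (- x) * (1 + 2 * - lam * sc K x).
have {}gF x : generator sx sr mx mr x (F1 x) (F2 x) =
    - (lam * (hd (- x) ^+ 2 * (sx ^+ 2 + x ^+ 2 * sr ^+ 2))).
  by rewrite mulrA -2!mulNr; exact: gF.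
have {}dF t : lo < t < hi -> [/\ is_derive t (1 : R) F (F1 t), is_derive t (1 : R) F1 (F2 t),
    is_derive t (1 : R) F2 (F3 t) & [/\ `|F t| <= BF, `|F1 t| <= BF, `|F2 t| <= BF & `|F3 t| <= BF]].
  exact: dF.
have [C C0 CP] := @clip_taylor R F F1 F2 F3 lo hi a K 0 (K - 1) BF
  (ltac:(rewrite /lo /a; lin)) (ltac:(rewrite /a; lin)) (ltac:(lin)) (ltac:(rewrite /hi; lin))
  (fun t tI => let: And4 h _ _ _ := dF t tI in h)
  (fun t tI => let: And4 _ h _ _ := dF t tI in h)
  (fun t tI => let: And4 _ _ h _ := dF t tI in h) BF0
  (fun t tI => let: And4 _ _ _ (And4 h _ _ _) := dF t tI in h)
  (fun t tI => let: And4 _ _ _ (And4 _ h _ _) := dF t tI in h)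
  (fun t tI => let: And4 _ _ _ (And4 _ _ h _) := dF t tI in h)
  (fun t tI => let: And4 _ _ _ (And4 _ _ _ h) := dF t tI in h).
pose k := (sc K 0)^-1.
have k0 : 0 < k by rewrite invr_gt0.
pose eta := A / (K - 1) ^+ 2.
have eta0 : 0 <= eta by rewrite divr_ge0// sqr_ge0.
(* The first summand makes up for the subtracted square, so that [f] is at least 1 below 0, and
   costs at most [eps] by the choice of [lam]; the second makes [f] dominate the bound above
   [K - 1]. *)
pose e := k * (lam * B ^+ 2) + eta.
have e0 : 0 <= e.
  by apply: addr_ge0 => //; apply: mulr_ge0; [exact: ltW|apply: mulr_ge0; [exact: ltW|exact: sqr_ge0]].
pose f y := k * (F \o clip a K) y + e.
have [m m0 mP] := h_bnd 0 (K - 1).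
have aK : a <= K by rewrite /a; lin.
have qclip y : 0 <= sc K (clip a K y) <= B.
  have /andP[? ?] := clip_in y aK; rewrite sc_ge0//= /B.
  exact: sc_mono.
have mf : measurable_fun setT f.
  have mq := measurableT_comp (measurable_sc K) (measurable_clip a K).
  apply: measurable_funD => //; apply: measurable_funM => //.
  by apply: measurable_funD => //; apply: measurable_funM => //; exact: measurable_funX.
have fE y : f y = k * (sc K (clip a K y) + lam * (B ^+ 2 - sc K (clip a K y) ^+ 2)) + eta.
  by rewrite /f /e /F /=; ring.
have f_ge y : eta <= f y.
  rewrite fE lerDr mulr_ge0 ?(ltW k0)//; have /andP[q0 qB] := qclip y.
  by rewrite addr_ge0// mulr_ge0 ?(ltW lam0)// subr_ge0 ler_sqr ?nnegrE// ltW.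
have f0 y : 0 <= f y by exact: le_trans (f_ge y).
have f1 y : y < 0 -> 1 <= f y.
  move=> y0; rewrite fE -[1]addr0 lerD// -(ler_pM2l q00) mulrA divff ?gt_eqF// mul1r mulr1.
  have q0 : sc K 0 <= sc K (clip a K y).
    by apply: sc_mono; rewrite /clip ge_min ge_max (ltW y0) /a lerN10 /= orbT.
  have /andP[_ qB] := qclip y; move: (sc K (clip a K y)) q0 qB => q q0 qB.
  have : 0 <= lam * ((B - q) * (B + q)) by rewrite !mulr_ge0 ?(ltW lam0)//; lin.
  lin.
pose kap := k * (lam * m).
have kap0 : 0 < kap by rewrite !mulr_gt0.
have hM : 0 <= k * BF + `|e| by rewrite addr_ge0// mulr_ge0// ltW.
have hC : 0 <= k * C by rewrite mulr_ge0// ltW.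
have tP (x : R) : 0 <= x <= K - 1 -> taylor_at (k * BF + `|e|) (k * C) f x (k * F1 x) (k * F2 x).
  by move=> xI; apply: taylor_affine; [exact: ltW|exact: CP].
have gP (x : R) : 0 <= x <= K - 1 -> generator sx sr mx mr x (k * F1 x) (k * F2 x) <= - kap.
  move=> xI; have -> : generator sx sr mx mr x (k * F1 x) (k * F2 x) = k * generator sx sr mx mr x (F1 x) (F2 x).
    by rewrite /generator; ring.
  by rewrite gF mulrN lerN2 ler_pM2l// ler_pM2l// mP.
have far' : \forall n \near \oo, forall N i (x : R), K - 1 < x -> 1 - surv n (above 0) N i x <= f x.
  apply: filterS far => n nP N i x Kx; apply: le_trans (f_ge x).
  have x0 : 0 < x by lin.
  apply: (le_trans (nP N i x x0)); rewrite ler_wpM2l// lef_pV2 ?posrE ?exprn_gt0//; last lin.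
  by rewrite ler_sqr ?nnegrE ?ltW//; lin.
apply: filterS (@super_solution R al be sx sr al1 al2 be1 be2 mx mr c f
  (fun x => k * F1 x) (fun x => k * F2 x) (K - 1) (k * BF + `|e|) (k * C) kap
  hM hC mf tP f0 f1 kap0 gP far') => n nP N i x /andP[x0 xK].
apply: (le_trans (nP N i x)).
have xc : clip a K x = x by rewrite clip_id// xK andbT (le_trans _ x0)// /a lerN10.
rewrite fE xc.
have q0 : 0 <= sc K x by exact: sc_ge0.
have : k * (lam * (B ^+ 2 - sc K x ^+ 2)) <= eps.
  rewrite mulrC ler_pdivrMr//; apply: le_trans lame.
  by rewrite ler_wpM2l ?(ltW lam0)// lerBlDr lerDl sqr_ge0.
rewrite -/eta [sc K x / _]mulrC -/k; lin.
Qed.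

End ruin_bounds.

(** * The Markov property *)

Section rectangles.
Context d d1 d2 (T : measurableType d) (T1 : measurableType d1) (T2 : measurableType d2)
  (R : realType) (P : probability T R).
Local Open Scope ereal_scope.

Lemma prod_measure_ext (m1 m2 : {measure set (T1 * T2) -> \bar R}) :
  m1 setT < +oo ->
  (forall C D, measurable C -> measurable D -> m1 (C `*` D) = m2 (C `*` D)) ->
  forall X, measurable X -> m1 X = m2 X.
Proof.
move=> m1oo m12 X mX.
pose G : set (set (T1 * T2)) :=
  [set X | exists A, measurable A /\ exists B, measurable B /\ X = A `*` B].
apply: (measure_unique G (fun=> setT)) => //.
- rewrite measurable_prod_measurableType; congr (<<s _ >>).
  rewrite predeqE => Z; split => [[A mA [B mB <-]]|[A [mA [B [mB ->]]]]].
    by exists A; split => //; exists B.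
  by exists A => //; exists B.
- move=> _ _ [X1 [mX1 [X2 [mX2 ->]]]] [Y1 [mY1 [Y2 [mY2 ->]]]].
  rewrite -setXI; exists (X1 `&` Y1); split; first exact: measurableI.
  by exists (X2 `&` Y2); split => //; exact: measurableI.
- by move=> _; exists setT; split => //; exists setT; rewrite setXTT.
- by rewrite bigcup_const.
- by move=> _ [A [mA [B [mB ->]]]]; exact: m12.
Qed.

Variables (U : T -> T1) (V : T -> T2).
Hypotheses (mU : measurable_fun setT U) (mV : measurable_fun setT V).

Lemma measurable_pre d' (S : measurableType d') (f : T -> S) D :
  measurable_fun setT f -> measurable D -> measurable (f @^-1` D).
Proof. by move=> mf mD; rewrite -[X in measurable X]setTI; exact: mf. Qed.

Let UV w := (U w, V w).
Let mUV : measurable_fun setT UV. Proof. exact: measurable_fun_pair. Qed.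

(** The finite measures that send [X] to [P (UV in X, F)] and to [P F * P (UV in X)] agree on the
    pi-system of rectangles, hence everywhere. *)
Lemma rect_indep (F : set T) : measurable F ->
  (forall C D, measurable C -> measurable D ->
     P (U @^-1` C `&` V @^-1` D `&` F) = P (U @^-1` C `&` V @^-1` D) * P F) ->
  forall X, measurable X -> P (UV @^-1` X `&` F) = P (UV @^-1` X) * P F.
Proof.
move=> mF rect X mX.
have PF : P F = (fine (P F))%:E by rewrite fineK// fin_num_measure.
pose r : {nonneg R} := NngNum (fine_ge0 (measure_ge0 P F)).
pose m1 : {measure set (T1 * T2) -> \bar R} := pushforward (mrestr P mF) UV.
pose m2 : {measure set (T1 * T2) -> \bar R} := mscale r (pushforward P UV).
have -> : P (UV @^-1` X `&` F) = m1 mUV X by [].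
have -> : P (UV @^-1` X) * P F = m2 mUV X by rewrite muleC [in LHS]PF.
apply: prod_measure_ext => //.
- rewrite /m1 /= /pushforward preimage_setT /mrestr setTI.
  by rewrite PF ltry.
- move=> C D mC mD.
  have := rect C D mC mD.
  rewrite [in RHS]PF muleC => h; exact: h.
Qed.

Lemma rect_product (a : probability T1 R) (b : probability T2 R) :
  (forall C D, measurable C -> measurable D ->
     P (U @^-1` C `&` V @^-1` D) = a C * b D) ->
  forall X, measurable X -> P (UV @^-1` X) = (a \x b) X.
Proof.
move=> rect X mX.
pose m1 : {measure set (T1 * T2) -> \bar R} := pushforward P UV.
by rewrite (@product_measure_unique _ _ _ _ _ a b (m1 mUV)).
Qed.

End rectangles.

Section recursion.
Context d dS (T : measurableType d) (S : measurableType dS) (R : realType)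
  (P : probability T R) (al be : probability R R) (F : bool * nat -> T -> R)
  (Phi : nat -> S * (R * R) -> S) (s0 : S).
Local Open Scope ereal_scope.
Hypotheses (indF : mutually_independent P F)
  (lawA : forall k D, measurable D -> P (F (true, k) @^-1` D) = al D)
  (lawB : forall k D, measurable D -> P (F (false, k) @^-1` D) = be D)
  (mPhi : forall k, measurable_fun setT (Phi k)).

Definition pair_at k (w : T) : R * R := (F (true, k) w, F (false, k) w).

Fixpoint state k (w : T) : S :=
  if k is k'.+1 then Phi k' (state k' w, pair_at k' w) else s0.

Let mF i : measurable_fun setT (F i). Proof. exact: indF.1. Qed.

Lemma measurable_pair_at k : measurable_fun setT (pair_at k).
Proof. exact: measurable_fun_pair. Qed.

Lemma measurable_state k : measurable_fun setT (state k).
Proof.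
elim: k => [|k IH] /=; first exact: measurable_cst.
exact: (measurableT_comp (mPhi k) (measurable_fun_pair IH (measurable_pair_at k))).
Qed.

Let future (J : seq (bool * nat)) (B : bool * nat -> set R) := [set w | forall i, i \in J -> B i (F i w)].

Let futureE j J B : future (j :: J) B = F j @^-1` B j `&` future J B.
Proof.
apply/seteqP; split => w /=.
  by move=> h; split=> [|i iJ]; apply: h; rewrite inE ?eqxx// iJ orbT.
by move=> [h1 h2] i; rewrite inE => /predU1P[->|/h2].
Qed.

Let measurable_future J B : (forall i, measurable (B i)) -> measurable (future J B).
Proof.
move=> mB; elim: J => [|j J IH].
  by rewrite (_ : future _ _ = setT)//; apply/seteqP; split.
by rewrite futureE; apply: measurableI => //; exact: measurable_pre.
Qed.

Let future_cons j J B : uniq (j :: J) -> (forall i, measurable (B i)) ->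
  P (F j @^-1` B j `&` future J B) = P (F j @^-1` B j) * P (future J B).
Proof.
move=> uJ mB; have uJ' : uniq J by move: uJ => /andP[].
by rewrite -futureE (indF.2 _ B uJ mB) big_cons (indF.2 _ B uJ' mB).
Qed.

(** The induction invariant. Independence of the next pair alone would not propagate; all finite
    families of noises from time [k] on are needed. *)
Let indep_upto k := forall C J B, measurable C -> uniq J ->
  (forall j, j \in J -> (k <= j.2)%N) -> (forall i, measurable (B i)) ->
  P (state k @^-1` C `&` future J B) = P (state k @^-1` C) * P (future J B).

Lemma pair_law k D : measurable D -> P (pair_at k @^-1` D) = (al \x be) D.
Proof.
move=> mD; apply: rect_product => // C1 C2 mC1 mC2.
pose B (i : bool * nat) := if i.1 then C1 else C2.
have mB i : measurable (B i) by rewrite /B; case: ifP.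
have -> : F (true, k) @^-1` C1 `&` F (false, k) @^-1` C2 =
    F (true, k) @^-1` B (true, k) `&` future [:: (false, k)] B.
  rewrite futureE [X in _ = _ `&` (_ `&` X)](_ : _ = setT) ?setIT//.
  by apply/seteqP; split.
rewrite future_cons//= lawA//; congr (_ * _).
have -> : future [:: (false, k)] B = F (false, k) @^-1` C2.
  by rewrite futureE [X in _ `&` X](_ : _ = setT) ?setIT//; apply/seteqP; split.
exact: lawB.
Qed.

(** On a rectangle [C1 * C2] the event on the pair at time [k] is itself a condition on future
    noises, so it may be added to [J] and the invariant applied; [rect_indep] then passes to a
    general [D]. *)
Let indep_pair k C J B D : indep_upto k -> measurable C -> uniq J ->
  (forall j, j \in J -> (k < j.2)%N) -> (forall i, measurable (B i)) -> measurable D ->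
  P (pair_at k @^-1` D `&` (state k @^-1` C `&` future J B)) =
  P (pair_at k @^-1` D) * P (state k @^-1` C `&` future J B).
Proof.
move=> Ik mC uJ kJ mB mD; apply: rect_indep => //.
  apply: measurableI; last exact: measurable_future.
  by apply: measurable_pre => //; exact: measurable_state.
move=> C1 C2 mC1 mC2.
(* Overriding [B] at time [k] does not disturb [J], whose indices are strictly later. *)
pose B' (i : bool * nat) := if i.2 == k then (if i.1 then C1 else C2) else B i.
have mB' i : measurable (B' i) by rewrite /B'; case: ifP => // _; case: ifP.
have notJ b : (b, k) \notin J by apply/negP => /kJ; rewrite ltnn.
have fJ : future J B = future J B'.
  apply/seteqP; split => w /= h i iJ; have := h i iJ; rewrite /B' ifF//;
    by apply/negP => /eqP ik; have := kJ i iJ; rewrite ik ltnn.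
have B't : B' (true, k) = C1 by rewrite /B' /= eqxx.
have B'f : B' (false, k) = C2 by rewrite /B' /= eqxx.
have u2 : uniq [:: (true, k), (false, k) & J] by rewrite /= !inE negb_or /= !notJ uJ.
have u1 : uniq ((false, k) :: J) by move: u2 => /andP[].
have leJ : forall j, j \in [:: (true, k), (false, k) & J] -> (k <= j.2)%N.
  by move=> j; rewrite !inE => /or3P[/eqP->|/eqP->|/kJ/ltnW].
have leJ' : forall j, j \in J -> (k <= j.2)%N by move=> j /kJ/ltnW.
rewrite [X in P X = _](_ : _ = state k @^-1` C `&` future [:: (true, k), (false, k) & J] B'); last first.
  by rewrite !futureE B't B'f fJ; rewrite setICA !setIA.
rewrite Ik// Ik// !futureE B't B'f fJ.
have e1 := future_cons u2 mB'; rewrite B't futureE B'f in e1.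
have e2 := future_cons u1 mB'; rewrite B'f in e2.
have e3 : P (F (true, k) @^-1` C1 `&` F (false, k) @^-1` C2) = al C1 * be C2.
  rewrite -(@product_measure1E _ _ _ _ _ al be)// -(pair_law k)//; exact: measurableX.
rewrite e1 e2 e3 lawA// lawB// -!muleA; rewrite muleC -!muleA.
congr (_ * _); congr (_ * _); exact: muleC.
Qed.

Lemma state_indep k : indep_upto k.
Proof.
elim: k => [|k IH] C J B mC uJ kJ mB.
  have [Cs|Cs] := pselect (C s0).
    have -> : state 0 @^-1` C = setT by apply/seteqP; split.
    by rewrite setTI probability_setT mul1e.
  have -> : state 0 @^-1` C = set0 by apply/seteqP; split.
  by rewrite set0I measure0 mul0e.
have mst := measurable_state k; have mpa := measurable_pair_at k.
pose X := Phi k @^-1` C.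
have mX : measurable X by exact: measurable_pre.
have -> : state k.+1 @^-1` C = (fun w => (state k w, pair_at k w)) @^-1` X by [].
apply: rect_indep => //; first exact: measurable_future.
move=> C1 D mC1 mD.
have leJ' : forall j, j \in J -> (k <= j.2)%N by move=> j /kJ/ltnW.
have f0 : future [::] B = setT by apply/seteqP; split.
have e1 : P (state k @^-1` C1 `&` pair_at k @^-1` D) = P (pair_at k @^-1` D) * P (state k @^-1` C1).
  by have := indep_pair IH mC1 (J := [::]) isT (fun j => ltac:(by [])) mB mD; rewrite f0 !setIT setIC.
rewrite e1 [X in P X = _](_ : _ = pair_at k @^-1` D `&` (state k @^-1` C1 `&` future J B)); last first.
  by rewrite setIA [in RHS](setIC (pair_at k @^-1` D)).
by rewrite indep_pair// IH// muleA.
Qed.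

Lemma state_pair_law k (st : {mfun T >-> S}) X : st = state k :> (T -> S) -> measurable X ->
  P ((fun w => (state k w, pair_at k w)) @^-1` X) =
  (distribution P st \x (al \x be)) X.
Proof.
have mst := measurable_state k; have mpa := measurable_pair_at k.
move=> stE mX; apply: rect_product => // C D mC mD.
have f0 : future [::] (fun=> setT) = setT by apply/seteqP; split.
have := indep_pair (@state_indep k) mC (J := [::]) isT (fun j => ltac:(by [])) (fun=> measurableT) mD.
rewrite f0 !setIT setIC pair_law// muleC => ->.
by rewrite /= /distribution /pushforward /= stE.
Qed.

(* The Markov property: [E g(V_{k+1}) = E (int g(Phi_k(V_k, z)) (al \x be)(dz))]. *)
Lemma state_step k (g : S -> \bar R) : measurable_fun setT g -> (forall s, 0 <= g s) ->
  \int[P]_w g (state k.+1 w) = \int[P]_w \int[al \x be]_z g (Phi k (state k w, z)).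
Proof.
move=> mg g0.
have mst := measurable_state k; have mpa := measurable_pair_at k.
have msp := measurable_fun_pair mst mpa.
pose st : {mfun T >-> S} := HB.pack (state k) (isMeasurableFun.Build _ _ _ _ _ mst).
pose h (p : S * (R * R)) := g (Phi k p).
have mh : measurable_fun setT h by exact: measurableT_comp.
have h0 p : 0 <= h p by exact: g0.
pose m1 : {measure set (S * (R * R)) -> \bar R} := pushforward P (fun w => (state k w, pair_at k w)).
have -> : \int[P]_w g (state k.+1 w) = \int[m1 msp]_p h p.
  by rewrite ge0_integral_pushforward.
pose PiP : probability (R * R)%type R := (al \x be).
pose m2 : {measure set (S * (R * R)) -> \bar R} := distribution P st \x PiP.
have -> : \int[m1 msp]_p h p = \int[m2]_p h p.
  apply: (@eq_measure_integral _ _ _ setT m2 (m1 msp)) => X mX _.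
  by have E := @state_pair_law k st X erefl mX; rewrite /m2 /= -E.
rewrite /m2 (@fubini_tonelli1 _ _ _ _ _ (distribution P st) PiP)//.
have mG := measurable_fun_fubini_tonelli_F (m2 := PiP) h mh h0.
rewrite ge0_integral_distribution//.
by move=> s; exact: integral_ge0.
Qed.

End recursion.

(** * Survival of the chain as an iterated integral *)

Section chain.
Context d (T : measurableType d) (R : realType) (P : probability T R)
  (al be : probability R R) (F : bool * nat -> T -> R).
Hypotheses (indF : mutually_independent P F)
  (lawA : forall k D, measurable D -> P (F (true, k) @^-1` D) = al D)
  (lawB : forall k D, measurable D -> P (F (false, k) @^-1` D) = be D).
Variables (mx mr : R) (c : bool) (n : nat) (G : nat -> set R) (y : R) (theta : nat -> T -> R).
Hypotheses (mG : forall i, measurable (G i)) (theta0 : forall w, theta 0%N w = y)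
  (thetaS : forall k w, theta k.+1 w =
     step mx mr c (mesh n) (theta k w) (F (true, k) w) (F (false, k) w)).
Local Notation surv := (surv al be mx mr c n G).

(** The first coordinate accumulates the indicators of [G 0], ..., [G k], so that the event of
    survival becomes a function of a Markov state. *)
Let Phi k (p : (R * R) * (R * R)) : R * R :=
  (p.1.1 * \1_(G k) p.1.2, step mx mr c (mesh n) p.1.2 p.2.1 p.2.2).

Let mPhi k : measurable_fun setT (Phi k).
Proof.
have m1 : measurable_fun setT (fun p : (R * R) * (R * R) => p.1.1) by exact: measurableT_comp.
have m2 : measurable_fun setT (fun p : (R * R) * (R * R) => p.1.2) by exact: measurableT_comp.
have m3 : measurable_fun setT (fun p : (R * R) * (R * R) => (p.1.2, p.2)) by exact: measurable_fun_pair.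
apply: measurable_fun_pair.
  by apply: measurable_funM => //; apply: measurableT_comp m2; exact: measurable_indic.
exact: (measurableT_comp (measurable_step mx mr c (mesh n)) m3).
Qed.

Let V := state F Phi (1, y).

Let VE k w : V k w = (\prod_(i < k) \1_(G i) (theta i w), theta k w).
Proof.
elim: k => [|k IH]; first by rewrite big_ord0 theta0.
by rewrite /V /= -/V IH /Phi /= big_ord_recr thetaS.
Qed.

Let prod_ind k w : \prod_(i < k) \1_(G i) (theta i w) =
   \1_[set w | forall i, (i < k)%N -> G i (theta i w)] w :> R.
Proof.
rewrite indicE; case: (boolP (w \in _)) => [|]; rewrite ?inE ?notin_setE /=.
  by move=> h; rewrite big1// => i _; rewrite indicE mem_set//; exact: h.
move=> /existsNP[i /not_implyP[ik nG]].
by rewrite (bigD1 (Ordinal ik))//= indicE memNset// mul0r.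
Qed.

(** A martingale argument: the mean of past indicators times the probability of surviving the
    remaining [N - k] steps is the same for all [k]. At [k = 0] it is [surv N 0 y], at [k = N] the
    probability of the event. *)
Lemma chain_surv N :
  P [set w | forall i, (i <= N)%N -> G i (theta i w)] = (surv N 0 y)%:E.
Proof.
(* The absolute value makes [g] nonnegative at every state, as [state_step] requires; along the
   chain the first coordinate is 0 or 1. *)
pose g M k (s : R * R) := (`|s.1| * surv M k s.2)%:E.
have gP M k : measurable_fun setT (g M k) /\ forall s, (0 <= g M k s)%E.
  have [mS S01] := surv_prop al be mx mr c n M mG k; split.
    apply/measurable_EFinP; apply: measurable_funM; first exact: measurableT_comp.
    exact: measurableT_comp.
  by move=> s; have /andP[? _] := S01 s.2; rewrite lee_fin mulr_ge0.
have stp M k : (\int[P]_w g M k.+1 (V k.+1 w) = \int[P]_w g M.+1 k (V k w))%E.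
  have [mg g0] := gP M k.+1.
  rewrite (state_step (S := (R * R)%type) (1, y) indF lawA lawB mPhi k mg g0); apply: eq_integral => w _.
  rewrite -/V; case: (V k w) => u x.
  have [mS S01] := surv_prop al be mx mr c n M mG k.+1.
  have mQ := mean_surv al be mx mr c n M k.+1 x mG.
  rewrite /g /Phi /= mulrA -(mean_ge0_EFin (meanZ (`|u| * \1_(G k) x) mQ)).
  apply: eq_integral => z _ /=.
  by rewrite normrM (@ger0_norm _ (\1_(G k) x)).
have const k : (k <= N)%N -> (\int[P]_w g (N - k)%N k (V k w) = \int[P]_w g N 0%N (V 0%N w))%E.
  elim: k => [|k IH] kN; first by rewrite subn0.
  by rewrite stp -IH ?(ltnW kN)// subnSK.
have e0 : (\int[P]_w g N 0%N (V 0%N w) = (surv N 0 y)%:E)%E.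
  under eq_integral do rewrite VE big_ord0 theta0 /g /= normr1 mul1r.
  by rewrite integral_cst//= probability_setT mule1.
have mth i : measurable_fun setT (theta i).
  have := measurable_state (S := (R * R)%type) (1, y) indF mPhi i; rewrite -/V => mV.
  rewrite (_ : theta i = snd \o V i); last by apply/funext => w; rewrite /= VE.
  exact: measurableT_comp.
have mE k : measurable [set w | forall i, (i < k)%N -> G i (theta i w)].
  rewrite (_ : [set w | _] = \bigcap_(i < k) (theta i @^-1` G i)); last first.
    by apply/seteqP; split => w /= h i; exact: h.
  by apply: bigcap_measurableType => i _; rewrite -[X in measurable X]setTI; exact: mth.
rewrite -e0 -(const N (leqnn N)) subnn.
have -> : [set w | forall i, (i <= N)%N -> G i (theta i w)] =
    [set w | forall i, (i < N.+1)%N -> G i (theta i w)] by [].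
set E := [set w | _].
have <- : (\int[P]_w (\1_E w)%:E = P E)%E by rewrite integral_indic ?setIT//; exact: (mE N.+1).
apply: eq_integral => w _.
rewrite /E -(prod_ind N.+1) big_ord_recr VE /g /= ger0_norm//.
by apply: prodr_ge0 => i _; have /andP[] := indic01 (G i) (theta i w).
Qed.

End chain.

Lemma derive_ge0_le {R : realType} (f f1 : R -> R) (a b : R) : a <= b ->
  (forall t, a <= t <= b -> is_derive t (1 : R) f (f1 t)) ->
  (forall t, a <= t <= b -> 0 <= f1 t) -> f a <= f b.
Proof.
rewrite le_eqVlt => /predU1P[->//|ab] df f1_ge0.
have [t||t] := @MVT R f f1 a b ab.
- by rewrite in_itv/= => /andP[? ?]; apply: df; rewrite !ltW.
- apply: derivable_within_continuous => t; rewrite in_itv/= => tI.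
  by have [|] := df t.
rewrite in_itv/= => /andP[? ?] E.
rewrite -subr_ge0 E mulr_ge0 ?subr_ge0 ?(ltW ab)//.
by rewrite f1_ge0// !ltW.
Qed.

(** * Limits of the ruin bounds *)

Section scale_limit.
Context {R : realType} (mx mr sx sr : R).
Hypotheses (sx0 : 0 < sx) (sr0 : 0 < sr).
Local Notation hd := (hdens mx mr sx sr).
Local Notation sc := (scale_gap sx sr mx mr).

Let D (x : R) := sx ^+ 2 + sr ^+ 2 * x ^+ 2.
Let cc := 2 * mx / (sx * sr).
Let m := mr / sr ^+ 2.
Let s := Num.sqrt (sx ^+ 2 + sr ^+ 2).

Let s_gt0 : 0 < s.
Proof. by rewrite sqrtr_gt0 addr_gt0// exprn_gt0. Qed.

Let D_gt0 x : 0 < D x.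
Proof. by rewrite ltr_pwDl ?exprn_gt0// mulr_ge0 ?sqr_ge0. Qed.

Let dD (x : R) : is_derive x (1 : R) D (2 * sr ^+ 2 * x).
Proof. by rewrite /D; apply: is_derive_eq; rewrite /GRing.scale/=; ring. Qed.

(** The square root of [D x], in the exponential form that combines with the other powers of [D]. *)
Let w x := expR (2^-1 * ln (D x)).

Let w_gt0 x : 0 < w x. Proof. exact: expR_gt0. Qed.

Let w_le (x : R) : 1 <= x -> w x <= s * x.
Proof.
move=> x1; have x0 : 0 <= x by lin.
have w2 : w x ^+ 2 = D x.
  by rewrite /w expr2 -expRD -mulrDl -[RHS](lnK (D_gt0 x)); congr expR; field.
rewrite -ler_sqr ?nnegrE ?mulr_ge0 ?(ltW (w_gt0 x)) ?(ltW s_gt0)// w2.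
rewrite exprMn sqr_sqrtr ?addr_ge0 ?sqr_ge0// mulrDl lerD2r.
by rewrite ler_peMr ?sqr_ge0// exprn_ege1.
Qed.

Let hdE (x : R) : hd (- x) =
  (w x)^-1 * expR (- m * ln (D x)) * expR (cc * atan (sr / sx * - x)).
Proof.
rewrite /hdens /powR sqrrN -/(D x) gt_eqF ?D_gt0// /w -expRN.
by congr (_ * _); rewrite -expRD; congr expR; rewrite /m; ring.
Qed.

Let pi2 := `|cc| * pi : R.

Let atan_bound x : - pi2 <= cc * atan x <= pi2.
Proof.
rewrite -ler_norml normrM /pi2 ler_wpM2l// ler_norml.
have := atan_gtNpi2 x; have := atan_ltpi2 x; have := pi_gt0 R => *; apply/andP; split; lin.
Qed.

Lemma sc_chasles (K x y : R) : x <= y -> y <= K -> sc K x = sc K y + sc y x.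
Proof.
move=> xy yK; have xK := le_trans xy yK.
rewrite !sc_integral//.
have h1 : (BLeft (- K) <= BRight (- y))%O by rewrite bnd_simp lerN2.
have h2 : (BRight (- y) <= BRight (- x))%O by rewrite bnd_simp lerN2.
have := Rintegral_itvB (hdens_integrable mx mr sx0 sr0 (- K) (- x)) h1 h2.
rewrite Rintegral_itv_obnd_cbnd; first by move=> <-; rewrite subrKC.
apply: integrableS (hdens_integrable mx mr sx0 sr0 (- y) (- x)) => //.
exact: subset_itv_oc_cc.
Qed.

Lemma sc_homo_K (x K K' : R) : x <= K -> K <= K' -> sc K x <= sc K' x.
Proof. by move=> xK KK'; rewrite (sc_chasles xK KK') lerDr sc_ge0. Qed.

Let dsc (K x : R) : x <= K -> is_derive x (1 : R) (sc K) (- hd (- x)).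
Proof.
move=> xK; have xK2 : x < K + 2 by lra.
have := is_derive_qscale mx mr sx0 sr0 xK2 => ?.
by rewrite /scale_gap; apply: is_derive_eq; rewrite subr0.
Qed.

Let dln (x : R) : is_derive x (1 : R) (fun y => ln (D y)) (2 * sr ^+ 2 * x / D x).
Proof.
have := is_derive1_comp (is_derive1_ln (D_gt0 x)) (dD x).
by rewrite mulrC.
Qed.

(** For [x >= 1] the density [hd (- x)] is at most the derivative of [- C * D ^ (- m)]: the
    arctangent factor is bounded by [expR pi2], and [w x <= s * x] gives [1 / w <= s * x / D]. The
    constant [C] is what this comparison requires. *)
Lemma sc_bounded : 0 < mr -> exists B : R, forall K : R, 1 <= K -> sc K 0 <= B.
Proof.
move=> mr0; have m0 : 0 < m by rewrite divr_gt0// exprn_gt0.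
pose Psi x := expR (- m * ln (D x)).
pose C := expR pi2 * s / (2 * m * sr ^+ 2).
have sr20 : 0 < sr ^+ 2 by rewrite exprn_gt0.
have C0 : 0 < C.
  apply: divr_gt0; first by apply: mulr_gt0; [exact: expR_gt0|exact: s_gt0].
  by apply: mulr_gt0 => //; apply: mulr_gt0.
have dPsi (x : R) : is_derive x (1 : R) Psi (Psi x * (- m * (2 * sr ^+ 2 * x / D x))).
  have dl : is_derive x (1 : R) (fun y => - m * ln (D y)) (- m * (2 * sr ^+ 2 * x / D x)).
    by have := dln x => ?; apply: is_derive_eq; rewrite /GRing.scale/=; ring.
  exact: (is_derive1_comp (is_derive_expR _) dl).
exists (C * Psi 1 + sc 1 0) => K K1.
rewrite (sc_chasles ler01 K1) lerD2r.
have : sc K 1 - C * Psi 1 <= sc K K - C * Psi K.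
  apply: (@derive_ge0_le R (fun x => sc K x - C * Psi x)
    (fun x => - hd (- x) - C * (Psi x * (- m * (2 * sr ^+ 2 * x / D x)))) 1 K K1).
    move=> t /andP[_ tK]; have := dsc tK => ?; have := dPsi t => ?.
    by apply: is_derive_eq; rewrite /GRing.scale/=; ring.
  move=> t /andP[t1 tK].
  have -> : - hd (- t) - C * (Psi t * (- m * (2 * sr ^+ 2 * t / D t))) =
     Psi t * (expR pi2 * (s * t / D t)) - hd (- t).
    by rewrite /C; field; rewrite !gt_eqF// D_gt0.
  rewrite subr_ge0 hdE -/(Psi t).
  have -> : (w t)^-1 * Psi t * expR (cc * atan (sr / sx * - t)) =
    Psi t * (expR (cc * atan (sr / sx * - t)) * (w t)^-1) by ring.
  rewrite ler_wpM2l ?expR_ge0//.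
  apply: ler_pM; rewrite ?expR_ge0 ?invr_ge0 ?(ltW (w_gt0 t))//.
    by rewrite ler_expR; have /andP[] := atan_bound (sr / sx * - t).
  have w2 : w t ^+ 2 = D t.
    by rewrite /w expr2 -expRD -mulrDl -[RHS](lnK (D_gt0 t)); congr expR; field.
  rewrite -w2 ler_pdivlMr ?exprn_gt0// expr2 mulrA mulVf ?gt_eqF// mul1r.
  exact: w_le.
rewrite sc_diag.
have : 0 <= C * Psi K by rewrite mulr_ge0 ?expR_ge0 ?(ltW C0).
lin.
Qed.

(** For [x >= 1] the density [hd (- x)] is at least [c / x], because [- m >= 0] and [D >= sx ^ 2];
    the divergence is at least logarithmic. *)
Lemma sc_unbounded : mr <= 0 -> forall M : R, exists K0 : R, forall K, K0 <= K -> M <= sc K 0.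
Proof.
move=> mr0 M; have m0 : 0 <= - m by rewrite oppr_ge0 mulr_le0_ge0// invr_ge0 sqr_ge0.
pose c := s^-1 * expR (- m * ln (sx ^+ 2)) * expR (- pi2).
have c0 : 0 < c by rewrite !mulr_gt0 ?expR_gt0 ?invr_gt0.
exists (maxr 1 (expR (M / c))) => K; rewrite ge_max => /andP[K1 KM].
have K0 : 0 < K by lin.
have lnK1 : M <= c * ln K.
  rewrite mulrC -ler_pdivrMr// -ler_expR lnK//.
suff : sc K 1 + c * ln 1 >= sc K K + c * ln K.
  rewrite sc_diag ln1 mulr0 add0r addr0 => h.
  rewrite (sc_chasles ler01 K1); have := sc_ge0 mx mr sx0 sr0 (@ler01 R); lin.
rewrite -lerN2.
apply: (@derive_ge0_le R (fun x => - (sc K x + c * ln x)) (fun x => hd (- x) - c * x^-1) 1 K K1).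
  move=> t /andP[t1 tK]; have t0 : 0 < t by lin.
  have := dsc tK => ?; have := is_derive1_ln t0 => ?.
  by apply: is_derive_eq; rewrite /GRing.scale/=; ring.
move=> t /andP[t1 tK]; have t0 : 0 < t by lin.
rewrite subr_ge0 hdE /c mulrAC; apply: ler_pM.
- by rewrite !mulr_ge0 ?expR_ge0 ?invr_ge0 ?(ltW s_gt0) ?(ltW t0).
- exact: expR_ge0.
- rewrite mulrAC -invfM; apply: ler_pM; rewrite ?expR_ge0 ?invr_ge0 ?mulr_ge0 ?(ltW s_gt0) ?(ltW t0)//.
    by rewrite lef_pV2 ?posrE ?mulr_gt0// w_le.
  by rewrite ler_expR ler_wpM2l// ler_ln ?posrE ?exprn_gt0// lerDl mulr_ge0 ?sqr_ge0.
- by rewrite ler_expR; have /andP[] := atan_bound (sr / sx * - t).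
Qed.

(** Monotone convergence along the intervals [[- k, - x]]. As [H_fun] is a real-valued integral, the
    extended one must be shown finite for the two to agree; this is the role of [sc_bounded]. *)
Lemma sc_cvg_H (x : R) : 0 < mr -> 0 <= x ->
  sc k%:R x @[k --> \oo] --> H_fun mx mr sx sr (- x).
Proof.
move=> mr0 x0; have [B BP] := sc_bounded mr0.
pose A (k : nat) := `[- k%:R, - x]%classic : set R.
have Acup : \bigcup_k A k = `]-oo, - x]%classic.
  apply/seteqP; split => z /=.
    by move=> [k _]; rewrite /A /= !in_itv/= => /andP[].
  rewrite in_itv/= => zx; exists (Num.bound `|z|) => //.
  rewrite /A /= in_itv/= zx andbT.
  have := archi_boundP (normr_ge0 z); rewrite lerNl => h.
  by rewrite (le_trans _ (ltW h))// -normrN ler_norm.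
have cv : (\int[lebesgue_measure]_(z in A k) (hd z)%:E)%E @[k --> \oo] -->
    (\int[lebesgue_measure]_(z in `]-oo, (- x)%R]) (hd z)%:E)%E.
  rewrite -Acup; apply: ge0_nondecreasing_set_cvg_integral.
  - move=> j k jk; apply/subsetPset => z; rewrite /A /= !in_itv/= => /andP[jz ->].
    by rewrite andbT (le_trans _ jz)// lerN2 ler_nat.
  - by move=> k; exact: measurable_itv.
  - move=> k; apply: measurable_funTS; apply/measurable_EFinP; exact: measurable_hdens.
  - by move=> k z _; rewrite lee_fin ltW// hdens_gt0.
have scE k : x <= k%:R -> (\int[lebesgue_measure]_(z in A k) (hd z)%:E)%E = (sc k%:R x)%:E.
  by move=> xk; rewrite sc_integral// /Rintegral fineK//;
    exact: (integrable_fin_num _ (hdens_integrable mx mr sx0 sr0 _ _)).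
have near_x : \forall k \near \oo, x <= k%:R :> R by exact: nbhs_infty_ger.
have {}cv : (sc k%:R x)%:E @[k --> \oo] -->
    (\int[lebesgue_measure]_(z in `]-oo, (- x)%R]) (hd z)%:E)%E.
  apply: cvg_trans cv; apply: near_eq_cvg.
  by apply: filterS near_x => k xk; rewrite scE.
have fin : (\int[lebesgue_measure]_(z in `]-oo, (- x)%R]) (hd z)%:E)%E \is a fin_num.
  rewrite ge0_fin_numE; last by apply: integral_ge0 => z _; rewrite lee_fin ltW// hdens_gt0.
  apply: (@le_lt_trans _ _ B%:E); last exact: ltry.
  rewrite -(cvg_lim _ cv)//; apply: lime_le; first by apply/cvg_ex; eexists; exact: cv.
  near=> k; rewrite lee_fin.
  have k1 : 1 <= k%:R :> R by near: k; exact: nbhs_infty_ger.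
  have xk : x <= k%:R :> R by near: k.
  apply: le_trans (BP _ k1); exact: sc_mono.
rewrite -[X in _ --> X]fineK// in cv.
exact: (fine_cvg cv).
Unshelve. all: by end_near. Qed.

Lemma H_fun0_gt0 : 0 < mr -> 0 < H_fun mx mr sx sr 0.
Proof.
move=> mr0; have := sc_cvg_H mr0 (lexx 0); rewrite oppr0 => cv.
apply: (@lt_le_trans _ _ (sc 1 0)); first by apply: sc_gt0.
rewrite -(cvg_lim _ cv)//; apply: limr_ge; first by apply/cvg_ex; eexists; exact: cv.
near=> k; apply: sc_homo_K; first exact: ler01.
by near: k; exact: nbhs_infty_ger.
Unshelve. all: by end_near. Qed.

End scale_limit.

(** * Sending the upper barrier to infinity *)

Section ruin_limits.
Context {R : realType} (al be : probability R R) (sx sr : R).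
Hypotheses (al1 : has_mean al id 0) (al2 : has_mean al (fun a => a ^+ 2) (sx ^+ 2))
  (be1 : has_mean be id 0) (be2 : has_mean be (fun b => b ^+ 2) (sr ^+ 2)).
Variables (mx mr : R) (c : bool).
Hypotheses (sx0 : 0 < sx) (sr0 : 0 < sr).
Local Notation surv := (surv al be mx mr c).
Local Notation sc := (scale_gap sx sr mx mr).

(* [sc K x / sc K 0] is the probability that the diffusion started at [x] reaches 0 before
   [K]. *)
Definition ratio_lim (y g : R) := forall e : R, 0 < e ->
  \forall k \near \oo, `|sc k%:R y / sc k%:R 0 - g| <= e.

Lemma ratio_lim_transient (y : R) : 0 < mr -> 0 <= y ->
  ratio_lim y (H_fun mx mr sx sr (- y) / H_fun mx mr sx sr 0).
Proof.
move=> mr0 y0 e e0.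
have H0 := H_fun0_gt0 mx sx0 sr0 mr0.
have c1 := @sc_cvg_H R mx mr sx sr sx0 sr0 y mr0 y0.
have c2 := @sc_cvg_H R mx mr sx sr sx0 sr0 0 mr0 (lexx 0); rewrite oppr0 in c2.
have : sc k%:R y / sc k%:R 0 @[k --> \oo] --> H_fun mx mr sx sr (- y) / H_fun mx mr sx sr 0.
  by apply: cvgM => //; apply: cvgV => //; rewrite gt_eqF.
by move/cvgrPdist_le => /(_ _ e0); apply: filterS => k; rewrite distrC.
Qed.

(** Numerator and denominator differ by the fixed quantity [sc y 0], while the denominator
    diverges. *)
Lemma ratio_lim_recurrent (y : R) : mr <= 0 -> 0 <= y -> ratio_lim y 1.
Proof.
move=> mr0 y0 e e0.
have B0 := sc_ge0 mx mr sx0 sr0 y0.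
have [K0 K0P] := sc_unbounded mx sx0 sr0 mr0 ((sc y 0 + 1) / e).
near=> k.
have yk : y <= k%:R :> R by near: k; exact: nbhs_infty_ger.
have kK : K0 <= k%:R :> R by near: k; exact: nbhs_infty_ger.
have big := K0P _ kK.
have q0 : 0 < sc k%:R 0 by apply: lt_le_trans big; rewrite divr_gt0// ltr_wpDl.
have E := sc_chasles mx mr sx0 sr0 y0 yk.
have -> : sc k%:R y / sc k%:R 0 - 1 = - (sc y 0 / sc k%:R 0).
  have -> : sc k%:R y = sc k%:R 0 - sc y 0 by rewrite E addrK.
  by field; rewrite gt_eqF.
rewrite normrN ger0_norm ?divr_ge0 ?(ltW q0)// ler_pdivrMr//.
by move: big; rewrite ler_pdivrMr// mulrC; lin.
Unshelve. all: by end_near. Qed.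

(** Ruin is obtained with a margin [del], which the comparison with the diffusion uses up later.
    Here [a = - d] and [r = - d / 2] in [ruin_lower], and the excess [sc 0 (- d)] in the denominator
    is small by continuity. *)
Lemma ruin_lower_lim (y g eps : R) : ratio_lim y g -> 0 <= y -> 0 < eps ->
  exists2 del : R, 0 < del & exists2 T : R, 0 < T &
    \forall n \near \oo, forall N i, T * n%:R <= N%:R ->
      g - eps <= 1 - surv n (above (- del)) N i y.
Proof.
move=> yg y0 eps0; have e3 : 0 < eps / 3 by rewrite divr_gt0.
have q1 := sc_gt0 mx mr sx0 sr0 (@ltr01 R).
have cont : {for 0, continuous (sc 0)}.
  have h2 : (0 : R) < 0 + 2 by rewrite add0r.
  have := is_derive_qscale mx mr sx0 sr0 h2 => ?.
  apply: (@is_derive_continuous R (sc 0) 0 (- hdens mx mr sx sr (- 0))).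
  by rewrite /scale_gap; apply: is_derive_eq; rewrite subr0.
(* Smallness is measured against [sc 1 0], which is at most [sc k 0] for every [k >= 1]: thus [d] is
   fixed before [k]. *)
have e4 : 0 < eps / 3 * sc 1 0 by rewrite mulr_gt0.
have [d d0 dP] : exists2 d : R, 0 < d & sc 0 (- d) <= eps / 3 * sc 1 0.
  move/cvgrPdist_le : cont => /(_ _ e4) /nbhs_ballP[d /= d0 dP].
  exists (d / 2); first by rewrite divr_gt0.
  have := dP (- (d / 2)); rewrite /ball /= sub0r opprK ger0_norm ?divr_ge0 ?(ltW d0)//.
  move=> /(_ _); rewrite sc_diag sub0r normrN.
  move=> h; apply: le_trans (ler_norm _) (h _).
  by rewrite ltr_pdivrMr// ltr_pMr// ltr1n.
have [k [yk k1 kP]] : exists k : nat, [/\ y <= k%:R :> R, (0 < k)%N & `|sc k%:R y / sc k%:R 0 - g| <= eps / 3].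
  have [k0 _ kP] := yg _ e3.
  exists (maxn k0 (maxn 1 (Num.bound y))); split.
  - have := archi_boundP y0 => h; apply: (le_trans (ltW h)).
    by rewrite ler_nat !leq_max leqnn !orbT.
  - by rewrite !leq_max /= orbT.
  - by apply: kP; rewrite /= leq_max leqnn.
have k1' : 1 <= k%:R :> R by rewrite ler1n.
pose q0 := sc k%:R 0.
have q01 : sc 1 0 <= q0 by apply: sc_homo_K.
have q00 : 0 < q0 by exact: lt_le_trans q01.
have d2 : - d < - (d / 2) by lin.
have [T T0 TP] := ruin_lower al1 al2 be1 be2 mx mr c sx0 sr0 k%:R d2 e3.
exists (d / 2); first by rewrite divr_gt0.
exists T => //; apply: filterS TP => n nP N i TN.
have yI : - (d / 2) <= y <= k%:R by rewrite yk andbT; lin.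
apply: le_trans (nP N i y yI TN).
have dN : - d <= 0 by lin.
have k0' : 0 <= k%:R :> R by [].
rewrite (sc_chasles mx mr sx0 sr0 dN k0') -/q0.
set e := sc 0 (- d) in dP *.
have ee : 0 <= e by apply: sc_ge0.
have qy : 0 <= sc k%:R y <= q0 by rewrite sc_ge0//= sc_mono.
set t := sc k%:R y / q0.
have t01 : 0 <= t <= 1 by move: qy => /andP[? ?]; rewrite divr_ge0 ?ler_pdivrMr ?mul1r ?(ltW q00).
have -> : sc k%:R y / (q0 + e) = t - t * (e / (q0 + e)).
  by rewrite /t; field; rewrite !gt_eqF// ltr_wpDr.
have : t * (e / (q0 + e)) <= eps / 3.
  move/andP: t01 => [t0 t1]; rewrite (@le_trans _ _ (e / (q0 + e)))//.
    by rewrite ler_piMl// divr_ge0// addr_ge0// ltW.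
  rewrite ler_pdivrMr; last by rewrite ltr_wpDr.
  apply: (le_trans dP); rewrite ler_wpM2l ?(ltW e3)//; lin.
move: kP; rewrite -/q0 -/t ler_norml => /andP[? ?]; lin.
Qed.

Lemma ruin_upper_lim (y g eps : R) : ratio_lim y g -> 0 <= y -> 0 < eps ->
  (exists2 C : R, C < 1 & \forall n \near \oo, exists2 p,
     has_mean be (fun b => expR (-2 * (mr * mesh n ^+ 2 + b * mesh n))) p & p ^+ n <= C) ->
  \forall n \near \oo, forall N i, 1 - surv n (above 0) N i y <= g + eps.
Proof.
move=> yg y0 eps0 [C C1 Cp]; have e3 : 0 < eps / 3 by rewrite divr_gt0.
have [A A0 AP] := ruin_far be al1 al2 mx mr c C1.
have [k [yk k1 kP Ak]] : exists k : nat, [/\ y <= k%:R :> R, 1 < k%:R :> R,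
   `|sc k%:R y / sc k%:R 0 - g| <= eps / 3 & A / (k%:R - 1) ^+ 2 <= eps / 3].
  have [k0 _ kP] := yg _ e3.
  have A3 : 0 <= A / (eps / 3) by rewrite divr_ge0// ltW.
  (* The shift by 2 yields both [k - 1 >= 1] and [k - 1 >= A / (eps / 3)], so that [(k - 1) ^ 2]
     exceeds the latter too. *)
  exists (maxn k0 (maxn 2 (maxn (Num.bound y) (Num.bound (A / (eps / 3))).+2))); set k := maxn _ _.
  have kb : (Num.bound (A / (eps / 3)))%:R + 2 <= k%:R :> R.
    by rewrite -natrD ler_nat addn2 /k !leq_max leqnn !orbT.
  have ab := archi_boundP A3.
  split.
  - have := archi_boundP y0 => h; apply: (le_trans (ltW h)).
    by rewrite ler_nat !leq_max leqnn !orbT.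
  - by rewrite ltr1n /k !leq_max /= orbT.
  - by apply: kP; rewrite /= leq_max leqnn.
  - have k11 : 1 <= k%:R - 1 :> R by have : 0 <= (Num.bound (A / (eps / 3)))%:R :> R by []; lin.
    rewrite ler_pdivrMr ?exprn_gt0//; last lin.
    rewrite mulrC -ler_pdivrMr//; apply: (@le_trans _ _ (k%:R - 1)); first lin.
    by rewrite expr2 ler_peMl//; lin.
have far : \forall n \near \oo, forall N i (x : R), 0 < x -> 1 - surv n (above 0) N i x <= A / x ^+ 2.
  near=> n => N i x x0.
  have n0 : (0 < n)%N by near: n; exists 1%N.
  have [p pm pC] : exists2 p, has_mean be (fun b => expR (-2 * (mr * mesh n ^+ 2 + b * mesh n))) p & p ^+ n <= C.
    by near: n.
  exact: (AP n p n0 pm pC N i x x0).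
have U := ruin_upper al1 al2 be1 be2 sx0 sr0 A0 k1 e3 far.
apply: filterS U => n nP N i.
have yI : 0 <= y <= k%:R by rewrite y0.
have := nP N i y yI; move: kP; rewrite ler_norml => /andP[? ?]; lin.
Unshelve. all: by end_near. Qed.

Lemma indic_le (A B : set R) (x : R) : A `<=` B -> \1_A x <= \1_B x :> R.
Proof.
move=> AB; rewrite !indicE; case: (boolP (x \in A)) => [/set_mem/AB xB|_].
  by rewrite mem_set.
exact: ler0n.
Qed.

Lemma surv_sub n (G G' : nat -> set R) N i x :
  (forall i, measurable (G i)) -> (forall i, measurable (G' i)) ->
  (forall i, G i `<=` G' i) -> surv n G N i x <= surv n G' N i x.
Proof.
move=> mG mG' GG; elim: N i x => [|N IH] i x /=.
  exact: indic_le.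
have mS := mean_surv al be mx mr c n N i.+1 x mG.
have mS' := mean_surv al be mx mr c n N i.+1 x mG'.
have /andP[i0 _] := indic01 (G i) x.
apply: ler_pM => //; last by apply: (mean_le mS mS') => z; exact: IH.
- by apply: (mean_le (mean_cst _ 0) mS) => z; have [_ /(_ (step mx mr c (mesh n) x z.1 z.2)) /andP[]] := surv_prop al be mx mr c n N mG i.+1.
- exact: indic_le.
Qed.

Section event.
Context d (T : measurableType d) (P : probability T R) (n : nat) (y : R) (theta : nat -> T -> R)
  (F : bool * nat -> T -> R).
Hypotheses (indF : mutually_independent P F)
  (lawA : forall k D, measurable D -> P (F (true, k) @^-1` D) = al D)
  (lawB : forall k D, measurable D -> P (F (false, k) @^-1` D) = be D)
  (theta0 : forall w, theta 0%N w = y)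
  (thetaS : forall k w, theta k.+1 w =
     step mx mr c (mesh n) (theta k w) (F (true, k) w) (F (false, k) w)).

Lemma measurable_chain k : measurable_fun setT (theta k).
Proof.
elim: k => [|k IH].
  by rewrite (_ : theta 0 = fun=> y)//; apply/funext.
have mp : measurable_fun setT (fun w => (theta k w, (F (true, k) w, F (false, k) w))).
  by apply: measurable_fun_pair => //; apply: measurable_fun_pair; exact: indF.1.
rewrite (_ : theta k.+1 = fun w => step mx mr c (mesh n) (theta k w) (F (true, k) w) (F (false, k) w)).
  exact: (measurableT_comp (measurable_step mx mr c (mesh n)) mp).
exact/funext.
Qed.

Lemma ruin_by (r : R) N :
  P [set w | exists2 k, (k <= N)%N & theta k w < r] = (1 - surv n (above r) N 0 y)%:E.
Proof.
have mA := measurable_above r.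
have := chain_surv indF lawA lawB (c := c) mA theta0 thetaS N.
set A := [set w | _]; set E := [set w | _] => PA.
have EA : E = ~` A.
  apply/seteqP; split => w /=.
    by move=> [k kN kr] h; have := h k kN; rewrite /above /= leNgt kr.
  by move=> /existsNP[k /not_implyP[kN /negP]]; rewrite /above /= -ltNge => h; exists k.
have mk k : measurable_fun setT (theta k) by exact: measurable_chain.
have mEA : measurable A.
  rewrite (_ : A = \bigcap_(i < N.+1) (theta i @^-1` above r i)); last first.
    by apply/seteqP; split => w /= h i; exact: h.
  by apply: bigcap_measurableType => i _; exact: measurable_pre.
by rewrite EA probability_setC// PA.
Qed.

Lemma ruin_ever_ge (r : R) N :
  ((1 - surv n (above r) N 0 y)%:E <= P [set w | exists k, theta k w < r]%R)%E.
Proof.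
rewrite -ruin_by; apply: le_measure; rewrite ?inE.
- rewrite (_ : [set w | _] = \bigcup_(k < N.+1) (theta k @^-1` [set x | x < r])).
    by apply: bigcup_measurable => k _; apply: measurable_pre; [exact: measurable_chain|exact: open_measurable].
  by apply/seteqP; split => w /= [k kN kr]; exists k.
- rewrite (_ : [set w | _] = \bigcup_k (theta k @^-1` [set x | x < r])).
    by apply: bigcup_measurable => k _; apply: measurable_pre; [exact: measurable_chain|exact: open_measurable].
  by apply/seteqP; split => w /= [k]; exists k.
- by move=> w /= [k _ kr]; exists k.
Qed.

Lemma ruin_ever_le (r B : R) : (forall N, 1 - surv n (above r) N 0 y <= B) ->
  (P [set w | exists k, theta k w < r]%R <= B%:E)%E.
Proof.
move=> SB; pose E N := [set w | exists2 k, (k <= N)%N & theta k w < r].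
have mE N : measurable (E N).
  rewrite (_ : E N = \bigcup_(k < N.+1) (theta k @^-1` [set x | x < r])).
    by apply: bigcup_measurable => k _; apply: measurable_pre; [exact: measurable_chain|exact: open_measurable].
  by apply/seteqP; split => w /= [k kN kr]; exists k.
have -> : [set w | exists k, theta k w < r] = \bigcup_N E N.
  apply/seteqP; split => w /=.
    by move=> [k kr]; exists k => //; exists k.
  by move=> [N _ [k _ kr]]; exists k.
have cv := @nondecreasing_cvg_mu _ _ _ P E mE (bigcupT_measurable E mE).
have {}cv : (P \o E) N @[N --> \oo] --> P (\bigcup_N E N).
  apply: cv => N M NM; apply/subsetPset => w /= [k kN kr]; exists k => //.
  exact: leq_trans NM.
rewrite -(cvg_lim _ cv)//; apply: lime_le; first by apply/cvg_ex; eexists; exact: cv.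
by apply: nearW => N; rewrite /= ruin_by lee_fin.
Qed.

End event.

End ruin_limits.

(** * The discrete scheme *)

Section transfer.
Context d (T : measurableType d) (R : realType) (P : probability T R).

Lemma mutually_independent_comp (I : eqType) (X : I -> T -> R) (phi : I -> R -> R) :
  mutually_independent P X -> (forall i, measurable_fun setT (phi i)) ->
  mutually_independent P (fun i w => phi i (X i w)).
Proof.
move=> [mX indX] mphi; split; first by move=> i; exact: measurableT_comp.
move=> J B uJ mB.
have mB' i : measurable (phi i @^-1` B i) by exact: measurable_pre.
exact: (indX J (fun i => phi i @^-1` B i) uJ mB').
Qed.

Definition law (X : T -> R) (mX : measurable_fun setT X) : probability R R :=
  distribution P (HB.pack_for {mfun T >-> R} X (isMeasurableFun.Build _ _ _ _ _ mX)).

Lemma lawE (X : T -> R) (mX : measurable_fun setT X) D : law mX D = P (X @^-1` D).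
Proof. by []. Qed.

Lemma mean_law (X : T -> R) (mX : measurable_fun setT X) (f : R -> R) (e : R) :
  measurable_fun setT f -> has_mean P (fun w => f (X w)) e -> has_mean (law mX) f e.
Proof.
move=> mf [fi fe]; split.
  by apply: integrable_pushforward => //; exact/measurable_EFinP.
rewrite -fe /Rintegral; congr fine.
by apply: integral_pushforward => //; exact/measurable_EFinP.
Qed.

Lemma mean_of_sq (X : T -> R) (mu : R) : measurable_fun setT X ->
  P.-integrable setT (fun w => (X w ^+ 2)%:E) -> (\int[P]_w (X w)%:E)%E = mu%:E ->
  has_mean P X mu.
Proof.
move=> mX X2 Xmu.
have m2 : has_mean P (fun w => X w ^+ 2) (\int[P]_w (X w ^+ 2)) by split.
have <- : \int[P]_w X w = mu by rewrite /Rintegral Xmu.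
apply: (mean_dom (meanD (mean_cst P 1) m2) mX) => w.
rewrite -(real_normK (num_real (X w))).
by have := sqr_ge0 (`|X w| - 1); have := normr_ge0 (X w); nra.
Qed.

End transfer.

Lemma ruin_timeP {R : realType} (Z : R -> R) :
  (ruin_time Z < +oo)%E <-> exists t, 0 < t /\ Z t < 0.
Proof.
split.
  by move=> /ereal_inf_lt[_ [t [t0 Zt] <-] _]; exists t.
move=> [t tZ]; apply: (@le_lt_trans _ _ t%:E); last exact: ltry.
by apply: ereal_inf_lbound; exists t.
Qed.

Section discrete.
Context {R : realType} d (T : measurableType d) (P : probability T R) (xi rho : nat -> T -> R)
  (mx mr sx sr y : R).
Hypotheses
  (indep : mutually_independent P (fun bk : bool * nat => if bk.1 then xi bk.2 else rho bk.2))
  (lawxi : forall k, same_law P (xi k) (xi 0%N))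
  (lawrho : forall k, same_law P (rho k) (rho 0%N))
  (ixi : P.-integrable setT (fun w => (xi 0%N w ^+ 2)%:E))
  (irho : P.-integrable setT (fun w => (ln (rho 0%N w) ^+ 2)%:E))
  (Exi : (\int[P]_w (xi 0%N w)%:E)%E = mx%:E)
  (Erho : (\int[P]_w (ln (rho 0%N w))%:E)%E = mr%:E)
  (sx0 : 0 < sx) (Vxi : (\int[P]_w ((xi 0%N w - mx) ^+ 2)%:E)%E = (sx ^+ 2)%:E)
  (sr0 : 0 < sr) (Vrho : (\int[P]_w ((ln (rho 0%N w) - mr) ^+ 2)%:E)%E = (sr ^+ 2)%:E)
  (y0 : 0 <= y).

Let phi (i : bool * nat) (x : R) : R := if i.1 then x - mx else ln x - mr.
Let X (i : bool * nat) (w : T) : R := if i.1 then xi i.2 w - mx else ln (rho i.2 w) - mr.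

Let mphi i : measurable_fun setT (phi i).
Proof.
rewrite /phi; case: i => [[] k] /=.
  by apply: measurable_funB.
by apply: measurable_funB => //; exact: measurable_ln.
Qed.

Let indX : mutually_independent P X.
Proof.
have := mutually_independent_comp indep mphi.
by congr mutually_independent; apply/funext => -[[] k]; apply/funext.
Qed.

Let mX i : measurable_fun setT (X i). Proof. exact: indX.1. Qed.

Definition xi_law := law P (mX (true, 0%N)).
Definition rho_law := law P (mX (false, 0%N)).

Let lawA k D : measurable D -> P (X (true, k) @^-1` D) = xi_law D.
Proof.
move=> mD; rewrite lawE.
exact: (lawxi k (measurable_pre (mphi (true, 0%N)) mD)).
Qed.

Let lawB k D : measurable D -> P (X (false, k) @^-1` D) = rho_law D.
Proof.
move=> mD; rewrite lawE.
exact: (lawrho k (measurable_pre (mphi (false, 0%N)) mD)).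
Qed.

Let mxi k : measurable_fun setT (xi k). Proof. exact: indep.1 (true, k). Qed.
Let mlr k : measurable_fun setT (fun w => ln (rho k w)).
Proof. by apply: measurableT_comp; [exact: measurable_ln|exact: indep.1 (false, k)]. Qed.

Lemma xi_law1 : has_mean xi_law id 0.
Proof.
apply: mean_law => //; have := meanB (mean_of_sq (mxi 0) ixi Exi) (mean_cst P mx).
by rewrite subrr; apply: eq_mean.
Qed.

Lemma xi_law2 : has_mean xi_law (fun a => a ^+ 2) (sx ^+ 2).
Proof.
apply: mean_law; first exact: measurable_funX.
by apply: mean_of_int Vxi; [apply: measurable_funX; exact: mX (true, 0%N)|move=> w; exact: sqr_ge0].
Qed.

Lemma rho_law1 : has_mean rho_law id 0.
Proof.
apply: mean_law => //; have := meanB (mean_of_sq (mlr 0) irho Erho) (mean_cst P mr).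
by rewrite subrr; apply: eq_mean.
Qed.

Lemma rho_law2 : has_mean rho_law (fun b => b ^+ 2) (sr ^+ 2).
Proof.
apply: mean_law; first exact: measurable_funX.
by apply: mean_of_int Vrho; [apply: measurable_funX; exact: mX (false, 0%N)|move=> w; exact: sqr_ge0].
Qed.

Let theta n k w := theta_seq (fun k => xi_n mx xi n k w) (fun k => expR (gamma_n mr rho n k w)) y k.

Let thetaS n : (0 < n)%N -> forall k w, theta n k.+1 w =
  step mx mr false (mesh n) (theta n k w) (X (true, k) w) (X (false, k) w).
Proof.
move=> n0 k w; rewrite /theta /= /step expr0 mulr1 mesh_sqr//.
Qed.

(** Times [t > 0] below [1 / n] have index 0, where the chain equals [y >= 0]; index [k + 1] is
    attained at [t = (k + 1) / n]. Passing from times to indices therefore loses nothing. *)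
Lemma tau_n_finite n : (0 < n)%N ->
  [set w | (tau_n y mx mr xi rho n w < +oo)%E] = [set w | exists k, theta n k w < 0].
Proof.
move=> n0; have n0' : 0 < n%:R :> R by rewrite ltr0n.
apply/seteqP; split => w /=.
  by move=> /ruin_timeP[t [t0 tZ]]; exists (Num.truncn (n%:R * t)).
move=> [[|k] kZ]; first by move: kZ; rewrite /theta /= ltNge y0.
apply/ruin_timeP; exists (k.+1%:R / n%:R); split; first by rewrite divr_gt0.
by rewrite /theta_n mulrCA divff ?gt_eqF// mulr1 natrK.
Qed.

Lemma discrete_lower g eps : ratio_lim sx sr mx mr y g -> 0 < eps ->
  \forall n \near \oo,
    ((g - eps)%:E <= P [set w | (tau_n y mx mr xi rho n w < +oo)%E])%E.
Proof.
move=> yg eps0.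
have [del del0 [T1 T10 H]] := ruin_lower_lim xi_law1 xi_law2 rho_law1 rho_law2 false sx0 sr0 yg y0 eps0.
near=> n; have n0 : (0 < n)%N by near: n; exists 1%N.
rewrite tau_n_finite//.
pose N := Num.bound (T1 * n%:R).
have TN : T1 * n%:R <= N%:R.
  by apply/ltW/archi_boundP; rewrite mulr_ge0// ltW.
have HN : forall N i, T1 * n%:R <= N%:R ->
      g - eps <= 1 - surv xi_law rho_law mx mr false n (above (- del)) N i y by near: n.
have th0 w : theta n 0%N w = y by [].
apply: le_trans (ruin_ever_ge indX lawA lawB th0 (thetaS n0) 0 N).
rewrite lee_fin; apply: le_trans (HN N 0%N TN) _.
rewrite lerD2l lerN2; apply: surv_sub => [i|i|i x]; try exact: measurable_above.
by rewrite /above /= => x0; rewrite (le_trans _ x0)// oppr_le0 ltW.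
Unshelve. all: by end_near. Qed.

Lemma discrete_le1 n : (0 < n)%N ->
  (P [set w | (tau_n y mx mr xi rho n w < +oo)%E] <= 1%:E)%E.
Proof.
move=> n0; rewrite tau_n_finite//.
have th0 w : theta n 0%N w = y by [].
apply: (ruin_ever_le indX lawA lawB th0 (thetaS n0)) => N.
have [_ /(_ y)/andP[S0 _]] := surv_prop xi_law rho_law mx mr false n N (measurable_above 0) 0.
by rewrite lerBlDr lerDl.
Qed.

Lemma discrete_upper g eps : ratio_lim sx sr mx mr y g -> 0 < eps ->
  (exists2 C : R, C < 1 & \forall n \near \oo, exists2 p,
     has_mean rho_law (fun b => expR (-2 * (mr * mesh n ^+ 2 + b * mesh n))) p & p ^+ n <= C) ->
  \forall n \near \oo,
    (P [set w | (tau_n y mx mr xi rho n w < +oo)%E] <= (g + eps)%:E)%E.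
Proof.
move=> yg eps0 HC.
have H := ruin_upper_lim xi_law1 xi_law2 rho_law1 rho_law2 false sx0 sr0 yg y0 eps0 HC.
near=> n; have n0 : (0 < n)%N by near: n; exists 1%N.
rewrite tau_n_finite//.
have HN : forall N i, 1 - surv xi_law rho_law mx mr false n (above 0) N i y <= g + eps by near: n.
have th0 w : theta n 0%N w = y by [].
exact: (ruin_ever_le indX lawA lawB th0 (thetaS n0) (fun N => HN N 0%N)).
Unshelve. all: by end_near. Qed.

(** The hypothesis concerns an extended expectation. For [n > 0] a finite bound on its power
    excludes [+oo], which gives the integrability contained in [has_mean]. *)
Lemma moment_condition (C : R) n0 :
  (forall n : nat, (n0 <= n)%N ->
        ((\int[P]_w (expR (-2 * gamma_n mr rho n 0%N w))%:E) ^+ n <= C%:E)%E) ->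
  \forall n \near \oo, exists2 p,
     has_mean rho_law (fun b => expR (-2 * (mr * mesh n ^+ 2 + b * mesh n))) p & p ^+ n <= C.
Proof.
move=> HC; near=> n; have n1 : (0 < n)%N by near: n; exists 1%N.
have nn : (n0 <= n)%N by near: n; exists n0.
have := HC n nn; set I := (\int[P]_w _)%E => IC.
have I0 : (0 <= I)%E by apply: integral_ge0 => w _; rewrite lee_fin expR_ge0.
have Ifin : I \is a fin_num.
  rewrite ge0_fin_numE// ltNge leye_eq; apply/negP => /eqP Ioo.
  move: IC; rewrite Ioo; case: (n) n1 => // k _.
  have : (+oo ^+ k.+1 = +oo :> \bar R)%E.
    by elim: k => [|k IH]; rewrite ?expe1// expeS IH mulyy.
  by move=> ->; rewrite leye_eq.
exists (fine I); last first.
  by rewrite -lee_fin EFin_expe fineK.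
apply: mean_law.
  apply: measurableT_comp => //; apply: measurable_funM => //; apply: measurable_funD => //.
  exact: measurable_funM.
apply: mean_of_int => [|w|].
- apply: measurableT_comp => //; apply: measurable_funM => //; apply: measurable_funD => //.
  by apply: measurable_funM => //; exact: mX (false, 0%N).
- exact: expR_ge0.
- rewrite (fineK Ifin) /I; apply: eq_integral => w _.
  by rewrite /gamma_n mesh_sqr.
Unshelve. all: by end_near. Qed.

End discrete.

(** * Gaussian noise *)

Section gaussian.
Context {R : realType}.
Local Notation mu := (@lebesgue_measure R).
Local Notation N01 := (normal_prob (0 : R) 1).

Lemma integral_normal_prob (m s : R) (f : R -> \bar R) : measurable_fun setT f ->
  (forall x, (0 <= f x)%E) ->
  (\int[normal_prob m s]_x f x = \int[mu]_x (f x * (normal_pdf m s x)%:E))%E.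
Proof.
move=> mf f0; have dom := normal_prob_dominates m s.
have mpdf : measurable_fun setT (fun x => (normal_pdf m s x)%:E).
  by apply/measurable_EFinP; exact: measurable_normal_pdf.
rewrite -(Radon_Nikodym_SigmaFinite.change_of_variables dom)//.
apply: ae_eq_integral => //.
- apply: emeasurable_funM => //; apply: (measurable_int mu).
  exact: Radon_Nikodym_SigmaFinite.f_integrable.
- exact: emeasurable_funM.
- apply: ae_eqe_mul2l; apply: integral_ae_eq => //.
    exact: Radon_Nikodym_SigmaFinite.f_integrable.
  by move=> E _ mE; rewrite -Radon_Nikodym_SigmaFinite.f_integral.
Qed.

(** Completing the square: [expR (t * x)] times the density centred at 0 is [expR (t ^ 2 / 2)] times
    the density centred at [t]. *)
Lemma normal_mgf (t : R) : has_mean N01 (fun x => expR (t * x)) (expR (t ^+ 2 / 2)).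
Proof.
have me : measurable_fun setT (fun x : R => expR (t * x)).
  by apply: measurableT_comp => //; exact: measurable_funM.
apply: mean_of_int => //.
rewrite integral_normal_prob; [|exact/measurable_EFinP|by move=> x; rewrite lee_fin expR_ge0].
have E x : ((expR (t * x))%:E * (normal_pdf 0 1 x)%:E =
    (expR (t ^+ 2 / 2))%:E * (normal_pdf t 1 x)%:E)%E.
  rewrite -!EFinM; congr EFin.
  rewrite !normal_pdfE ?oner_neq0// mulrCA [RHS]mulrCA; congr (_ * _).
  by rewrite /normal_fun -!expRD; congr expR; field.
under eq_integral do rewrite E.
rewrite ge0_integralZl//=.
- by rewrite integral_normal_pdf mule1.
- by apply/measurable_EFinP; exact: measurable_normal_pdf.
- by move=> x _; rewrite lee_fin normal_pdf_ge0.
Qed.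

Lemma expR_abs_le (a x : R) : 0 <= a -> expR (a * `|x|) <= expR (a * x) + expR (- a * x).
Proof.
move=> a0; have [x0|x0] := leP 0 x.
  by rewrite ger0_norm// lerDl expR_ge0.
by rewrite ltr0_norm// mulrN -mulNr lerDr expR_ge0.
Qed.

(** The moments are read off the generating function: it is expanded at 0 with unknown coefficients
    [m], [v], to be compared in [normal_moments] with the expansion of [expR (t ^ 2 / 2)]. The
    remainder is dominated by [expR (2 * |x|)], integrable by [normal_mgf] at 2 and -2. *)
Lemma normal_taylor : exists m v K : R,
  [/\ has_mean N01 id m, has_mean N01 (fun x => x ^+ 2) v &
    forall t : R, `|t| <= 1 -> `|expR (t ^+ 2 / 2) - 1 - t * m - t ^+ 2 / 2 * v| <= K * `|t| ^+ 3].
Proof.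
have mE2 := meanD (normal_mgf 2) (normal_mgf (- 2)).
have mE1 := meanD (normal_mgf 1) (normal_mgf (- 1)).
have pow3 (u : R) : 0 <= u -> u ^+ 3 <= 27 * expR u.
  move=> u0; have h : u / 3 <= expR (u / 3) by have := expR_ge1Dx (u / 3); lin.
  have -> : expR u = expR (u / 3) ^+ 3 by rewrite -expRM_natl; congr expR; field.
  have -> : u ^+ 3 = 27 * (u / 3) ^+ 3 by field.
  by rewrite ler_wpM2l// lerXn2r ?nnegrE ?expR_ge0 ?divr_ge0.
have m1 : has_mean N01 id (\int[N01]_x x).
  apply: (mean_dom mE1) => // x; apply: le_trans (expR_abs_le x ler01).
  by have := expR_ge1Dx (1 * `|x|); rewrite mul1r; have := normr_ge0 x; lin.
have m2 : has_mean N01 (fun x => x ^+ 2) (\int[N01]_x (x ^+ 2)).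
  apply: (mean_dom (meanZ 4 mE1)) => [|x]; first exact: measurable_funX.
  rewrite ger0_norm ?sqr_ge0// -(real_normK (num_real x)).
  apply: le_trans (_ : 4 * expR (1 * `|x|) <= _); last by rewrite ler_wpM2l// expR_abs_le.
  have h : `|x| / 2 <= expR (`|x| / 2) by have := expR_ge1Dx (`|x| / 2); lin.
  have -> : expR (1 * `|x|) = expR (`|x| / 2) ^+ 2 by rewrite -expRM_natl; congr expR; field.
  have -> : `|x| ^+ 2 = 4 * (`|x| / 2) ^+ 2 by field.
  by rewrite ler_wpM2l// lerXn2r ?nnegrE ?expR_ge0 ?divr_ge0.
exists (\int[N01]_x x), (\int[N01]_x (x ^+ 2)).
exists (expR 1 * 27 * (expR (2 ^+ 2 / 2) + expR ((- 2) ^+ 2 / 2))); split=> // t t1.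
have mR := meanB (meanB (meanB (normal_mgf t) (mean_cst N01 1)) (meanZ t m1)) (meanZ (t ^+ 2 / 2) m2).
have [e' ne' le_e'] := mean_norm mR.
apply: (le_trans le_e').
rewrite mulrAC; apply: (mean_le ne' (meanZ (expR 1 * 27 * `|t| ^+ 3) mE2)) => x.
have -> : expR (t * x) - 1 - t * x - t ^+ 2 / 2 * x ^+ 2 =
   expR (t * x) - 1 - t * x - (t * x) ^+ 2 / 2 by field.
have tx : `|t * x| <= `|x| by rewrite normrM ler_piMl.
apply: (le_trans (expR_taylor2 tx)).
rewrite normrM exprMn expRD.
have := pow3 _ (normr_ge0 x) => h3.
apply: (@le_trans _ _ (expR `|x| * expR 1 * (`|t| ^+ 3 * (27 * expR `|x|)))).
  by rewrite ler_wpM2l ?mulr_ge0 ?expR_ge0// ler_wpM2l// exprn_ge0.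
have -> : expR `|x| * expR 1 * (`|t| ^+ 3 * (27 * expR `|x|)) =
   expR 1 * 27 * `|t| ^+ 3 * (expR `|x| * expR `|x|) by ring.
rewrite ler_wpM2l ?mulr_ge0 ?expR_ge0 ?exprn_ge0//.
rewrite -expRD; have -> : `|x| + `|x| = 2 * `|x| by ring.
exact: expR_abs_le.
Qed.

(** Uniqueness of Taylor coefficients, with explicit values of [t] small enough to contradict [a] or
    [b] being nonzero. *)
Lemma small_quadratic (a b K : R) :
  (forall t : R, `|t| <= 1 -> `|t * a + t ^+ 2 * b| <= K * `|t| ^+ 3) -> a = 0 /\ b = 0.
Proof.
move=> H.
have K0 : 0 <= K by have := H 1; rewrite normr1 !expr1n mulr1 => /(_ (lexx _)); exact: le_trans.
have HL (t : R) : 0 < t -> t <= 1 -> `|a + t * b| <= K * t ^+ 2.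
  move=> t0 t1; have := H t; rewrite gtr0_norm// => /(_ t1).
  have -> : t * a + t ^+ 2 * b = t * (a + t * b) by ring.
  rewrite normrM gtr0_norm//; have -> : K * t ^+ 3 = t * (K * t ^+ 2) by ring.
  by rewrite ler_pM2l.
have a0 : a = 0.
  apply/eqP/negPn/negP => an0; have A0 : 0 < `|a| by rewrite normr_gt0.
  pose S := `|a| + `|b| + K + 1.
  have S0 : 0 < S by rewrite ltr_wpDl// !addr_ge0.
  pose t := `|a| / (2 * S).
  have t0 : 0 < t by rewrite divr_gt0// mulr_gt0.
  have tS : t * (2 * S) = `|a| by rewrite /t mulfVK// gt_eqF// mulr_gt0.
  have aS : `|a| <= S by rewrite /S; have := normr_ge0 b; lin.
  have t1 : t <= 1 by rewrite ler_pdivrMr ?mulr_gt0//; lin.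
  have := HL t t0 t1.
  have := lerB_normD a (t * b); rewrite normrM gtr0_norm// => h1 h2.
  have : K * t ^+ 2 <= K * t by rewrite ler_wpM2l// expr2 ler_piMl// ltW.
  have : t * (`|a| + 1) > 0 by rewrite mulr_gt0// ltr_wpDl.
  have := tS; rewrite /S; lin.
split=> //; apply/eqP/negPn/negP => bn0; have B0 : 0 < `|b| by rewrite normr_gt0.
pose t := `|b| / (2 * (K + `|b|)).
have S0 : 0 < K + `|b| by rewrite ltr_wpDl.
have t0 : 0 < t by rewrite divr_gt0// mulr_gt0.
have t1 : t <= 1 by rewrite ler_pdivrMr ?mulr_gt0//; lin.
have tS : t * (2 * (K + `|b|)) = `|b| by rewrite /t mulfVK// gt_eqF// mulr_gt0.
have := HL t t0 t1; rewrite a0 add0r normrM gtr0_norm// expr2 mulrCA ler_pM2l// => h.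
have : 0 < t * `|b| by rewrite mulr_gt0.
have : 0 <= K * t by rewrite mulr_ge0// ltW.
by have := tS; lin.
Qed.

Lemma normal_moments : has_mean N01 id 0 /\ has_mean N01 (fun x => x ^+ 2) 1.
Proof.
have [m [v [K [m1 m2 H]]]] := normal_taylor.
suff [m0 /eqP] : m = 0 /\ (v - 1) / 2 = 0.
  rewrite mulf_eq0 invr_eq0 pnatr_eq0 orbF subr_eq0 => /eqP v1.
  by move: m1 m2; rewrite m0 v1.
apply: (@small_quadratic _ _ (K + expR (1 + 1))) => t t1.
have u0 : 0 <= t ^+ 2 / 2 by rewrite divr_ge0 ?sqr_ge0.
have at0 : 0 <= `|t| by [].
have t2E : t ^+ 2 = `|t| ^+ 2 by rewrite real_normK// num_real.
have t21 : `|t| ^+ 2 <= 1 by rewrite exprn_ile1.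
have u1 : `|t ^+ 2 / 2| <= 1 by rewrite ger0_norm//; lin.
have T2 := expR_taylor2 u1; rewrite (ger0_norm u0) in T2.
have HT := H t t1.
have -> : t * m + t ^+ 2 * ((v - 1) / 2) =
   (expR (t ^+ 2 / 2) - 1 - t ^+ 2 / 2 - (t ^+ 2 / 2) ^+ 2 / 2) + (t ^+ 2 / 2) ^+ 2 / 2
   - (expR (t ^+ 2 / 2) - 1 - t * m - t ^+ 2 / 2 * v) by field.
apply: (le_trans (ler_normB _ _)); rewrite mulrDl addrC lerD//.
apply: (le_trans (ler_normD _ _)).
have e1 : 1 <= expR (1 + 1 : R) by have := expR_ge1Dx (1 + 1 : R); lin.
have u3 : (t ^+ 2 / 2) ^+ 3 <= `|t| ^+ 3 / 2.
  rewrite t2E; have -> : (`|t| ^+ 2 / 2) ^+ 3 = `|t| ^+ 3 * `|t| ^+ 3 / 8 by field.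
  have : `|t| ^+ 3 <= 1 by rewrite exprn_ile1.
  have := exprn_ge0 3 at0; nra.
have u2 : `|(t ^+ 2 / 2) ^+ 2 / 2| <= `|t| ^+ 3 / 2.
  rewrite ger0_norm ?divr_ge0 ?exprn_ge0// t2E.
  have -> : (`|t| ^+ 2 / 2) ^+ 2 / 2 = `|t| ^+ 3 * `|t| / 8 by field.
  have := exprn_ge0 3 at0; nra.
have : expR (1 + 1) * (t ^+ 2 / 2) ^+ 3 <= expR (1 + 1) * (`|t| ^+ 3 / 2).
  by rewrite ler_wpM2l ?expR_ge0.
have := exprn_ge0 3 at0; nra.
Qed.

(** Lebesgue measure and [s] times its image under dilation agree on half-open intervals, hence are
    equal. *)
Lemma lebesgue_scale (s : R) (f : R -> \bar R) : 0 < s -> measurable_fun setT f ->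
  (forall x, 0 <= f x)%E ->
  (\int[mu]_x f x = \int[mu]_x (s%:E * f (s * x)%R))%E.
Proof.
move=> s0 mf f0.
have s10 : 0 <= s by exact: ltW.
pose dil : measurableTypeR R -> measurableTypeR R := fun x => s * x.
have md : measurable_fun setT dil by exact: measurable_funM.
pose mu' : {measure set (measurableTypeR R) -> \bar R} :=
  mscale (NngNum s10) (pushforward mu dil).
have E A : measurable A -> mu A = mu' md A.
  apply: lebesgue_measure_unique => _ [[a b]] _ <-.
  rewrite /mu' /= /mscale /= /pushforward.
  have -> : dil @^-1` [set` `]a, b]] = `](a / s), (b / s)]%classic.
    by apply/seteqP; split => x /=; rewrite !in_itv/= ltr_pdivrMr// ler_pdivlMr// mulrC.
  rewrite !lebesgue_measure_itv/= !lte_fin ltr_pM2r ?invr_gt0//.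
  case: ifP => _; last by rewrite mule0.
  by rewrite -!EFinB -EFinM -mulrBl mulrCA divff ?gt_eqF// mulr1.
rewrite (eq_measure_integral (mu' md)); last by move=> A mA _; exact: E.
rewrite ge0_integral_mscale//= ge0_integral_pushforward// ge0_integralZl//.
exact: (measurableT_comp mf md).
Qed.

Lemma normal_prob_scale (s : R) (B : set R) : 0 < s -> measurable B ->
  normal_prob 0 s [set x | B (x / s)] = N01 B.
Proof.
move=> s0 mB.
have mB' : measurable [set x | B (x / s)].
  by apply: (measurable_pre (f := fun x : R => x / s)) => //; exact: measurable_funM.
rewrite /normal_prob integral_mkcond [RHS]integral_mkcond.
set A := [set x | B (x / s)].
have mpdf (m t : R) : measurable_fun setT (fun x => (normal_pdf m t x)%:E).
  by apply/measurable_EFinP; exact: measurable_normal_pdf.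
rewrite (lebesgue_scale s0); last 2 first.
- by apply: ((measurable_restrictT _ mB').1 _); apply: measurable_funTS; exact: mpdf.
- by move=> x; rewrite /patch; case: ifP; rewrite ?lee_fin ?normal_pdf_ge0.
apply: eq_integral => x _.
have xA : (s * x \in A) = (x \in B).
  by apply/idP/idP; rewrite !inE /A /= mulrAC divff ?gt_eqF// mul1r.
rewrite /patch xA; case: ifP => _; last by rewrite mule0.
rewrite -EFinM; congr EFin; rewrite !normal_pdfE ?oner_neq0 ?gt_eqF//.
rewrite mulrA /normal_fun !subr0; congr (_ * expR _); last first.
  by rewrite expr1n; field; rewrite gt_eqF.
rewrite /normal_peak expr1n mul1r -mulrnAr sqrtrM ?sqr_ge0// sqrtr_sqr gtr0_norm//.
by rewrite invfM mulrA divff ?gt_eqF// mul1r.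
Qed.

End gaussian.

(** * The diffusion *)

Section coarse_times.
Context {R : realType} (al be : probability R R) (sx sr : R).
Hypotheses (al1 : has_mean al id 0) (al2 : has_mean al (fun a => a ^+ 2) (sx ^+ 2))
  (be1 : has_mean be id 0) (be2 : has_mean be (fun b => b ^+ 2) (sr ^+ 2)).
Variables (mx mr : R) (c : bool).
Local Notation surv := (surv al be mx mr c).
Local Notation Q := (Q al be mx mr c).

Lemma step_homo t (x y a b : R) : x <= y -> step mx mr c t x a b <= step mx mr c t y a b.
Proof. by move=> xy; rewrite /step lerD2l ler_wpM2r ?expR_ge0. Qed.

(** A coupling: driven by the same noise, the chain started higher stays higher, as [step] is
    nondecreasing in [x]. *)
Lemma surv_homo n (G : nat -> set R) N i (x y : R) : (forall j, measurable (G j)) ->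
  (forall j u v, u <= v -> G j u -> G j v) -> x <= y -> surv n G N i x <= surv n G N i y.
Proof.
move=> mG upG; elim: N i x y => [|N IH] i x y xy /=.
all: have indxy : \1_(G i) x <= \1_(G i) y :> R
  by rewrite !indicE; case: (boolP (x \in G i)) => [/set_mem/(upG _ _ _ xy)/mem_set ->|_] //; exact: ler0n.
- exact: indxy.
have mS u := mean_surv al be mx mr c n N i.+1 u mG.
have /andP[i0 _] := indic01 (G i) x.
apply: ler_pM => //.
- by apply: (mean_le (mean_cst _ 0) (mS x)) => z; have [_ /(_ (step mx mr c (mesh n) x z.1 z.2)) /andP[]] := surv_prop al be mx mr c n N mG i.+1.
- by apply: (mean_le (mS x) (mS y)) => z; apply: IH; exact: step_homo.
Qed.

(** Only multiples of [l] are tested; with [n = q * l] steps per unit of time these are the times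
    [j / q], finitely many on a bounded horizon whatever [l] is. *)
Definition coarse (l : nat) (b : R) (i : nat) : set R :=
  if (l %| i)%N then above b i else setT.

Lemma measurable_coarse l b i : measurable (coarse l b i).
Proof. by rewrite /coarse; case: ifP => // _; exact: measurable_above. Qed.

Lemma coarse_up l (b : R) j u v : u <= v -> coarse l b j u -> coarse l b j v.
Proof. by rewrite /coarse; case: ifP => // _ uv; rewrite /above /= => /le_trans; apply. Qed.

(* Started at or below [- a], the chain is still below [- b] at the next multiple of
   [l] except with probability [O(l / n)]: the quadratic [((x + a) / (a - b)) ^ 2] is at
   least 1 above [- b], and one step increases its mean by [O(1 / n)]. *)
Lemma coarse_below (a b : R) : 0 < b -> b < a -> exists2 C : R, 0 < C &
  \forall n \near \oo, forall l N i (x : R), (0 < l)%N -> (l %| i + N)%N ->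
    x <= - a -> surv n (coarse l (- b)) N i x <= C / n%:R * l%:R.
Proof.
move=> b0 ba; pose kap := (a - b)^-1.
have ab0 : 0 < a - b by rewrite subr_gt0.
have kap0 : 0 < kap by rewrite invr_gt0.
pose F (x : R) := (kap * (x + a)) ^+ 2.
pose F1 (x : R) := 2 * kap ^+ 2 * (x + a).
pose F2 (x : R) := 2 * kap ^+ 2.
(* [F] is convex and [F1] nondecreasing, so their values at the end points bound them on the whole
   interval. *)
pose lo := - a - 2; pose hi : R := 1; pose B := F lo + F hi + `|F1 lo| + `|F1 hi| + F2 0.
have dF t : lo < t < hi -> is_derive t (1 : R) F (F1 t).
  by move=> _; rewrite /F /F1; apply: is_derive_eq; rewrite /GRing.scale/=; ring.
have dF1 t : lo < t < hi -> is_derive t (1 : R) F1 (F2 t).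
  by move=> _; rewrite /F1 /F2; apply: is_derive_eq; rewrite /GRing.scale/=; ring.
have dF2 t : lo < t < hi -> is_derive t (1 : R) F2 (cst 0 t).
  by move=> _; rewrite /F2; apply: is_derive_cst.
have F_ge0 t : 0 <= F t by exact: sqr_ge0.
have F20 : 0 <= F2 0 by rewrite /F2 mulr_ge0 ?sqr_ge0.
have B0 : 0 <= B by rewrite !addr_ge0.
have k20 : 0 < kap ^+ 2 by rewrite exprn_gt0.
have F0B t : lo < t < hi -> `|F t| <= B.
  move=> /andP[lt th]; rewrite ger0_norm//.
  have [ta|ta] := leP (t + a) 0.
    have : F t <= F lo.
      rewrite /F !exprMn ler_wpM2l ?(ltW k20)//.
      by rewrite -[leLHS]sqrrN -[leRHS]sqrrN ler_sqr ?nnegrE; lin.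
    rewrite /B; have := F_ge0 hi; have := normr_ge0 (F1 lo); have := normr_ge0 (F1 hi); lin.
  have : F t <= F hi.
    by rewrite /F !exprMn ler_wpM2l ?(ltW k20)// ler_sqr ?nnegrE; lin.
  rewrite /B; have := F_ge0 lo; have := normr_ge0 (F1 lo); have := normr_ge0 (F1 hi); lin.
have F1B t : lo < t < hi -> `|F1 t| <= B.
  move=> /andP[lt th].
  have k2 : 0 <= 2 * kap ^+ 2 by rewrite mulr_ge0// ltW.
  have e1 : F1 lo <= F1 t by rewrite /F1 ler_wpM2l//; lin.
  have e2 : F1 t <= F1 hi by rewrite /F1 ler_wpM2l//; lin.
  have n1 := ler_norm (F1 hi); have n2 := ler_norm (- F1 lo); rewrite normrN in n2.
  have := F_ge0 lo; have := F_ge0 hi; have := normr_ge0 (F1 lo); have := normr_ge0 (F1 hi).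
  by rewrite ler_norml /B => *; apply/andP; split; lin.
have F2B t : lo < t < hi -> `|F2 t| <= B.
  move=> _; rewrite ger0_norm// /B; have := F_ge0 lo; have := F_ge0 hi.
  by have := normr_ge0 (F1 lo); have := normr_ge0 (F1 hi); rewrite /F2; lin.
have F3B t : lo < t < hi -> `|cst 0 t : R| <= B by rewrite normr0.
have [C C0 CP] := @clip_taylor R F F1 F2 (cst 0) lo hi (- a - 1) 0 (- a) (- b) B
  (ltac:(rewrite /lo; lin)) (ltac:(lin)) (ltac:(lin)) (ltac:(rewrite /hi; lin))
  dF dF1 dF2 B0 F0B F1B F2B F3B.
pose f := F \o clip (- a - 1) 0.
have mf : measurable_fun setT f.
  apply: (measurableT_comp _ (measurable_clip _ _)).
  by apply: measurable_funX; apply: measurable_funM => //; exact: measurable_funD.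
have f0 x : 0 <= f x by exact: F_ge0.
(* A bound for the generator on [[- a, - b]], plus 1 for the error of [Q_taylor] taken with
   [eps = 1]. *)
pose D := C * (`|mx| + (`|a| + 1) * (`|mr| + sr ^+ 2)) + C * (sx ^+ 2 + (`|a| + 1) ^+ 2 * sr ^+ 2) + 1.
have D0 : 0 < D.
  have A0 : 0 <= `|mx| + (`|a| + 1) * (`|mr| + sr ^+ 2).
    by apply: addr_ge0 => //; apply: mulr_ge0; apply: addr_ge0; rewrite ?sqr_ge0.
  have A1 : 0 <= sx ^+ 2 + (`|a| + 1) ^+ 2 * sr ^+ 2.
    by apply: addr_ge0; rewrite ?sqr_ge0//; apply: mulr_ge0; exact: sqr_ge0.
  by apply: ltr_wpDl => //; apply: addr_ge0; exact: mulr_ge0.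
exists D => //.
near=> n.
have n0 : (0 < n)%N by near: n; exists 1%N.
have n1 : 0 < n%:R^-1 :> R by rewrite invr_gt0 ltr0n.
have T : forall (f : R -> R) (x u1 u2 : R), measurable_fun setT f ->
    taylor_at B C f x u1 u2 -> `|x| <= `|a| + 1 ->
    `|Q n f x - f x - n%:R^-1 * generator sx sr mx mr x u1 u2| <= 1 * n%:R^-1.
  by near: n; apply: (Q_taylor al1 al2 be1 be2) => //; rewrite addr_ge0.
have Qf x : - a <= x <= - b -> Q n f x <= f x + D / n%:R.
  move=> xI; have tx := CP _ xI; have [_ u1C u2C _] := tx.
  have xa : `|x| <= `|a| + 1.
    move/andP: xI => [h1 h2]; rewrite ler_norml; apply/andP; split.
      by have := ler_norm a; lin.
    by have := normr_ge0 a; lin.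
  have := T f x _ _ mf tx xa; rewrite mul1r ler_norml => /andP[_ h].
  have g1 : F1 x * drift sr mx mr x <= C * (`|mx| + (`|a| + 1) * (`|mr| + sr ^+ 2)).
    rewrite (le_trans (ler_norm _))// normrM ler_pM// /drift.
    rewrite (le_trans (ler_normD _ _))// lerD2l normrM ler_pM//.
    rewrite (le_trans (ler_normD _ _))// lerD2l ger0_norm ?divr_ge0 ?sqr_ge0//.
    by have := sqr_ge0 sr; lin.
  have g2 : F2 x / 2 * (sx ^+ 2 + x ^+ 2 * sr ^+ 2) <= C * (sx ^+ 2 + (`|a| + 1) ^+ 2 * sr ^+ 2).
    have x2 : x ^+ 2 <= (`|a| + 1) ^+ 2.
      by rewrite -(real_normK (num_real x)) ler_sqr ?nnegrE// addr_ge0.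
    have q0 : 0 <= sx ^+ 2 + x ^+ 2 * sr ^+ 2.
      by apply: addr_ge0; rewrite ?sqr_ge0//; apply: mulr_ge0; exact: sqr_ge0.
    apply: (@le_trans _ _ (C * (sx ^+ 2 + x ^+ 2 * sr ^+ 2))).
      by apply: ler_wpM2r => //; have := ler_norm (F2 x); have := normr_ge0 (F2 x); lin.
    by apply: ler_wpM2l => //; rewrite lerD2l; apply: ler_wpM2r; rewrite ?sqr_ge0.
  have : n%:R^-1 * generator sx sr mx mr x (F1 x) (F2 x) <= n%:R^-1 * (D - 1).
    by rewrite ler_pM2l// /generator /D; lin.
  lin.
(* The parabola rises again to the left of [- a]; there [phi] is kept at 0, which is legitimate
   because survival is monotone in the starting point. *)
pose phi x := f (maxr x (- a)).
have phi_f x : phi x <= f x.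
  rewrite /phi; have [//|xa] := leP (- a) x; rewrite ?lexx//.
  by rewrite /f /= clip_id ?/F; [rewrite addNr mulr0 expr0n /= sqr_ge0|apply/andP; split; lin].
have phi1 x : - b <= x -> 1 <= phi x.
  move=> bx; rewrite /phi (max_idPl _); last by lin.
  have h : a - b <= clip (- a - 1) 0 x + a.
    by rewrite -lerBlDr /clip le_min !le_max; apply/andP; split; [lin|apply/orP; right; lin].
  rewrite /f /= /F -[leLHS](expr1n _ 2) ler_sqr ?nnegrE//.
    by rewrite /kap mulrC ler_pdivlMr ?mul1r.
  by apply: mulr_ge0; [exact: ltW|lin].
(* As [l] divides [i + N], the residue [N %% l] is the number of steps from time [i] to the next
   multiple of [l], and is 0 at a multiple. *)
have main l N i x : (0 < l)%N -> (l %| i + N)%N ->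
    surv n (coarse l (- b)) N i x <= phi x + D / n%:R * (N %% l)%:R.
  move=> l0; have mG := measurable_coarse l (- b).
  have S01 M j z : 0 <= surv n (coarse l (- b)) M j z <= 1.
    by have [_ h] := surv_prop al be mx mr c n M mG j.
  have coarse0 j z : (l %| j)%N -> z < - b -> \1_(coarse l (- b) j) z = 0 :> R.
    by move=> lj zb; rewrite /coarse lj above_indic leNgt zb.
  have Dn M : 0 <= D / n%:R * M%:R by rewrite mulr_ge0// divr_ge0 ?ler0n// ltW.
  elim: N i x => [|N IH] i x lN.
    have [bx|xb] := leP (- b) x.
      have := phi1 _ bx; have /andP[_] := S01 0%N i x; have := Dn (0 %% l)%N; lin.
    rewrite /= coarse0//; first exact: addr_ge0 (f0 _) (Dn _).
    by rewrite addn0 in lN.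
  suff H z : - a <= z -> surv n (coarse l (- b)) N.+1 i z <= phi z + D / n%:R * (N.+1 %% l)%:R.
    have [ax|xa] := leP (- a) x; first exact: H.
    apply: le_trans (surv_homo n N.+1 i mG (@coarse_up l (- b)) (ltW xa)) _.
    by apply: le_trans (H _ (lexx _)) _; rewrite /phi maxxx (max_idPr (ltW xa)).
  move=> az; have [bz|zb] := leP (- b) z.
    have := phi1 _ bz; have /andP[_] := S01 N.+1 i z; have := Dn (N.+1 %% l)%N; lin.
  have [lN1|lN1] := boolP (l %| N.+1)%N.
    have li : (l %| i)%N by move: lN; rewrite dvdn_addl.
    by rewrite /= coarse0// mul0r; exact: addr_ge0 (f0 _) (Dn _).
  have mS := mean_surv al be mx mr c n N i.+1 z mG.
  have fM y : `|f y| <= B.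
    have xI : - a <= - a <= - b by apply/andP; split; lin.
    by have [] := CP _ xI.
  have mF := @mean_Q R al be mx mr c n f B z mf fM.
  have QS : Q n (surv n (coarse l (- b)) N i.+1) z <= Q n f z + D / n%:R * (N %% l)%:R.
    apply: (mean_le mS (meanD mF (mean_cst _ _))) => p.
    have lN' : (l %| i.+1 + N)%N by rewrite addSnnS.
    by apply: le_trans (IH i.+1 _ lN') _; rewrite lerD2r.
  have zI : - a <= z <= - b by rewrite az ltW.
  have := Qf z zI.
  have modS : (N.+1 %% l = (N %% l).+1)%N.
    by rewrite modnS (negbTE lN1).
  rewrite modS -natr1 mulrDr mulr1.
  have -> : phi z = f z by rewrite /phi (max_idPl az).
  have := S01 N i.+1; have /andP[I0 I1] := indic01 (coarse l (- b) i) z.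
  have Q0 : 0 <= Q n (surv n (coarse l (- b)) N i.+1) z.
    by apply: (mean_le (mean_cst _ 0) mS) => p; have /andP[] := S01 N i.+1 (step mx mr c (mesh n) z p.1 p.2).
  have : \1_(coarse l (- b) i) z * Q n (surv n (coarse l (- b)) N i.+1) z <= Q n (surv n (coarse l (- b)) N i.+1) z.
    by rewrite ler_piMl.
  rewrite /=; lin.
move=> l N i x l0 lN xa; apply: (le_trans (main l N i x l0 lN)).
have -> : phi x = 0.
  rewrite /phi (max_idPr xa) /f /= clip_id; last by apply/andP; split; lin.
  by rewrite /F addNr mulr0 expr0n.
rewrite add0r ler_wpM2l ?divr_ge0 ?ler0n ?(ltW D0)// ler_nat ltnW// ltn_mod.
Unshelve. all: by end_near. Qed.

(** A chain that passes all coarse tests either stays above [- a] or falls below it at some first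
    time, after which [coarse_below] applies. The final time [i + N] is a multiple of [l], so that a
    test always follows. *)
Lemma coarse_surv (a b : R) : 0 < b -> b < a -> exists2 C : R, 0 < C &
  \forall n \near \oo, forall l N i (x : R), (0 < l)%N -> (l %| i + N)%N ->
    surv n (coarse l (- b)) N i x <= surv n (above (- a)) N i x + C / n%:R * l%:R.
Proof.
move=> b0 ba; have [C C0 CP] := coarse_below b0 ba; exists C => //.
apply: filterS CP => n nP l N i x l0; have mG := measurable_coarse l (- b).
have mA := measurable_above (- a).
have C0' : 0 <= C / n%:R * l%:R by rewrite mulr_ge0// divr_ge0 ?ler0n// ltW.
elim: N i x => [|N IH] i x lN; have [ax|xa] := leP (- a) x.
- rewrite /= above_indic ax; have /andP[_] := indic01 (coarse l (- b) i) x; rewrite /=; lin.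
- apply: (le_trans (nP l 0%N i x l0 lN (ltW xa))); rewrite lerDr /=.
  by have /andP[] := indic01 (above (- a) i) x.
- rewrite /= above_indic ax mul1r.
  have mS := mean_surv al be mx mr c n N i.+1 x mG.
  have mS' := mean_surv al be mx mr c n N i.+1 x mA.
  have lN' : (l %| i.+1 + N)%N by rewrite addSnnS.
  have QS := mean_le mS (meanD mS' (mean_cst _ (C / n%:R * l%:R)))
    (fun z => IH i.+1 (step mx mr c (mesh n) x z.1 z.2) lN').
  apply: le_trans QS.
  have /andP[I0 I1] := indic01 (coarse l (- b) i) x.
  rewrite ler_piMl//.
  apply: (mean_le (mean_cst _ 0) mS) => p.
  by have [_ /(_ (step mx mr c (mesh n) x p.1 p.2)) /andP[]] := surv_prop al be mx mr c n N mG i.+1.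
- apply: (le_trans (nP l N.+1 i x l0 lN (ltW xa))); rewrite lerDr.
  by have [_ /(_ x) /andP[]] := surv_prop al be mx mr c n N.+1 mA i.
Qed.

End coarse_times.

(** * What the moment condition implies in the limit *)

Section moment_rate.
Context {R : realType} (be : probability R R) (sr mr : R).
Hypotheses (be1 : has_mean be id 0) (be2 : has_mean be (fun b => b ^+ 2) (sr ^+ 2)).

(* [F] is the third order Taylor polynomial of [x ^- 2] at 1; clipped, it is bounded and
   below [x ^- 2], so its generator at 1, namely [2 sr ^ 2 - 2 mr], bounds the growth rate of
   [E (e ^ (- 2 gamma))] from below. *)
Lemma moment_rate (C : R) : C < 1 -> (\forall n \near \oo, exists2 p,
     has_mean be (fun b => expR (-2 * (mr * mesh n ^+ 2 + b * mesh n))) p & p ^+ n <= C) ->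
  sr ^+ 2 < mr.
Proof.
move=> C1 HC.
have m0 : measurable_fun setT (cst 0 : R -> R) by exact: measurable_cst.
(* A point mass at 0: without drift or additive noise the chain is the pure product [x * e ^ gamma],
   to which [Q_taylor] applies. *)
pose al := law be m0.
have mean_al (f : R -> R) : measurable_fun setT f -> has_mean al f (f 0).
  by move=> mf; apply: mean_law => //; exact: (mean_cst be (f 0)).
have al1 : has_mean al id 0 by apply: mean_al.
have al2 : has_mean al (fun a => a ^+ 2) (0 ^+ 2) by apply: (mean_al (fun a => a ^+ 2)); exact: measurable_funX.
pose F (x : R) := 1 - 2 * (x - 1) + 3 * (x - 1) ^+ 2 - 4 * (x - 1) ^+ 3.
pose F1 (x : R) := - 2 + 6 * (x - 1) - 12 * (x - 1) ^+ 2.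
pose F2 (x : R) := 6 - 24 * (x - 1).
pose F3 (x : R) := - 24 : R.
(* For [|x - 1| <= 2] the functions [F], [F1], [F2], [F3] are at most 49, 62, 54 and 24 in absolute
   value. *)
pose lo : R := -1; pose hi : R := 3; pose B : R := 70.
have dF t : lo < t < hi -> is_derive t (1 : R) F (F1 t).
  by move=> _; rewrite /F /F1; apply: is_derive_eq; rewrite /GRing.scale/=; ring.
have dF1 t : lo < t < hi -> is_derive t (1 : R) F1 (F2 t).
  by move=> _; rewrite /F1 /F2; apply: is_derive_eq; rewrite /GRing.scale/=; ring.
have dF2 t : lo < t < hi -> is_derive t (1 : R) F2 (F3 t).
  by move=> _; rewrite /F2 /F3; apply: is_derive_eq; rewrite /GRing.scale/=; ring.
have bnd (t : R) : lo < t < hi -> `|t - 1| <= 2.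
  by rewrite /lo /hi => /andP[h1 h2]; rewrite ler_norml; apply/andP; split; lin.
have pow (t : R) k : lo < t < hi -> `|(t - 1) ^+ k| <= 2 ^+ k.
  by move=> /bnd h; rewrite normrX lerXn2r ?nnegrE.
have B0 : 0 <= B by exact: ler0n.
have F0B t : lo < t < hi -> `|F t| <= B.
  move=> tI; have := bnd t tI; have := pow t 2 tI; have := pow t 3 tI.
  rewrite /F /B !ler_norml => /andP[? ?] /andP[? ?] /andP[? ?]; apply/andP; split; lin.
have F1B t : lo < t < hi -> `|F1 t| <= B.
  move=> tI; have := bnd t tI; have := pow t 2 tI.
  rewrite /F1 /B !ler_norml => /andP[? ?] /andP[? ?]; apply/andP; split; lin.
have F2B t : lo < t < hi -> `|F2 t| <= B.
  move=> tI; have := bnd t tI.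
  rewrite /F2 /B !ler_norml => /andP[? ?]; apply/andP; split; lin.
have F3B t : lo < t < hi -> `|F3 t| <= B.
  by move=> _; rewrite /F3 /B ler_norml; apply/andP; split; lin.
have [D D0 DP] := @clip_taylor R F F1 F2 F3 lo hi 0 2 1 1 B
  (ltac:(rewrite /lo; lin)) (ltac:(lin)) (ltac:(lin)) (ltac:(rewrite /hi; lin))
  dF dF1 dF2 B0 F0B F1B F2B F3B.
pose f := F \o clip 0 2.
have mf : measurable_fun setT f.
  apply: (measurableT_comp _ (measurable_clip _ _)).
  have m1 : measurable_fun setT (fun x : R => x - 1) by exact: measurable_funB.
  apply: measurable_funB; last by apply: measurable_funM => //; exact: measurable_funX.
  apply: measurable_funD; last by apply: measurable_funM => //; exact: measurable_funX.
  by apply: measurable_funB => //; exact: measurable_funM.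
have ft : taylor_at B D f 1 (F1 1) (F2 1) by apply: DP; rewrite lexx.
have fB x : `|f x| <= B by have [] := ft.
have fe (u : R) : f (expR u) <= expR (- 2 * u).
  have e0 := expR_gt0 u; have -> : expR (- 2 * u) = (expR u ^+ 2)^-1.
    by rewrite -expRM_natl -expRN mulNr.
  set x := expR u in e0 *; have x20 : 0 < x ^+ 2 by rewrite exprn_gt0.
  have [x2|x2] := leP x 2.
    rewrite /f /= clip_id; last by rewrite (ltW e0) x2.
    rewrite -[leRHS]mul1r ler_pdivlMr//.
    (* The last factor is [4 * x + 1 > 0], so [F] lies below [x ^- 2] for positive [x]. *)
    have -> : F x * x ^+ 2 = 1 - (x - 1) ^+ 2 ^+ 2 * (5 + 4 * (x - 1)) by rewrite /F; ring.
    by rewrite gerBl mulr_ge0 ?sqr_ge0//; lin.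
  have -> : f x = - 2.
    rewrite /f /= /clip (max_idPr (ltW e0)) (min_idPl (ltW x2)) /F; ring.
  have : 0 <= (x ^+ 2)^-1 by rewrite invr_ge0 ltW.
  by apply: le_trans; rewrite oppr_le0 ler0n.
(* [mean_le] compares pointwise, while the additive noise vanishes only almost surely; adding
   [B * ind], of mean 0, makes the comparison hold everywhere. *)
pose ind (a : R) : R := \1_(~` [set (0 : R)]) a.
have mind : measurable_fun setT ind by apply: measurable_indic; exact: measurableC.
have ind0 : ind 0 = 0 by rewrite /ind indicE memNset//= => /(_ erefl).
(* The left side is [2 * sr ^ 2 - 2 * mr]. One step lowers the mean by at least [(1 - C) / n], and
   half of this is left to the error of [Q_taylor]. *)
have key : F1 1 * (mr + sr ^+ 2 / 2) + F2 1 / 2 * sr ^+ 2 <= - ((1 - C) / 2).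
  near \oo => n; have n0 : (0 < n)%N by near: n; exists 1%N.
  have n0' : 0 < n%:R :> R by rewrite ltr0n.
  have [p mp pC] : exists2 p,
     has_mean be (fun b => expR (-2 * (mr * mesh n ^+ 2 + b * mesh n))) p & p ^+ n <= C by near: n.
  have T : forall (f : R -> R) (x u1 u2 : R), measurable_fun setT f ->
    taylor_at B D f x u1 u2 -> `|x| <= 1 ->
    `|Q al be 0 mr false n f x - f x - n%:R^-1 * generator 0 sr 0 mr x u1 u2| <= (1 - C) / 2 * n%:R^-1.
    by near: n; apply: (Q_taylor al1 al2 be1 be2) => //; lin.
  have p0 : 0 <= p by apply: (mean_le (mean_cst be 0) mp) => b; exact: expR_ge0.
  have pn := bernoulli_root p0 pC C1 n0.
  have Qp : Q al be 0 mr false n f 1 <= p.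
    have h := meanD (mean_snd al mp) (mean_fst be (meanZ B (mean_al _ mind))).
    rewrite ind0 mulr0 addr0 in h.
    apply: (mean_le (@mean_Q R al be 0 mr false n f B 1 mf fB) h) => z /=.
    have [z0|z0] := eqVneq z.1 0.
      by rewrite z0 ind0 mulr0 addr0 /step mul0r mul0r addr0 mul0r add0r mul1r.
    have -> : ind z.1 = 1 by rewrite /ind indicE mem_set//; exact/eqP.
    rewrite mulr1 (le_trans (ler_norm _))// (le_trans (fB _))// lerDr; exact: expR_ge0.
  have f1 : f 1 = 1.
    by rewrite /f /= clip_id; [rewrite /F; ring|apply/andP; split; lin].
  have := T f 1 _ _ mf ft; rewrite normr1 => /(_ (lexx _)); rewrite f1 ler_norml => /andP[h _].
  have {}h : n%:R^-1 * generator 0 sr 0 mr 1 (F1 1) (F2 1) <= n%:R^-1 * (- ((1 - C) / 2)).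
    have E : n%:R^-1 * (- ((1 - C) / 2)) = - ((1 - C) / n%:R) + (1 - C) / 2 * n%:R^-1.
      by field; rewrite gt_eqF.
    rewrite E; lin.
  move: h; rewrite ler_pM2l ?invr_gt0// /generator /drift.
  by rewrite add0r mul1r expr0n /= add0r expr1n mul1r.
move: key; rewrite /F1 /F2 subrr; rewrite !mulr0 expr0n /= mulr0 addr0 !subr0; lin.
Unshelve. all: by end_near. Qed.

End moment_rate.

Section gaussian_law.
Context {R : realType}.
Local Notation N01 := (normal_prob (0 : R) 1).

Let mscale (s : R) : measurable_fun setT (fun x : R => s * x).
Proof. exact: measurable_funM. Qed.

(** An image of the standard normal law, so that its moments follow from [normal_moments] and
    [normal_mgf]; [gaussE] links it to Brownian increments. *)
Definition gauss (s : R) : probability R R := law N01 (mscale s).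

Lemma gauss_mean1 s : has_mean (gauss s) id 0.
Proof.
have [m1 _] := @normal_moments R.
by apply: mean_law => //; have := meanZ s m1; rewrite mulr0; apply: eq_mean.
Qed.

Lemma gauss_mean2 s : has_mean (gauss s) (fun a => a ^+ 2) (s ^+ 2).
Proof.
have [_ m2] := @normal_moments R.
apply: mean_law; first exact: measurable_funX.
by have := meanZ (s ^+ 2) m2; rewrite mulr1; apply: eq_mean => x; rewrite exprMn.
Qed.

(** The power [p ^ n] is computed exactly and does not depend on [n]. *)
Lemma gauss_moment (mr sr : R) : sr ^+ 2 < mr -> exists2 C : R, C < 1 &
  \forall n \near \oo, exists2 p, has_mean (gauss sr)
    (fun b => expR (-2 * (mr * mesh n ^+ 2 + b * mesh n))) p & p ^+ n <= C.
Proof.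
move=> srmr; exists (expR (- 2 * (mr - sr ^+ 2))).
  by rewrite expR_lt1; lin.
near=> n; have n0 : (0 < n)%N by near: n; exists 1%N.
have n0' : n%:R != 0 :> R by rewrite gt_eqF ?ltr0n.
exists (expR (- 2 * (mr - sr ^+ 2) / n%:R)); last first.
  by rewrite -expRM_natl mulrC divfK.
apply: mean_law.
  apply: measurableT_comp => //; apply: measurable_funM => //; apply: measurable_funD => //.
  exact: measurable_funM.
have := meanZ (expR (- 2 * mr * mesh n ^+ 2)) (normal_mgf (- 2 * sr * mesh n)).
rewrite -expRD (_ : _ + _ = - 2 * (mr - sr ^+ 2) / n%:R); last first.
  by rewrite !exprMn -(mesh_sqr n0); field.
by apply: eq_mean => x; rewrite -expRD; congr expR; ring.
Unshelve. all: by end_near. Qed.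

Lemma gaussE (s : R) n D : (0 < n)%N -> measurable D ->
  normal_prob 0 (mesh n) [set x | D (s / mesh n * x)] = gauss s D.
Proof.
move=> n0 mD; have t0 : 0 < mesh n :> R by rewrite invr_gt0 sqrtr_gt0 ltr0n.
rewrite -[RHS]/(N01 [set x | D (s * x)]) -(normal_prob_scale t0); last first.
  exact: measurable_pre.
by congr normal_prob; apply/seteqP; split => x /=; rewrite mulrAC mulrA.
Qed.

End gaussian_law.

Lemma mutually_independent_reindex d (T : measurableType d) (R : realType)
  (P : probability T R) (I J : eqType) (X : I -> T -> R) (g : J -> I) (h : I -> J) :
  cancel g h -> mutually_independent P X -> mutually_independent P (fun j => X (g j)).
Proof.
move=> gK [mX indX]; split=> [j|K B uK mB]; first exact: mX.
have := indX (map g K) (fun i => B (h i)).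
rewrite map_inj_uniq ?big_map//; last exact: can_inj gK.
move=> /(_ uK (fun i => mB (h i))).
under eq_bigr do rewrite gK.
move=> <-; congr (P _); apply/seteqP; split => w /= H.
  by move=> _ /mapP[j jK ->]; rewrite gK; exact: H.
by move=> j jK; have := H (g j) (map_f g jK); rewrite gK.
Qed.

(** * Left-point Riemann sums along a Brownian path *)

Section riemann_chain.
Context {R : realType} d (T : measurableType d) (P : probability T R)
  (W W' : R -> T -> R) (mx mr sx sr y : R).
Hypothesis BM : indep_std_BM2 P W W'.
Local Notation Rp := (fun t w => mr * t + sr * W t w).
Local Notation Xp := (fun t w => mx * t + sx * W' t w).

(** Here [true] marks the additive noise, driven by [W'], whereas [indep_std_BM2] marks its first
    process [W] by [true]; hence the swap of the flag in [noise_indep]. *)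
Definition noise n (i : bool * nat) (w : T) : R :=
  let V := if i.1 then W' else W in
  (if i.1 then sx else sr) / mesh n * (V (i.2.+1%:R / n%:R) w - V (i.2%:R / n%:R) w).

Definition riemann_chain n k (w : T) : R := expR (Rp (k%:R / n%:R) w) *
  (y + \sum_(i < k) expR (- Rp (i%:R / n%:R) w) *
         (Xp (i.+1%:R / n%:R) w - Xp (i%:R / n%:R) w)).

Lemma noise_indep n : (0 < n)%N -> mutually_independent P (noise n).
Proof.
move=> n0; have [_ [_ [_ [_ [_ [_ ind]]]]]] := BM.
have n0' : 0 < n%:R^-1 :> R by rewrite invr_gt0 ltr0n.
have := ind (fun i => i%:R / n%:R).
rewrite mul0r => /(_ (lexx _) (fun i => ltac:(by rewrite ltr_pM2r// ltr_nat))).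
move=> /(@mutually_independent_comp _ _ _ _ _ _
  (fun i x => (if i.1 then sr else sx) / mesh n * x)) indW.
have mphi (i : bool * nat) : measurable_fun setT (fun x : R => (if i.1 then sr else sx) / mesh n * x).
  exact: measurable_funM.
have gK : cancel (fun i : bool * nat => (~~ i.1, i.2)) (fun i => (~~ i.1, i.2)).
  by move=> [b k] /=; rewrite negbK.
have := mutually_independent_reindex gK (indW mphi).
by congr mutually_independent; apply/funext => -[[] k].
Qed.

Lemma noise_law n k D : (0 < n)%N -> measurable D ->
  P (noise n (true, k) @^-1` D) = gauss sx D /\ P (noise n (false, k) @^-1` D) = gauss sr D.
Proof.
move=> n0 mD; have [_ [_ [_ [_ [_ [lawW _]]]]]] := BM.
have n0' : 0 < n%:R^-1 :> R by rewrite invr_gt0 ltr0n.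
have k0 : 0 <= k%:R / n%:R :> R by rewrite divr_ge0 ?ler0n.
have k1 : k%:R / n%:R < k.+1%:R / n%:R :> R by rewrite ltr_pM2r// ltr_nat.
have tE : Num.sqrt (k.+1%:R / n%:R - k%:R / n%:R) = mesh n :> R.
  by rewrite -mulrBl -natr1 addrAC subrr add0r mul1r sqrtrV ?ler0n.
have mB (s : R) : measurable [set x | D (s / mesh n * x)].
  by apply: (measurable_pre (f := fun x : R => s / mesh n * x)) => //; exact: measurable_funM.
split.
- by have [_] := lawW _ _ k0 k1 _ (mB sx); rewrite tE gaussE.
- by have [+ _] := lawW _ _ k0 k1 _ (mB sr); rewrite tE gaussE.
Qed.

Lemma riemann_chain0 n w : riemann_chain n 0 w = y.
Proof.
have [_ [_ [/(_ w)[W0 _] _]]] := BM.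
by rewrite /riemann_chain big_ord0 mul0r mulr0 W0 mulr0 addr0 expR0 mul1r addr0.
Qed.

Lemma riemann_chainS n k w : (0 < n)%N -> riemann_chain n k.+1 w =
  step mx mr true (mesh n) (riemann_chain n k w) (noise n (true, k) w) (noise n (false, k) w).
Proof.
move=> n0; have t0 : mesh n != 0 :> R by rewrite gt_eqF// invr_gt0 sqrtr_gt0 ltr0n.
have n0' : n%:R != 0 :> R by rewrite pnatr_eq0 -lt0n.
rewrite /step mesh_sqr// expr1 -mulrDl.
have -> : mr * n%:R^-1 + noise n (false, k) w * mesh n =
   Rp (k.+1%:R / n%:R) w - Rp (k%:R / n%:R) w.
  by rewrite /noise /= -natr1; field; rewrite n0' t0.
have -> : mx * n%:R^-1 + noise n (true, k) w * mesh n =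
   Xp (k.+1%:R / n%:R) w - Xp (k%:R / n%:R) w.
  by rewrite /noise /= -natr1; field; rewrite n0' t0.
rewrite /riemann_chain big_ord_recr /=.
move: (mr * (k.+1%:R / n%:R) + _) (mr * (k%:R / n%:R) + _) => u v.
by rewrite expRD expRN; field; rewrite gt_eqF ?expR_gt0.
Qed.

(** Cutting [[0, j / q]] into [j * l] pieces gives the mesh [1 / (q * l)] for every [j]: one chain
    carries the Riemann sums for all coarse times at once. *)
Lemma riemann_chainE q l j w : (0 < q)%N -> (0 < l)%N -> (0 < j)%N ->
  riemann_chain (q * l) (j * l) w =
  expR (Rp (j%:R / q%:R) w) * (y + riemann_sum Rp Xp (j * l) (j%:R / q%:R) w).
Proof.
move=> q0 l0 j0.
have q0' : q%:R != 0 :> R by rewrite pnatr_eq0 -lt0n.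
have l0' : l%:R != 0 :> R by rewrite pnatr_eq0 -lt0n.
have j0' : j%:R != 0 :> R by rewrite pnatr_eq0 -lt0n.
have E i : j%:R / q%:R * i%:R / (j * l)%:R = i%:R / (q * l)%:R :> R.
  by rewrite !natrM; field; rewrite q0' l0' j0'.
rewrite /riemann_chain /riemann_sum; congr (expR _ * (y + _)).
  have -> : (j * l)%:R / (q * l)%:R = j%:R / q%:R :> R.
    by rewrite !natrM; field; rewrite q0' l0'.
  by [].
by apply: eq_bigr => i _; rewrite !E.
Qed.

Lemma measurable_riemann_chain n k : (0 < n)%N -> measurable_fun setT (riemann_chain n k).
Proof.
move=> n0; have [mN _] := noise_indep n0.
elim: k => [|k IH].
  by rewrite (_ : riemann_chain n 0 = cst y)//; apply/funext => w; exact: riemann_chain0.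
rewrite (_ : riemann_chain n k.+1 = fun w => step mx mr true (mesh n)
  (riemann_chain n k w) (noise n (true, k) w) (noise n (false, k) w)).
  apply: (measurableT_comp (measurable_step mx mr true (mesh n))
    (measurable_fun_pair IH (measurable_fun_pair (mN (true, k)) (mN (false, k))))).
by apply/funext => w; exact: riemann_chainS.
Qed.

End riemann_chain.

(** * Ruin probability of the diffusion *)

Section diffusion_ruin.
Context {R : realType} d (T : measurableType d) (P : probability T R)
  (W W' Y : R -> T -> R) (mx mr sx sr y g : R).
Hypothesis BM : indep_std_BM2 P W W'.
Local Notation Rp := (fun t w => mr * t + sr * W t w).
Local Notation Xp := (fun t w => mx * t + sx * W' t w).
Hypotheses (mY : forall t, measurable_fun setT (Y t))
  (cY : forall w, {within [set t : R | 0 <= t], continuous (fun t => Y t w)})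
  (YE : forall t, 0 <= t -> forall eps, 0 < eps ->
     (fun m => P [set w | eps < `|Y t w - expR (Rp t w) * (y + riemann_sum Rp Xp m t w)|])
       @ \oo --> 0%E).
Hypotheses (sx0 : 0 < sx) (sr0 : 0 < sr) (y0 : 0 <= y) (yg : ratio_lim sx sr mx mr y g).
Local Notation chain := (riemann_chain W W' mx mr sx sr y).
Local Notation S n := (surv (gauss sx) (gauss sr) mx mr true n).

Let gap q l J eps := [set w | exists2 j, (0 < j <= J)%N &
  eps < `|Y (j%:R / q%:R) w - chain (q * l) (j * l) w|].

(** Convergence in probability at each of finitely many times, and a union bound; [j * l >= l]
    passes any threshold. *)
Lemma gap_small q J eps e : (0 < q)%N -> 0 < eps -> 0 < e -> \forall l \near \oo,
  [/\ (0 < l)%N, measurable (gap q l J eps) & (P (gap q l J eps) <= e%:E)%E].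
Proof.
move=> q0 eps0; elim: J e => [|J IH] e e0.
  near=> l; have l0 : (0 < l)%N by near: l; exists 1%N.
  have -> : gap q l 0 eps = set0.
    by apply/seteqP; split => w //= [j]; rewrite leqn0 => /andP[/lt0n_neq0/negbTE->].
  by split => //; rewrite measure0 lee_fin ltW.
have e2 : 0 < e / 2 by rewrite divr_gt0.
pose t : R := J.+1%:R / q%:R; have t0 : 0 <= t by rewrite divr_ge0 ?ler0n.
have /fine_cvgP[[m1 _ fin] /cvgrPdist_le/(_ _ e2)[m2 _ small]] := YE t0 eps0.
near=> l; have l0 : (0 < l)%N by near: l; exists 1%N.
have [_ mG PG] : [/\ (0 < l)%N, measurable (gap q l J eps) & (P (gap q l J eps) <= (e / 2)%:E)%E].
  by near: l; exact: IH.
pose B := [set w | eps < `|Y t w - chain (q * l) (J.+1 * l) w|].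
have ql0 : (0 < q * l)%N by rewrite muln_gt0 q0.
have mB : measurable B.
  apply: (measurable_pre (f := fun w => `|Y t w - chain (q * l) (J.+1 * l) w|) (D := [set x | eps < x])).
    apply: measurableT_comp => //; apply: measurable_funB => //.
    exact: (measurable_riemann_chain mx mr sx sr y BM).
  exact: open_measurable.
have -> : gap q l J.+1 eps = gap q l J eps `|` B.
  apply/seteqP; split => w /=.
    move=> [j /andP[j0]]; rewrite leq_eqVlt ltnS => /predU1P[->|jJ] jw; first by right.
    by left; exists j => //; rewrite j0.
  move=> [[j /andP[j0 jJ] jw]|Bw]; last by exists J.+1 => //; rewrite ltnS leqnn.
  by exists j => //; rewrite j0 leqW.
have PB : (P B <= (e / 2)%:E)%E.
  have lm1 : (m1 <= J.+1 * l)%N.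
    by apply: (@leq_trans l); [near: l; exists m1|rewrite leq_pmull].
  have lm2 : (m2 <= J.+1 * l)%N.
    by apply: (@leq_trans l); [near: l; exists m2|rewrite leq_pmull].
  have BE : B = [set w | eps < `|Y t w - expR (Rp t w) * (y + riemann_sum Rp Xp (J.+1 * l) t w)|].
    by apply/seteqP; split => w /=; rewrite /B /= riemann_chainE.
  have := small _ lm2; have := fin _ lm1; rewrite /= -BE => finB.
  rewrite sub0r normrN => h; rewrite -(fineK finB) lee_fin.
  by rewrite (le_trans _ h)// ler_norm.
split => //; first exact: measurableU.
apply: (le_trans (measureU2 _ _ _)) => //.
by rewrite [e in (_ <= e%:E)%E]splitr EFinD; apply: leeD.
Unshelve. all: by end_near. Qed.

Let ruin := [set w | exists t : R, 0 < t /\ Y t w < 0].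
(** Horizon, mesh and threshold all depend on [M], so that these events increase to ruin. The
    threshold is strictly negative to leave room for the error of the chain. *)
Let dyadic M := [set w | exists2 j, (0 < j <= M * 2 ^ M)%N &
  Y (j%:R / (2 ^ M)%:R) w < - M.+1%:R^-1].

Lemma dyadicS M N : (M <= N)%N -> dyadic M `<=` dyadic N.
Proof.
move=> /subnK <-; elim: (N - M)%N => [//|k IH] w /IH {IH}.
rewrite addSn; move: (k + M)%N => {k}K /= [j /andP[j0 jM] jw].
exists (2 * j)%N.
  rewrite muln_gt0 j0 expnS /= mulnCA leq_pmul2l//.
  by apply: (leq_trans jM); rewrite leq_mul2r leqnSn orbT.
rewrite expnS !natrM -mulf_div divff ?pnatr_eq0// mul1r; apply: (lt_trans jw).
by rewrite ltrN2 ltf_pV2 ?posrE ?ltr0n// ltr_nat.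
Qed.

Lemma dyadic_cover : \bigcup_M dyadic M = ruin.
Proof.
apply/seteqP; split => w /=.
  move=> [M _ [j /andP[j0 _] jw]]; exists (j%:R / (2 ^ M)%:R); split.
    by rewrite divr_gt0 ?ltr0n ?expn_gt0.
  by apply: (lt_trans jw); rewrite oppr_lt0 invr_gt0 ltr0n.
move=> [t [t0 Yt]].
have ct : {for t, continuous (fun s : R => Y s w)}.
  have sub : `]0, +oo[%classic `<=` [set t : R | 0 <= t].
    by move=> s; rewrite /= in_itv/= andbT => /ltW.
  have := continuous_subspaceW sub (@cY w).
  rewrite continuous_open_subspace; last exact: interval_open.
  by apply; rewrite inE /= in_itv/= t0.
have Yt2 : 0 < - Y t w / 2 by rewrite divr_gt0// oppr_gt0.
move/cvgrPdist_lt : ct => /(_ _ Yt2) /nbhs_ballP[r /= r0 near_t].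
have [M [Mt Mr MY]] : exists M : nat, [/\ t + 1 <= M%:R :> R, (2 ^ M)%:R^-1 < r & M.+1%:R^-1 < - Y t w / 2].
  exists (maxn (Num.bound (t + 1)) (maxn (Num.bound r^-1) (Num.bound (- Y t w / 2)^-1))).
  set M := maxn _ _.
  have bd (x : R) k : 0 < x -> (Num.bound x <= k)%N -> x < k%:R.
    by move=> x0 xk; apply: (lt_le_trans (archi_boundP (ltW x0))); rewrite ler_nat.
  have hM : (Num.bound r^-1 <= 2 ^ M)%N.
    by apply: (@leq_trans M); [rewrite /M !leq_max leqnn orbT|exact: ltnW (ltn_expl _ _)].
  have hM' : (Num.bound (- Y t w / 2)^-1 <= M.+1)%N.
    by rewrite leqW// /M !leq_max leqnn !orbT.
  split.
  - by apply/ltW/bd; [rewrite ltr_wpDl// ltW|rewrite leq_maxl].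
  - by rewrite invf_plt ?posrE ?ltr0n ?expn_gt0//; apply: bd => //; rewrite invr_gt0.
  - by rewrite invf_plt ?posrE ?ltr0n//; apply: bd => //; rewrite invr_gt0.
have q0 : 0 < (2 ^ M)%:R :> R by rewrite ltr0n expn_gt0.
have tq : 0 <= t * (2 ^ M)%:R by rewrite mulr_ge0// ltW.
have /andP[j1 j2] := truncn_itv tq.
set j := Num.truncn _ in j1 j2.
(* The right dyadic neighbour of [t]: its index is positive, and it is within [2 ^ - M < r] of
   [t]. *)
exists M => //; exists j.+1.
  rewrite andTb -(ler_nat R) natrM -natr1 (le_trans (lerD j1 (lexx 1)))//.
  rewrite (@le_trans _ _ ((t + 1) * (2 ^ M)%:R))//; last by rewrite ler_wpM2r// ltW.
  by rewrite mulrDl mul1r lerD2l ler1n expn_gt0.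
have s1 : t < j.+1%:R / (2 ^ M)%:R by rewrite ltr_pdivlMr.
have s2 : j.+1%:R / (2 ^ M)%:R <= t + (2 ^ M)%:R^-1.
  by rewrite ler_pdivrMr// mulrDl mulVf ?gt_eqF// -natr1 lerD2r.
have : ball t r (j.+1%:R / (2 ^ M)%:R) by rewrite /ball /= ltr_norml; apply/andP; split; lin.
move=> /near_t /=; rewrite ltr_norml => /andP[h _].
have K (a b m : R) : - (- a / 2) < a - b -> m < - a / 2 -> b < - m by lin.
exact: K h MY.
Qed.

Let mlt (t r : R) : measurable [set w | Y t w < r].
Proof.
apply: (measurable_pre (f := Y t) (D := [set x | x < r])) => //.
exact: open_measurable.
Qed.

Let measurable_dyadic M : measurable (dyadic M).
Proof.
rewrite (_ : dyadic M = \bigcup_(j in [set j | (0 < j <= M * 2 ^ M)%N])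
  [set w | Y (j%:R / (2 ^ M)%:R) w < - M.+1%:R^-1]); first by apply: bigcup_measurable.
by apply/seteqP; split => w /= [j jM jw]; exists j.
Qed.

Lemma measurable_ruin : measurable ruin.
Proof. by rewrite -dyadic_cover; exact: bigcupT_measurable. Qed.

(** Three losses of [eps / 3]: the ruin bound for the chain, the restriction to coarse times, and
    the distance from the chain to [Y]. The margin goes from [del] to [del / 2] at coarse times, and
    [Y] is compared within [del / 4]. *)
Lemma ruin_ge eps : 0 < eps -> ((g - eps)%:E <= P ruin)%E.
Proof.
move=> eps0; have e3 : 0 < eps / 3 by rewrite divr_gt0.
have [del del0 [T1 T10 low]] := ruin_lower_lim (gauss_mean1 sx) (gauss_mean2 sx)
  (gauss_mean1 sr) (gauss_mean2 sr) true sx0 sr0 yg y0 e3.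
have d2 : 0 < del / 2 by rewrite divr_gt0.
have d4 : 0 < del / 4 by rewrite divr_gt0.
have dd : del / 2 < del by lin.
have [C C0 fine_coarse] := coarse_surv (gauss_mean1 sx) (gauss_mean2 sx)
  (gauss_mean1 sr) (gauss_mean2 sr) mx mr true d2 dd.
(* The coarse mesh is fixed before [l]: with [n = q * l] the cost [C / n * l] equals [C / q] for
   every [l], which can then grow until the chain is close to [Y]. *)
pose q := (Num.bound (C / (eps / 3))).+1.
have q0' : 0 < q%:R :> R by rewrite ltr0n.
have Cq : C / q%:R <= eps / 3.
  rewrite ler_pdivrMr// mulrC -ler_pdivrMr//.
  apply: ltW; apply: (lt_le_trans (archi_boundP _)); first by rewrite divr_ge0// ltW.
  by rewrite ler_nat leqnSn.
pose J := Num.bound (T1 * q%:R).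
have TJ : T1 * q%:R <= J%:R by apply/ltW/archi_boundP; rewrite mulr_ge0// ltW.
have [n1 _ low'] := low; have [n2 _ fine'] := fine_coarse.
have [l [l0 mG PG ln1 ln2]] : exists l, [/\ (0 < l)%N, measurable (gap q l J (del / 4)%R),
    (P (gap q l J (del / 4)%R) <= (eps / 3)%:E)%E, (n1 <= l)%N & (n2 <= l)%N].
  near \oo => l; exists l.
  have [? ? ?] : [/\ (0 < l)%N, measurable (gap q l J (del / 4)%R) & (P (gap q l J (del / 4)%R) <= (eps / 3)%:E)%E].
    by near: l; exact: gap_small.
  by split => //; near: l; [exists n1|exists n2].
set n := (q * l)%N; have n0 : (0 < n)%N by rewrite muln_gt0.
have ln : (l <= n)%N by rewrite leq_pmull.
have TN : T1 * n%:R <= (J * l)%:R by rewrite !natrM mulrA ler_wpM2r.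
have lN : (l %| 0 + J * l)%N by rewrite add0n dvdn_mull.
have h1 := low' n (leq_trans ln1 ln) (J * l)%N 0%N TN.
have h2 := fine' n (leq_trans ln2 ln) l (J * l)%N 0%N y l0 lN.
have nlE : C / n%:R * l%:R = C / q%:R.
  by rewrite natrM; field; rewrite !pnatr_eq0 -!lt0n l0.
rewrite nlE in h2.
have mC := measurable_coarse l (- (del / 2)).
have lawA k D mD := (@noise_law R d T P W W' sx sr BM n k D n0 mD).1.
have lawB k D mD := (@noise_law R d T P W W' sx sr BM n k D n0 mD).2.
have th0 := @riemann_chain0 R d T P W W' mx mr sx sr y BM n.
have thS k w := @riemann_chainS R d T W W' mx mr sx sr y n k w n0.
have := chain_surv (noise_indep sx sr BM n0) lawA lawB mC th0 thS (J * l)%N.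
set A := [set w | _] => PA.
have mA : measurable A.
  rewrite (_ : A = \bigcap_(i < (J * l).+1) (chain n i @^-1` coarse l (- (del / 2)) i)); last first.
    by apply/seteqP; split => w /= h i; exact: h.
  apply: bigcap_measurableType => i _; apply: measurable_pre => //.
  exact: (measurable_riemann_chain mx mr sx sr y BM).
(* A failed test happens at an index [j * l], with [j > 0] since [y >= 0]. Either [Y] is negative at
   [j / q], or it differs from the chain by more than [del / 2]. *)
have sub : ~` A `<=` ruin `|` gap q l J (del / 4)%R.
  move=> w /= /existsNP[i /not_implyP[iN]]; rewrite /coarse.
  case: ifP => [/dvdnP[j iE]|_ []//]; rewrite /above /= => /negP; rewrite -ltNge => ci.
  have [j0|j0] := posnP j.
    by move: ci; rewrite iE j0 mul0n th0 ltNge (le_trans _ y0)// oppr_le0 ltW.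
  have [Yj|Yj] := ltP (Y (j%:R / q%:R) w) 0.
    by left; exists (j%:R / q%:R); split => //; rewrite divr_gt0 ?ltr0n.
  right; exists j; first by rewrite j0 -(leq_pmul2r l0) -iE.
  by rewrite -iE (lt_le_trans _ (ler_norm _))//; move: ci; rewrite -/n; lin.
have PAC : P (~` A) = (1 - S n (coarse l (- (del / 2))) (J * l) 0 y)%:E.
  by rewrite probability_setC// PA.
have : (P (~` A) <= P ruin + P (gap q l J (del / 4)%R))%E.
  have mR := measurable_ruin.
  apply: le_trans (measureU2 _ mR mG).
  by apply: le_measure; rewrite ?inE //; [exact: measurableC|exact: measurableU].
have finR : P ruin = (fine (P ruin))%:E by rewrite fineK// fin_num_measure//; exact: measurable_ruin.
move=> /le_trans /(_ (leeD (lexx _) PG)).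
rewrite PAC finR -EFinD !lee_fin; lin.
Unshelve. all: by end_near. Qed.

Hypothesis srmr : sr ^+ 2 < mr.

(** If [Y] is below [- 1 / (M + 1)] at a dyadic time, then the chain is negative there or at
    distance more than [1 / (M + 1)] from [Y]. The chain's ruin bound holds for all horizons, so
    [eps] is independent of [M]. *)
Lemma dyadic_le M eps : 0 < eps -> (P (dyadic M) <= (g + eps)%:E)%E.
Proof.
move=> eps0; have e2 : 0 < eps / 2 by rewrite divr_gt0.
have [n1 _ up] := ruin_upper_lim (gauss_mean1 sx) (gauss_mean2 sx)
  (gauss_mean1 sr) (gauss_mean2 sr) true sx0 sr0 yg y0 e2 (gauss_moment srmr).
set q := (2 ^ M)%N; have q0 : (0 < q)%N by rewrite expn_gt0.
have r0 : 0 < M.+1%:R^-1 :> R by rewrite invr_gt0 ltr0n.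
have [l [l0 mG PG ln1]] : exists l, [/\ (0 < l)%N, measurable (gap q l (M * q)%N M.+1%:R^-1%R),
    (P (gap q l (M * q)%N M.+1%:R^-1%R) <= (eps / 2)%:E)%E & (n1 <= l)%N].
  near \oo => l; exists l.
  have [? ? ?] : [/\ (0 < l)%N, measurable (gap q l (M * q)%N M.+1%:R^-1%R) & (P (gap q l (M * q)%N M.+1%:R^-1%R) <= (eps / 2)%:E)%E].
    by near: l; exact: gap_small.
  by split => //; near: l; exists n1.
set n := (q * l)%N; have n0 : (0 < n)%N by rewrite muln_gt0 q0.
have ln : (l <= n)%N by rewrite leq_pmull.
have lawA k D mD := (@noise_law R d T P W W' sx sr BM n k D n0 mD).1.
have lawB k D mD := (@noise_law R d T P W W' sx sr BM n k D n0 mD).2.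
have th0 := @riemann_chain0 R d T P W W' mx mr sx sr y BM n.
have thS k w := @riemann_chainS R d T W W' mx mr sx sr y n k w n0.
have PE := ruin_ever_le (noise_indep sx sr BM n0) lawA lawB th0 thS
  (fun N => up n (leq_trans ln1 ln) N 0%N).
set E := [set w | _] in PE.
have mE : measurable E.
  rewrite (_ : E = \bigcup_k (chain n k @^-1` [set x | x < 0])).
    apply: bigcupT_measurable => k; apply: measurable_pre; last exact: open_measurable.
    exact: (measurable_riemann_chain mx mr sx sr y BM).
  by apply/seteqP; split => w /= [k]; exists k.
have sub : dyadic M `<=` E `|` gap q l (M * q)%N M.+1%:R^-1%R.
  move=> w /= [j /andP[j0 jM] Yj].
  have [cj|cj] := ltP (chain n (j * l)%N w) 0; first by left; exists (j * l)%N.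
  right; exists j; first by rewrite j0.
  have K (a b m : R) : a < - m -> 0 <= b -> m < - (a - b) by lin.
  by rewrite -normrN (lt_le_trans _ (ler_norm _))//; exact: K Yj cj.
have : (P (dyadic M) <= P E + P (gap q l (M * q)%N M.+1%:R^-1%R))%E.
  apply: le_trans (measureU2 _ mE mG).
  by apply: le_measure; rewrite ?inE //; exact: measurableU.
move=> /le_trans; apply; apply: (le_trans (leeD PE PG)).
by rewrite -EFinD lee_fin; lin.
Unshelve. all: by end_near. Qed.

Lemma ruin_probability : P ruin = g%:E.
Proof.
apply/eqP; rewrite eq_le; apply/andP; split.
  have mR : measurable (\bigcup_M dyadic M) by rewrite dyadic_cover; exact: measurable_ruin.
  have cv := @nondecreasing_cvg_mu _ _ _ P dyadic measurable_dyadic mR.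
  have {}cv : (P \o dyadic) N @[N --> \oo] --> P ruin.
    by rewrite -dyadic_cover; apply: cv => N M NM; apply/subsetPset; exact: dyadicS.
  rewrite -(cvg_lim _ cv)//; apply: lime_le; first by apply/cvg_ex; eexists; exact: cv.
  apply: nearW => M; apply/lee_addgt0Pr => e e0; rewrite -EFinD; exact: dyadic_le.
apply/lee_subgt0Pr => e e0; rewrite -EFinB; exact: ruin_ge.
Qed.

End diffusion_ruin.

(** * Assembling the two regimes *)

Lemma cvg_EFin_of_bounds {R : realType} (u : nat -> \bar R) (g : R) :
  (forall e : R, 0 < e -> \forall n \near \oo, ((g - e)%:E <= u n)%E) ->
  (forall e : R, 0 < e -> \forall n \near \oo, (u n <= (g + e)%:E)%E) ->
  u @ \oo --> g%:E.
Proof.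
move=> low up; apply/fine_cvgP; split.
  near=> n; have h1 : ((g - 1)%:E <= u n)%E by near: n; exact: low.
  have h2 : (u n <= (g + 1)%:E)%E by near: n; exact: up.
  by rewrite fin_numElt (lt_le_trans (ltNyr _) h1) (le_lt_trans h2 (ltry _)).
apply/cvgrPdist_le => e e0; near=> n.
have : ((g - e)%:E <= u n)%E by near: n; exact: low.
have : (u n <= (g + e)%:E)%E by near: n; exact: up.
rewrite /=; case: (u n) => [r| |]; rewrite ?leye_eq ?leeNy_eq// !lee_fin /= => h1 h2.
by rewrite ler_norml; apply/andP; split; lin.
Unshelve. all: by end_near. Qed.

Theorem theorem4 (R : realType) (d : measure_display) (T : measurableType d)
  (P : probability T R) (xi rho : nat -> T -> R)
  (mu_xi mu_rho s_xi s_rho y : R) :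
  (* the family {xi_k, rho_k} is mutually independent: two independent i.i.d. sequences *)
  mutually_independent P (fun bk : bool * nat => if bk.1 then xi bk.2 else rho bk.2) ->
  (forall k, same_law P (xi k) (xi 0%N)) ->
  (forall k, same_law P (rho k) (rho 0%N)) ->
  (forall k, P [set w | rho k w <= 0] = 0%E) ->
  P.-integrable setT (fun w => (xi 0%N w ^+ 2)%:E) ->
  P.-integrable setT (fun w => (ln (rho 0%N w) ^+ 2)%:E) ->
  (\int[P]_w (xi 0%N w)%:E)%E = mu_xi%:E ->
  (\int[P]_w (ln (rho 0%N w))%:E)%E = mu_rho%:E ->
  0 < s_xi -> (\int[P]_w ((xi 0%N w - mu_xi) ^+ 2)%:E)%E = (s_xi ^+ 2)%:E ->
  0 < s_rho -> (\int[P]_w ((ln (rho 0%N w) - mu_rho) ^+ 2)%:E)%E = (s_rho ^+ 2)%:E ->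
  0 <= y ->
  (* (i) *)
  (mu_rho <= 0 ->
     (fun n => P [set w | (tau_n y mu_xi mu_rho xi rho n w < +oo)%E]) @ \oo --> 1%E)
  /\
  (* (ii) *)
  (0 < mu_rho ->
   (exists C : R, C < 1 /\ exists n0 : nat, (1 <= n0)%N /\
      forall n : nat, (n0 <= n)%N ->
        ((\int[P]_w (expR (-2 * gamma_n mu_rho rho n 0%N w))%:E) ^+ n <= C%:E)%E) ->
   ((fun n => P [set w | (tau_n y mu_xi mu_rho xi rho n w < +oo)%E]) @ \oo -->
      (H_fun mu_xi mu_rho s_xi s_rho (- y) / H_fun mu_xi mu_rho s_xi s_rho 0)%:E)
   /\
   (* P(tau(y) < oo) = H(-y)/H(0), where Y is the process built from two independent
      standard Brownian motions W, W' (on any probability space) *)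
   (forall (d' : measure_display) (T' : measurableType d') (P' : probability T' R)
           (W W' : R -> T' -> R) (Y : R -> T' -> R),
      indep_std_BM2 P' W W' ->
      let Rp := fun t w => mu_rho * t + s_rho * W t w in
      let Xp := fun t w => mu_xi * t + s_xi * W' t w in
      (forall t, measurable_fun setT (Y t)) ->
      (forall w, {within [set t : R | 0 <= t], continuous (fun t => Y t w)}) ->
      (* Y_t = e^{R_t} (y + int_0^t e^{-R_s} dX_s), the stochastic integral being the
         limit in probability of left-point Riemann sums *)
      (forall t, 0 <= t -> forall eps, 0 < eps ->
         (fun m => P' [set w | eps < `|Y t w - expR (Rp t w) * (y + riemann_sum Rp Xp m t w)|])
           @ \oo --> 0%E) ->
      P' [set w | (ruin_time (fun t => Y t w) < +oo)%E]
      = (H_fun mu_xi mu_rho s_xi s_rho (- y) / H_fun mu_xi mu_rho s_xi s_rho 0)%:E)).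
Proof.
move=> indep lawxi lawrho _ ixi irho Exi Erho sx0 Vxi sr0 Vrho y0.
have low := discrete_lower indep lawxi lawrho ixi irho Exi Erho sx0 Vxi sr0 Vrho y0.
have up := discrete_upper lawxi lawrho ixi irho Exi Erho sx0 Vxi sr0 Vrho y0.
split=> [mr0|mr0 [C [C1 [n0 [_ HC]]]]].
  apply: cvg_EFin_of_bounds => eps eps0.
    exact: low (ratio_lim_recurrent _ sx0 sr0 mr0 y0) eps0.
  exists 1%N => // n n0.
  have le1 := discrete_le1 mu_xi mu_rho indep lawxi lawrho y0 n0.
  by apply: (le_trans le1); rewrite lee_fin lerDl ltW.
have yg := ratio_lim_transient mu_xi sx0 sr0 mr0 y0.
have HM := moment_condition mu_xi indep HC.
split.
  apply: cvg_EFin_of_bounds => eps eps0; first exact: low yg eps0.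
  by apply: up yg eps0 _; exists C.
move=> d' T' P' W W' Y BM Rp Xp mY cY YE.
have srmr := moment_rate (rho_law1 mu_xi indep irho Erho) (rho_law2 mu_xi indep Vrho) C1 HM.
rewrite -(ruin_probability BM mY cY YE sx0 sr0 y0 yg srmr).
by congr (P' _); apply/seteqP; split => w /=; [move/ruin_timeP|move=> ?; apply/ruin_timeP].
Qed.
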